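(* Let $(M,\omega)$ be a closed symplectic manifold such that the homomorphism $e:\Gamma\to\pi_1(M)$ is injective. Suppose further that either $\chi(M)\neq 0$ or $\pi_1(M)$ has finite center. Then the flux group $\Gamma$ is trivial.
   Context: $M$ is connected. $\chi(M)$ is the Euler characteristic. $\mathrm{Symp}_0(M,\omega)$ is the identity component of the group of symplectic diffeomorphisms of $(M,\omega)$. For a smooth path $\{\psi_t\}_{t\in[0,1]}$ in $\mathrm{Symp}_0(M,\omega)$ with $\psi_0=\mathrm{id}$, generated by the time-dependent vector field $X^t$, the flux is $\widetilde{\mathrm{Flux}}(\{\psi_t\})=\int_0^1[\iota_{X^t}\omega]\,dt\in H^1(M;\mathbb{R})$; it depends only on the homotopy class of the path with fixed endpoints, and defines a homomorphism on the universal cover of $\mathrm{Symp}_0(M,\omega)$. The flux group $\Gamma\subset H^1(M;\mathbb{R})$ is the image of $\pi_1(\mathrm{Symp}_0(M,\omega),\mathrm{id})$ under $\widetilde{\mathrm{Flux}}$. The evaluation homomorphism $ev:\pi_1(\mathrm{Symp}_0(M,\omega),\mathrm{id})\to\pi_1(M,x_0)$ is $ev([\{\psi_t\}])=[\{\psi_t(x_0)\}]$; its image lies in the center of $\pi_1(M,x_0)$ and the maps for different base points are identified. The $e$-homomorphism $e:\Gamma\to\pi_1(M)$ is the well-defined homomorphism determined by $e(\widetilde{\mathrm{Flux}}(\{\psi_t\}))=ev([\{\psi_t\}])$ for every loop $\{\psi_t\}$ in $\mathrm{Symp}_0(M,\omega)$ based at $\mathrm{id}$. *)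

(* Defs.v *)
From HB Require Import structures.
From mathcomp Require Import all_boot all_order all_algebra generic_quotient.
From mathcomp Require Import ring_quotient.
From mathcomp Require Import all_classical all_reals all_analysis homotopy lra.
Import Order.TTheory GRing.Theory Num.Theory.
Import numFieldNormedType.Exports.

Set Implicit Arguments.
Unset Strict Implicit.
Unset Printing Implicit Defensive.

Local Open Scope classical_set_scope.
Local Open Scope ring_scope.
Local Open Scope quotient_scope.

Notation unitI R := (set_type (`[0, 1]%classic : set R)).

Section UnitInterval.
Context {R : realType}.

Lemma clampP (t : R) : Num.max 0 (Num.min 1 t) \in (`[0, 1]%classic : set R).
Proof.
by rewrite inE /= in_itv /= le_max lexx /= ge_max ler01 ge_min lexx.
Qed.

Definition clamp (t : R) : unitI R := SigSub (clampP t).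

Lemma val_clamp t : val (clamp t) = Num.max 0 (Num.min 1 t). Proof. by []. Qed.

Lemma val_unitI (t : unitI R) : 0 <= val t <= 1.
Proof. by have := valP t; rewrite inE /= in_itv. Qed.

Lemma clampK (t : unitI R) : clamp (val t) = t.
Proof.
apply: val_inj; rewrite val_clamp; have /andP[t0 t1] := val_unitI t.
by rewrite (min_r t1) (max_r t0).
Qed.

Lemma clamp_le0 (t : R) : t <= 0 -> clamp t = clamp 0.
Proof.
by move=> t0; apply: val_inj; rewrite !val_clamp !min_r ?ler01// ?max_l// ltW// (le_lt_trans t0).
Qed.

Lemma clamp_ge1 (t : R) : 1 <= t -> clamp t = clamp 1.
Proof. by move=> t1; apply: val_inj; rewrite !val_clamp !min_l. Qed.

Lemma clamp_neq : clamp 0 != clamp 1.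
Proof.
apply/eqP => /(congr1 val); rewrite !val_clamp minxx min_r ?ler01 // maxxx.
by rewrite max_r ?ler01 // => /esym/eqP; rewrite oner_eq0.
Qed.

HB.instance Definition _ := isBiPointed.Build (unitI R) clamp_neq.

Lemma clamp_continuous : continuous clamp.
Proof.
apply: (@continuous_comp_initial _ _ _ set_val clamp) => t.
have -> : set_val \o clamp = (cst 0 : R -> R) \max ((cst 1 : R -> R) \min id).
  by apply/funext => s.
apply: continuous_max; first exact: cst_continuous.
by apply: continuous_min => //; exact: cst_continuous.
Qed.

Lemma val_continuous : continuous (val : unitI R -> R).
Proof. exact: initial_continuous. Qed.

Lemma paste_continuous (X T : topologicalType) (u : X -> R) (c : R) (F G : X -> T) :
  continuous u -> continuous F -> continuous G ->
  (forall x, u x = c -> F x = G x) ->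
  continuous (fun x => if u x <= c then F x else G x).
Proof.
move=> cu cF cG FG; set h := (fun x => _).
apply/continuous_subspace_setT.
have -> : [set: X] = (u @^-1` [set r | r <= c]) `|` (u @^-1` [set r | c <= r]).
  apply/seteqP; split => // x _ /=.
  by case: (leP (u x) c) => [|/ltW]; [left|right].
apply: withinU_continuous.
- by apply: preimage_closed => //; exact: closed_le.
- by apply: preimage_closed => //; exact: closed_ge.
- apply: (subspace_eq_continuous (f := F)); last exact: continuous_subspaceT.
  by move=> x; rewrite inE /h /from_subspace/= => ->.
- apply: (subspace_eq_continuous (f := G)); last exact: continuous_subspaceT.
  move=> x; rewrite inE /h /from_subspace/= => cux; case: ifPn => // uxc.
  by rewrite FG//; apply/eqP; rewrite eq_le uxc cux.
Qed.

Lemma val_zero : val (zero : unitI R) = 0.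
Proof. by rewrite val_clamp min_r ?ler01// maxxx. Qed.

Lemma val_one : val (one : unitI R) = 1.
Proof. by rewrite val_clamp minxx max_r// ler01. Qed.

Lemma pair_continuous (S T U : topologicalType) (p : S -> T) (q : S -> U) :
  continuous p -> continuous q -> continuous (fun t => (p t, q t)).
Proof. by move=> cp cq t; apply: cvg_pair; [exact: cp|exact: cq]. Qed.

Lemma half_ge0 : 0 <= 1 / 2 :> R. Proof. by lra. Qed.

Lemma one_gt_half : (1 <= 1 / 2 :> R) = false.
Proof. by apply/negbTE; lra. Qed.

Lemma dbl_half : 2 * (1 / 2) = 1 :> R. Proof. by lra. Qed.

Lemma dbl_one : 2 * 1 - 1 = 1 :> R. Proof. by lra. Qed.

End UnitInterval.

Section FundamentalGroup.
Context {R : realType} {T : topologicalType} (x : T).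

Notation loop := {path unitI R from x to x}.
Implicit Types f g h : loop.

Definition homotopy f g (H : unitI R * unitI R -> T) : Prop :=
  [/\ continuous H, (forall t, H (t, zero) = f t), (forall t, H (t, one) = g t)
    & forall s, H (zero, s) = x /\ H (one, s) = x].

Definition homotopic f g : bool := `[< exists H, homotopy f g H >].

Let ext f (t : R) : T := f (clamp t).

Let ext_cts f : continuous (ext f).
Proof.
by move=> t; apply: continuous_comp; [exact: clamp_continuous|exact: cts_fun].
Qed.

Let ext_le0 f t : t <= 0 -> ext f t = x.
Proof. by move=> t0; rewrite /ext clamp_le0// (path_zero (s := f)). Qed.

Let ext_ge1 f t : 1 <= t -> ext f t = x.
Proof. by move=> t0; rewrite /ext clamp_ge1// (path_one (s := f)). Qed.

Let extK f (t : unitI R) : ext f (val t) = f t.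
Proof. by rewrite /ext clampK. Qed.

Let contR (S : topologicalType) (c d : R) (p : S -> R) :
  continuous p -> continuous (fun t => c * p t + d : R).
Proof.
by move=> cp t; apply: cvgD; [apply: cvgM; [exact: cvg_cst|exact: cp]|exact: cvg_cst].
Qed.

Let scaleR (S : topologicalType) (c : R) (p : S -> R) :
  continuous p -> continuous (fun t => c * p t : R).
Proof. by move=> cp t; apply: cvgM; [exact: cvg_cst|exact: cp]. Qed.

Let oneBR (S : topologicalType) (p : S -> R) :
  continuous p -> continuous (fun t => 1 - p t : R).
Proof. by move=> cp t; apply: cvgD; [exact: cvg_cst|apply: cvgN; exact: cp]. Qed.

Section Concat.
Variables f g : loop.

Definition concat_fun (t : unitI R) : T :=
  if val t <= 1/2 then f (clamp (2 * val t)) else g (clamp (2 * val t - 1)).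

Lemma concat_fun_continuous : continuous concat_fun.
Proof.
apply: paste_continuous; first exact: val_continuous.
- move=> t; apply: (@continuous_comp _ _ _ (fun t : unitI R => 2 * val t) (ext f)).
    exact: scaleR (@val_continuous R) _.
  exact: ext_cts.
- move=> t; apply: (@continuous_comp _ _ _ (fun t : unitI R => 2 * val t - 1) (ext g)).
    exact: contR (@val_continuous R) _.
  exact: ext_cts.
- move=> t ->; rewrite dbl_half subrr.
  by rewrite (path_one (s := f)) (path_zero (s := g)).
Qed.

Lemma concat_fun0 : concat_fun zero = x.
Proof.
by rewrite /concat_fun val_zero mulr0 half_ge0 (path_zero (s := f)).
Qed.

Lemma concat_fun1 : concat_fun one = x.
Proof.
by rewrite /concat_fun val_one one_gt_half dbl_one (path_one (s := g)).
Qed.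

Definition concat : loop := mk_path concat_fun_continuous concat_fun0 concat_fun1.

End Concat.

Section Reverse.
Variable f : loop.

Definition reverse_fun (t : unitI R) : T := f (clamp (1 - val t)).

Lemma reverse_fun_continuous : continuous reverse_fun.
Proof.
move=> t; apply: (@continuous_comp _ _ _ (fun t : unitI R => 1 - val t) (ext f)).
  exact: oneBR (@val_continuous R) _.
exact: ext_cts.
Qed.

Lemma reverse_fun0 : reverse_fun zero = x.
Proof. by rewrite /reverse_fun val_zero subr0 (path_one (s := f)). Qed.

Lemma reverse_fun1 : reverse_fun one = x.
Proof. by rewrite /reverse_fun val_one subrr (path_zero (s := f)). Qed.

Definition reverse : loop :=
  mk_path reverse_fun_continuous reverse_fun0 reverse_fun1.

End Reverse.

Definition const_loop : loop := cst x.

Lemma reparam_homotopic f (a b : loop) (p q : R -> R) :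
  continuous p -> continuous q ->
  (forall t, a t = ext f (p (val t))) -> (forall t, b t = ext f (q (val t))) ->
  p 0 <= 0 -> q 0 <= 0 ->
  p 1 <= 0 /\ q 1 <= 0 \/ 1 <= p 1 /\ 1 <= q 1 ->
  homotopic a b.
Proof.
move=> cp cq ap bq p0 q0 pq1.
apply/asboolP; exists (fun ts => ext f ((1 - val ts.2) * p (val ts.1) + val ts.2 * q (val ts.1))).
split=> [|t|t|s].
- move=> ts; apply: (@continuous_comp _ _ _ (fun ts : unitI R * unitI R => (1 - val ts.2) * p (val ts.1) + val ts.2 * q (val ts.1)) (ext f)); last exact: ext_cts.
  have c1 : continuous (fun ts : unitI R * unitI R => val ts.1 : R).
    by move=> z; apply: continuous_comp; [exact: cvg_fst|exact: val_continuous].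
  have c2 : continuous (fun ts : unitI R * unitI R => val ts.2 : R).
    by move=> z; apply: continuous_comp; [exact: cvg_snd|exact: val_continuous].
  apply: cvgD; apply: cvgM.
  + exact: oneBR c2 _.
  + by apply: (@continuous_comp _ _ _ (fun ts : unitI R * unitI R => val ts.1 : R) p); [exact: c1|exact: cp].
  + exact: c2.
  + by apply: (@continuous_comp _ _ _ (fun ts : unitI R * unitI R => val ts.1 : R) q); [exact: c1|exact: cq].
- by rewrite val_zero subr0 mul1r mul0r addr0 ap.
- by rewrite val_one subrr mul1r mul0r add0r bq.
have /andP[s0 s1] := val_unitI s.
rewrite val_zero val_one; split; first by rewrite ext_le0//; nra.
by case: pq1 => -[p1 q1]; [rewrite ext_le0//; nra|rewrite ext_ge1//; nra].
Qed.

Lemma homotopic_refl : reflexive homotopic.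
Proof.
move=> f; apply: (@reparam_homotopic f _ _ id id) => //.
- by move=> t; exact: cvg_id.
- by move=> t; exact: cvg_id.
- by right.
Qed.

Lemma homotopic_sym : symmetric homotopic.
Proof.
suff h f g : homotopic f g -> homotopic g f by move=> f g; apply/idP/idP; exact: h.
move=> /asboolP[H [cH H0 H1 Hx]]; apply/asboolP.
exists (fun ts => H (ts.1, clamp (1 - val ts.2))); split => [|t|t|s]//.
- move=> ts; apply: (@continuous_comp _ _ _ (fun ts : unitI R * unitI R => (ts.1, clamp (1 - val ts.2))) H); last exact: cH.
  apply: pair_continuous => {}ts; first exact: cvg_fst.
  apply: (@continuous_comp _ _ _ (fun ts : unitI R * unitI R => 1 - val ts.2) clamp); last exact: clamp_continuous.
  apply: oneBR => {ts}ts.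
  by apply: continuous_comp; [exact: cvg_snd|exact: val_continuous].
- by rewrite val_zero subr0 H1.
- by rewrite val_one subrr H0.
Qed.

Lemma homotopic_trans : transitive homotopic.
Proof.
move=> g f h /asboolP[H [cH H0 H1 Hx]] /asboolP[K [cK K0 K1 Kx]]; apply/asboolP.
exists (fun ts => if val ts.2 <= 1/2 :> R then H (ts.1, clamp (2 * val ts.2)) else K (ts.1, clamp (2 * val ts.2 - 1))).
have c2 : continuous (fun ts : unitI R * unitI R => val ts.2 : R).
  by move=> z; apply: continuous_comp; [exact: cvg_snd|exact: val_continuous].
split=> [|t|t|s].
- apply: (@paste_continuous _ _ _ (fun ts : unitI R * unitI R => val ts.2)) => //.
  + move=> ts; apply: (@continuous_comp _ _ _ (fun ts : unitI R * unitI R => (ts.1, clamp (2 * val ts.2))) H); last exact: cH.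
    apply: pair_continuous => {}ts; first exact: cvg_fst.
    apply: (@continuous_comp _ _ _ (fun ts : unitI R * unitI R => 2 * val ts.2) clamp); last exact: clamp_continuous.
    exact: scaleR c2 _.
  + move=> ts; apply: (@continuous_comp _ _ _ (fun ts : unitI R * unitI R => (ts.1, clamp (2 * val ts.2 - 1))) K); last exact: cK.
    apply: pair_continuous => {}ts; first exact: cvg_fst.
    apply: (@continuous_comp _ _ _ (fun ts : unitI R * unitI R => 2 * val ts.2 - 1) clamp); last exact: clamp_continuous.
    exact: contR c2 _.
  + move=> [t s] /= ->; rewrite dbl_half subrr.
    by rewrite H1 K0.
- by rewrite val_zero mulr0 half_ge0 H0.
- by rewrite val_one one_gt_half dbl_one K1.
- by split; case: ifPn => _; rewrite ?(Hx _).1 ?(Hx _).2 ?(Kx _).1 ?(Kx _).2.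
Qed.

Canonical homotopic_equiv :=
  EquivRel homotopic homotopic_refl homotopic_sym homotopic_trans.

Definition pi1 := {eq_quot homotopic}.
HB.instance Definition _ := Choice.on pi1.
HB.instance Definition _ := EqQuotient.on pi1.

Lemma concat_homotopic f f' g g' :
  homotopic f f' -> homotopic g g' -> homotopic (concat f g) (concat f' g').
Proof.
move=> /asboolP[H [cH H0 H1 Hx]] /asboolP[K [cK K0 K1 Kx]]; apply/asboolP.
exists (fun ts => if val ts.1 <= 1/2 :> R then H (clamp (2 * val ts.1), ts.2) else K (clamp (2 * val ts.1 - 1), ts.2)).
have c1 : continuous (fun ts : unitI R * unitI R => val ts.1 : R).
  by move=> z; apply: continuous_comp; [exact: cvg_fst|exact: val_continuous].
split=> [|t|t|s].
- apply: (@paste_continuous _ _ _ (fun ts : unitI R * unitI R => val ts.1)) => //.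
  + move=> ts; apply: (@continuous_comp _ _ _ (fun ts : unitI R * unitI R => (clamp (2 * val ts.1), ts.2)) H); last exact: cH.
    apply: pair_continuous => {}ts; last exact: cvg_snd.
    apply: (@continuous_comp _ _ _ (fun ts : unitI R * unitI R => 2 * val ts.1) clamp); last exact: clamp_continuous.
    exact: scaleR c1 _.
  + move=> ts; apply: (@continuous_comp _ _ _ (fun ts : unitI R * unitI R => (clamp (2 * val ts.1 - 1), ts.2)) K); last exact: cK.
    apply: pair_continuous => {}ts; last exact: cvg_snd.
    apply: (@continuous_comp _ _ _ (fun ts : unitI R * unitI R => 2 * val ts.1 - 1) clamp); last exact: clamp_continuous.
    exact: contR c1 _.
  + move=> [t s] /= ->; rewrite dbl_half subrr.
    by rewrite (Hx s).2 (Kx s).1.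
- by rewrite /= /mk_path /concat_fun; case: ifP => _; rewrite ?H0 ?K0.
- by rewrite /= /mk_path /concat_fun; case: ifP => _; rewrite ?H1 ?K1.
- rewrite val_zero val_one mulr0 half_ge0; rewrite one_gt_half dbl_one.
  by split; [exact: (Hx s).1|exact: (Kx s).2].
Qed.

Lemma reverse_homotopic f g : homotopic f g -> homotopic (reverse f) (reverse g).
Proof.
move=> /asboolP[H [cH H0 H1 Hx]]; apply/asboolP.
exists (fun ts => H (clamp (1 - val ts.1), ts.2)); split => [|t|t|s].
- move=> ts; apply: (@continuous_comp _ _ _ (fun ts : unitI R * unitI R => (clamp (1 - val ts.1), ts.2)) H); last exact: cH.
  apply: pair_continuous => {}ts; last exact: cvg_snd.
  apply: (@continuous_comp _ _ _ (fun ts : unitI R * unitI R => 1 - val ts.1) clamp); last exact: clamp_continuous.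
  apply: oneBR => {ts}ts.
  by apply: continuous_comp; [exact: cvg_fst|exact: val_continuous].
- exact: H0.
- exact: H1.
- by rewrite val_zero val_one subr0 subrr; have [] := Hx s.
Qed.

Definition pi1_one : pi1 := lift_cst pi1 const_loop.
Definition pi1_mul := lift_op2 pi1 concat.
Definition pi1_inv := lift_op1 pi1 reverse.

Canonical pi_pi1_one := PiConst pi1_one.

Lemma pi_pi1_mul : {morph \pi : f g / concat f g >-> pi1_mul f g}.
Proof.
move=> f g; unlock pi1_mul; apply/eqP; rewrite piE.
by apply: concat_homotopic; apply/eqmodP; rewrite reprK.
Qed.
Canonical pi_pi1_mul_morph := PiMorph2 pi_pi1_mul.

Lemma pi_pi1_inv : {morph \pi : f / reverse f >-> pi1_inv f}.
Proof.
move=> f; unlock pi1_inv; apply/eqP; rewrite piE.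
by apply: reverse_homotopic; apply/eqmodP; rewrite reprK.
Qed.
Canonical pi_pi1_inv_morph := PiMorph1 pi_pi1_inv.

Let affR (c d : R) : continuous (fun t => c * t + d : R).
Proof. by apply: contR => t; exact: cvg_id. Qed.

Let ext_concat f g (s : R) :
  ext (concat f g) s = if s <= 1/2 then ext f (2 * s) else ext g (2 * s - 1).
Proof.
case: (leP s 0) => s0.
  by rewrite ext_le0// ifT ?ext_le0//; lra.
case: (leP 1 s) => s1.
  by rewrite ext_ge1// ifF ?ext_ge1//; [lra|apply/negbTE; lra].
have vs : val (clamp s) = s by rewrite val_clamp min_r 1?max_r// ltW.
by rewrite {1}/ext /concat /= /mk_path /concat_fun vs.
Qed.

Let concatE f g t : concat f g t =
  if val t <= 1/2 then ext f (2 * val t) else ext g (2 * val t - 1).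
Proof. by []. Qed.

Lemma pi1_mulA : associative pi1_mul.
Proof.
move=> a b c; rewrite -[a]reprK -[b]reprK -[c]reprK !piE.
set f := repr a; set g := repr b; set h := repr c; apply/eqmodP.
apply: (@reparam_homotopic (concat f (concat g h)) _ _ id
  ((fun t => 2 * t + 0) \min ((fun t => 1 * t + 1/4) \min (fun t => 1/2 * t + 1/2)))).
- by move=> t; exact: cvg_id.
- by move=> t; apply: continuous_min; [|apply: continuous_min]; exact: affR.
- by move=> t; rewrite extK.
- move=> t; have /andP[t0 t1] := val_unitI t.
  move: t0 t1; rewrite concatE ext_concat; generalize (val t) => {}t t0 t1; 
  rewrite (_ : (_ \min _) t =
    Num.min (2 * t + 0) (Num.min (1 * t + 1/4) (1/2 * t + 1/2)))//.
  have [t2|t2] := leP t (1/2).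
    rewrite ext_concat; have [t3|t3] := leP t (1/4).
      rewrite (min_l (y := _ + 1/2)); last lra.
      rewrite min_l; last lra.
      rewrite ifT; last lra.
      by rewrite ifT; [congr (ext f _); lra|lra].
    rewrite (min_l (y := _ + 1/2)); last lra.
    rewrite min_r; last lra.
    rewrite ifF; last (apply/negbTE; lra).
    rewrite ifF; last (apply/negbTE; lra).
    by rewrite ext_concat ifT; [congr (ext g _); lra|lra].
  rewrite (min_r (y := _ + 1/2)); last lra.
  rewrite min_r; last lra.
  rewrite ext_concat ifF; last (apply/negbTE; lra).
  by rewrite ext_concat ifF; [congr (ext h _); lra|apply/negbTE; lra].
- by [].
- by rewrite /= ge_min; apply/orP; left; lra.
- by right; split => //; rewrite /= !le_min; apply/and3P; split; lra.
Qed.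

Let ext_const (s : R) : ext const_loop s = x.
Proof. by []. Qed.

Lemma mul1pi1 : left_id pi1_one pi1_mul.
Proof.
move=> a; rewrite -[a]reprK !piE; set f := repr a; apply/eqmodP.
apply: (@reparam_homotopic f _ _ (fun t => 2 * t + -1) id).
- exact: affR.
- by move=> t; exact: cvg_id.
- move=> t; have /andP[t0 t1] := val_unitI t.
  rewrite concatE; case: ifPn => // t2.
  by rewrite ext_const ext_le0//; lra.
- by move=> t; rewrite extK.
- lra.
- by [].
- right; split=> //; lra.
Qed.

Lemma mulpi11 : right_id pi1_one pi1_mul.
Proof.
move=> a; rewrite -[a]reprK !piE; set f := repr a; apply/eqmodP.
apply: (@reparam_homotopic f _ _ (fun t => 2 * t + 0) id).
- exact: affR.
- by move=> t; exact: cvg_id.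
- move=> t; have /andP[t0 t1] := val_unitI t.
  rewrite concatE; case: ifPn => t2; first by rewrite addr0.
  by rewrite ext_const ext_ge1//; lra.
- by move=> t; rewrite extK.
- lra.
- by [].
- right; split=> //; lra.
Qed.

Let ext_reverse f (s : R) : ext (reverse f) s = ext f (1 - s).
Proof.
case: (leP s 0) => s0; first by rewrite ext_le0// ext_ge1//; lra.
case: (leP 1 s) => s1; first by rewrite ext_ge1// ext_le0//; lra.
have vs : val (clamp s) = s by rewrite val_clamp min_r 1?max_r// ltW.
by rewrite {1}/ext /reverse /= /mk_path /reverse_fun vs.
Qed.

Lemma mulpi1V : right_inverse pi1_one pi1_inv pi1_mul.
Proof.
move=> a; rewrite -[a]reprK !piE; set f := repr a; apply/eqmodP.
apply: (@reparam_homotopic f _ _ ((fun t => 2 * t + 0) \min (fun t => -2 * t + 2)) (fun=> 0)).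
- by move=> t; apply: continuous_min; exact: affR.
- by move=> t; exact: cvg_cst.
- move=> t; have /andP[t0 t1] := val_unitI t.
  rewrite (_ : (_ \min _) (val t) = Num.min (2 * val t + 0) (-2 * val t + 2))//.
  rewrite concatE; case: ifPn => t2.
    by rewrite min_l ?addr0//; lra.
  rewrite min_r; last by lra.
  by rewrite ext_reverse; congr (ext f _); lra.
- by move=> t; rewrite ext_le0.
- by rewrite /= ge_min; apply/orP; left; lra.
- by [].
- by left; split => //; rewrite /= ge_min; apply/orP; right; lra.
Qed.

Lemma reverseK f : reverse (reverse f) = f.
Proof.
apply/path_eqP => t; rewrite -!extK !ext_reverse.
by congr (ext f _); lra.
Qed.

Lemma mulVpi1 : left_inverse pi1_one pi1_inv pi1_mul.
Proof.
move=> a; have := mulpi1V (pi1_inv a).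
by rewrite -[a]reprK -!pi_pi1_inv reverseK.
Qed.

HB.instance Definition _ :=
  isGroup.Build pi1 pi1_mulA mul1pi1 mulpi11 mulVpi1 mulpi1V.

End FundamentalGroup.

Arguments pi1 R {T} x.

Section SingularHomology.
Context (R : realType) (X : topologicalType).

Definition std_simplex (k : nat) : set 'rV[R]_k.+1 :=
  [set v | (forall i, 0 <= v 0 i) /\ \sum_i v 0 i = 1].

#[local] Arguments std_simplex : clear implicits.

Definition face_map (k : nat) (i : 'I_k.+2) (v : 'rV[R]_k.+1) : 'rV[R]_k.+2 :=
  \row_j oapp (v 0) 0 (unlift i j).

Lemma face_mapP k i (v : std_simplex k) : face_map i (val v) \in std_simplex k.+1.
Proof.
have /set_mem[v0 v1] := valP v; rewrite inE; split=> /= [j|].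
  by rewrite mxE; case: unliftP => [j' _|] /=.
rewrite (bigD1_ord i)//= mxE unlift_none add0r -v1.
by apply: eq_bigr => j _; rewrite mxE liftK.
Qed.

Definition face k (i : 'I_k.+2) (v : std_simplex k) : std_simplex k.+1 :=
  SigSub (face_mapP i v).

Definition singular_simplex k := continuousType (std_simplex k) X.
HB.instance Definition _ k := Choice.on (singular_simplex k).

(** A chain is a finitely supported function on singular simplices. *)
Definition is_chain k (c : singular_simplex k -> rat) : Prop :=
  finite_set [set s | c s != 0].

Definition boundary k (c : singular_simplex k.+1 -> rat) : singular_simplex k -> rat :=
  fun t => \sum_(i < k.+2)
    (-1) ^+ i * \sum_(s \in [set s : singular_simplex k.+1 | s \o face i = t]) c s.

Definition is_cycle k : (singular_simplex k -> rat) -> Prop :=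
  match k with
  | 0 => @is_chain 0
  | k'.+1 => fun c => is_chain c /\ boundary c = 0
  end.

Definition homologous k (c c' : singular_simplex k -> rat) : Prop :=
  exists2 d, is_chain d & c - c' = boundary d.

(** [b] is the dimension of the [k]-th homology: some family of [b] cycles
    represents a basis of cycles modulo boundaries. *)
Definition is_betti k (b : nat) : Prop :=
  exists2 z : 'I_b -> singular_simplex k -> rat, forall i, is_cycle (z i) &
    forall c, is_cycle c ->
      exists! a : 'rV[rat]_b, homologous c (fun s => \sum_i a 0 i * z i s).

Definition is_euler_char (chi : int) : Prop :=
  exists b N, [/\ forall k, is_betti k (b k), forall k, (N <= k)%N -> b k = 0%N
    & chi = \sum_(k < N) (-1) ^+ k * (b k)%:Z].

(** The value is the junk [0] when the total rational homology is infinite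
    dimensional, which does not happen for compact manifolds. *)
Definition euler_char : int := xget 0 is_euler_char.

End SingularHomology.

Section Smooth.
Context {R : realType} {V W : normedModType R}.

Definition iter_derive (s : seq V) (f : V -> W) : V -> W :=
  foldr (fun v g x => 'D_v g x) f s.

(** For [V] finite dimensional and [U] open this is smoothness on [U]: all
    iterated directional derivatives exist and are continuous. *)
Definition smooth_on (U : set V) (f : V -> W) : Prop :=
  forall s x, U x -> {for x, continuous (iter_derive s f)} /\
                     forall v, derivable (iter_derive s f) x v.

Lemma iter_deriveB (U : set V) f g : open U -> smooth_on U f -> smooth_on U g ->
  forall s x, U x ->
    iter_derive s (f - g) x = (iter_derive s f - iter_derive s g) x.
Proof.
move=> oU sf sg; elim=> //= v s IH x Ux.
rewrite (@near_eq_derive _ _ _ _ (iter_derive s f - iter_derive s g)).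
- by rewrite deriveB//; [exact: (sf _ _ Ux).2|exact: (sg _ _ Ux).2].
- near=> y; apply: IH; near: y; exact: open_nbhs_nbhs.
Unshelve. all: by end_near. Qed.

Lemma iter_derive0 s : iter_derive s 0 = 0.
Proof. by elim: s => //= v s ->; apply/funext => x; exact: derive_cst. Qed.

Lemma smooth_on0 (U : set V) : smooth_on U 0.
Proof.
move=> s x _; rewrite iter_derive0; split; first exact: cst_continuous.
by move=> v; exact: (derivable_cst 0).
Qed.

Lemma smooth_onB (U : set V) f g : open U ->
  smooth_on U f -> smooth_on U g -> smooth_on U (f - g).
Proof.
move=> oU sf sg s x Ux.
have H : {near x, iter_derive s f - iter_derive s g =1 iter_derive s (f - g)}.
  near=> y; apply/esym; apply: (iter_deriveB oU sf sg); near: y.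
  exact: open_nbhs_nbhs.
split; last first.
  move=> v; apply: near_eq_derivable H _.
  by apply: derivableB; [exact: (sf _ _ Ux).2|exact: (sg _ _ Ux).2].
have E := iter_deriveB oU sf sg s Ux.
apply: cvg_trans; first exact: near_eq_cvg H.
rewrite -[nbhs _]/(nbhs _) E.
by apply: cvgB; [exact: (sf _ _ Ux).1|exact: (sg _ _ Ux).1].
Unshelve. all: by end_near. Qed.

End Smooth.

(** A smooth manifold of dimension [dim] given by an atlas indexed by [idx];
    [phi i] is a homeomorphism from the open set [dom i] onto an open set, with
    inverse [phi_inv i]. Values of [phi i] off [dom i], and of [phi_inv i] off
    [phi i @` dom i], are irrelevant. *)
Record manifold (R : realType) := Manifold {
  carrier :> topologicalType;
  dim : nat;
  idx : Type;
  dom : idx -> set carrier;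
  phi : idx -> carrier -> 'rV[R]_dim;
  phi_inv : idx -> 'rV[R]_dim -> carrier;
  manifold_hausdorff : hausdorff_space carrier;
  manifold_second_countable : @second_countable carrier;
  dom_cover : \bigcup_i dom i = [set: carrier];
  dom_open : forall i, open (dom i);
  phi_dom_open : forall i, open (phi i @` dom i);
  phi_continuous : forall i, {within dom i, continuous (phi i)};
  phi_inv_continuous : forall i, {within phi i @` dom i, continuous (phi_inv i)};
  phiK : forall i, {in dom i, cancel (phi i) (phi_inv i)};
  transition_smooth : forall i j,
    smooth_on (phi i @` (dom i `&` dom j)) (phi j \o phi_inv i)
}.

Section Manifold.
Context {R : realType} (M : manifold R).
Local Notation n := (dim M).
Local Notation I := (idx M).
Implicit Types (i j : I) (p q : M).

Definition smooth_fun (f : M -> R) : Prop :=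
  forall i, smooth_on (phi i @` dom i) (f \o phi_inv i).

Definition local_rep (f : M -> M) i j : 'rV[R]_n -> 'rV[R]_n :=
  phi j \o f \o phi_inv i.

Definition smooth_map (f : M -> M) : Prop :=
  continuous f /\
  forall i j, smooth_on (phi i @` (dom i `&` f @^-1` dom j)) (local_rep f i j).

Definition smooth_isotopy (F : R * M -> M) : Prop :=
  continuous F /\
  forall i j, smooth_on
    [set ty : R^o * 'rV[R]_n |
       (phi i @` dom i) ty.2 /\ dom j (F (ty.1, phi_inv i ty.2))]
    (fun ty => phi j (F (ty.1, phi_inv i ty.2))).

(** Differential of [f] at [p] in the charts [i] and [j]; with the conventions
    of [jacobian] it acts on row vectors by right multiplication. *)
Definition jac (f : M -> M) i j p : 'M[R]_n :=
  jacobian (local_rep f i j) (phi i p).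

(** Partial derivative in the chart [i], in the direction of the [a]-th
    coordinate. *)
Definition partial (V : normedModType R) i (a : 'I_n) (f : M -> V) p : V :=
  'D_(delta_mx 0 a) (f \o phi_inv i) (phi i p).

Lemma smooth_map_id : smooth_map id.
Proof.
by split=> [p|i j]; [exact: cvg_id|exact: transition_smooth].
Qed.

(** A 1-form is given by its coefficients: [al i p] is the row of the
    coefficients at [p] in the chart [i]. Only [p] in [dom i] matters; the
    values at other points are arbitrary, and disappear in [H1] below. *)
Definition preform1 := I -> M -> 'rV[R]_n.
HB.instance Definition _ := GRing.Zmodule.on preform1.

Definition is_closed_form1 (al : preform1) : Prop :=
  [/\ forall i j p, dom i p -> dom j p -> al i p = al j p *m (jac id i j p)^T,
      forall i, smooth_on (phi i @` dom i) (al i \o phi_inv i)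
    & forall i p a b, dom i p ->
        partial i a (al i) p 0 b = partial i b (al i) p 0 a].

Definition closed_form1_pred : {pred preform1} :=
  fun al => `[< is_closed_form1 al >].

Lemma partialB (V : normedModType R) i a (f g : M -> V) p : dom i p ->
  smooth_on (phi i @` dom i) (f \o phi_inv i) ->
  smooth_on (phi i @` dom i) (g \o phi_inv i) ->
  partial i a (f - g) p = partial i a f p - partial i a g p.
Proof.
move=> ip fS gS; have ipp : (phi i @` dom i) (phi i p) by exists p.
have [_ df] := fS [::] _ ipp; have [_ dg] := gS [::] _ ipp.
exact: (deriveB (df _) (dg _)).
Qed.

Lemma rowB (u v : 'rV[R]_n) b : (u - v) 0 b = u 0 b - v 0 b.
Proof. by rewrite !mxE. Qed.

Lemma closed_form1_zmod_closed : zmod_closed closed_form1_pred.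
Proof.
split=> [|al be /asboolP[alC alS alD] /asboolP[beC beS beD]]; apply/asboolP.
- split=> [i j p _ _|i|i p a b _].
  + by rewrite mul0mx.
  + exact: smooth_on0.
  + have E : ((0 : preform1) i : M -> 'rV[R]_n) \o phi_inv i = cst 0 by [].
    by rewrite /partial E !derive_cst !mxE.
- have E i : (al - be) i \o phi_inv i =
             (al i \o phi_inv i) - (be i \o phi_inv i) by [].
  split=> [i j p ip jp|i|i p a b ip].
  + by rewrite [LHS](_ : _ = al i p - be i p)// (alC i j)// (beC i j)// -mulmxBl.
  + by rewrite E; apply: smooth_onB => //; exact: phi_dom_open.
  + have P c d : partial i c ((al - be) i) p 0 d =
                 partial i c (al i) p 0 d - partial i c (be i) p 0 d.
      by rewrite -rowB; congr (fun_of_matrix _ _ _); exact: partialB.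
    apply: etrans (P a b) _; apply: etrans _ (esym (P b a)).
    by congr (_ - _); [exact: alD|exact: beD].
Qed.

HB.instance Definition _ :=
  GRing.isZmodClosed.Build preform1 closed_form1_pred closed_form1_zmod_closed.

Record closed_form1 := ClosedForm1 {
  form1 :> preform1;
  form1P : form1 \in closed_form1_pred
}.

HB.instance Definition _ := [isSub for form1].
HB.instance Definition _ := [Choice of closed_form1 by <:].
HB.instance Definition _ := [SubChoice_isSubZmodule of closed_form1 by <:].

Definition exact_form1_pred : {pred closed_form1} :=
  fun al => `[< exists2 f : M -> R^o, smooth_fun f &
    forall i p a, dom i p -> form1 al i p 0 a = partial i a f p >].

Lemma exact_form1_zmod_closed : zmod_closed exact_form1_pred.
Proof.
split=> [|al be /asboolP[f fS fE] /asboolP[g gS gE]]; apply/asboolP.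
- exists 0 => [i|i p a ip]; first exact: smooth_on0.
  have E : (0 : M -> R^o) \o phi_inv i = cst 0 by [].
  by rewrite /partial E derive_cst -[form1 0]/(val 0) raddf0 mxE.
- have E i : (f - g) \o phi_inv i = (f \o phi_inv i) - (g \o phi_inv i) by [].
  exists (f - g) => [i|i p a ip].
    by rewrite E; apply: smooth_onB => //; exact: phi_dom_open.
  rewrite partialB// -fE// -gE//.
  by rewrite -[form1 _]/(val (al - be)) raddfB !mxE.
Qed.

HB.instance Definition _ := GRing.isZmodClosed.Build closed_form1
  exact_form1_pred exact_form1_zmod_closed.

Definition H1 := Quotient.quot exact_form1_pred.
HB.instance Definition _ := GRing.Zmodule.on H1.

End Manifold.

(** [w] is the pull-back of [w] by [f], for a 2-form [w] given by its matrices
    of coefficients in the charts. *)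
Definition preserves (R : realType) (M : manifold R)
    (w : idx M -> M -> 'M[R]_(dim M)) (f : M -> M) : Prop :=
  forall i j p, dom i p -> dom j (f p) ->
    w i p = jac f i j p *m w j (f p) *m (jac f i j p)^T.

(** [form2 i p] is the matrix of the form at [p] in the chart [i]:
    omega(u, v) = u *m form2 i p *m v^T. It only matters for [p] in [dom i]. *)
Record symplectic_form (R : realType) (M : manifold R) := SymplecticForm {
  form2 :> idx M -> M -> 'M[R]_(dim M);
  form2_compatible : preserves form2 id;
  form2_smooth : forall i, smooth_on (phi i @` dom i) (form2 i \o phi_inv i);
  form2_alternating : forall i p, dom i p -> (form2 i p)^T = - form2 i p;
  form2_nondegenerate : forall i p, dom i p -> form2 i p \in unitmx;
  form2_closed : forall i p a b c, dom i p ->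
    partial i a (form2 i) p b c + partial i b (form2 i) p c a +
      partial i c (form2 i) p a b = 0
}.

Section Symplectic.
Context {R : realType} {M : manifold R} (w : symplectic_form M).
Local Notation n := (dim M).

Record symp := Symp {
  symp_fun :> M -> M;
  symp_inv : M -> M;
  symp_smooth : smooth_map symp_fun;
  symp_inv_smooth : smooth_map symp_inv;
  symp_funK : cancel symp_fun symp_inv;
  symp_invK : cancel symp_inv symp_fun;
  symp_preserves : preserves w symp_fun
}.

Definition symp_id : symp := Symp (@smooth_map_id R M) (@smooth_map_id R M)
  (fun=> erefl) (fun=> erefl) (form2_compatible w).

(** Subbasic neighbourhoods of the C^oo topology: on a compact set [K] lying in
    the chart [i] and mapped into the chart [j], an iterated derivative stays
    close to that of [f]. *)
Definition symp_nbhd (f : symp) (i j : idx M) (K : set M)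
    (s : seq 'rV[R]_n) (eps : R) : set symp :=
  [set g : symp | g @` K `<=` dom j /\ forall p, K p ->
    `|iter_derive s (local_rep g i j) (phi i p) -
      iter_derive s (local_rep f i j) (phi i p)| < eps].

Definition symp_subbase : set (set symp) :=
  [set B | exists (f : symp) i j (K : set M) s (eps : R),
     [/\ compact K, K `<=` dom i, f @` K `<=` dom j, 0 < eps &
         B = symp_nbhd f i j K s eps]].

HB.instance Definition _ := gen_eqMixin symp.
HB.instance Definition _ := gen_choiceMixin symp.
HB.instance Definition _ := isSubBaseTopological.Build symp symp_subbase id.

Definition Symp0 : set symp := connected_component [set: symp] symp_id.

(** A path is a function on [R] of which only the restriction to [0, 1]
    matters; smoothness up to the end points means that it extends smoothly
    past them. *)
Definition smooth_path (psi : R -> symp) : Prop :=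
  exists2 F, smooth_isotopy F & forall t p, 0 <= t <= 1 -> F (t, p) = psi t p.

(** The vector field X^t generating [psi], in the chart [i] at the point [q]:
    the time derivative at [t] of psi_s (psi_t^-1 q). *)
Definition velocity (psi : R -> symp) (t : R) (i : idx M) (q : M) : 'rV[R]_n :=
  derive1 (fun s : R => phi i (psi s (symp_inv (psi t) q))) t.

(** The coefficients of the integral over [0, 1] of the contraction
    omega(X^t, -). *)
Definition flux_form (psi : R -> symp) : preform1 M := fun i q =>
  \row_a \int[lebesgue_measure]_(t in `[0, 1])
           (velocity psi t i q *m w i q) 0 a.

(** [flux_form psi] is a closed form for every smooth path [psi]; [insubd] only
    packs it as an element of [closed_form1 M]. *)
Definition flux (psi : R -> symp) : H1 M :=
  \pi_(H1 M) (insubd (0 : closed_form1 M) (flux_form psi)).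

Record symp_loop := SympLoop {
  loop_path :> R -> symp;
  loop_smooth : smooth_path loop_path;
  loop_Symp0 : forall t, 0 <= t <= 1 -> Symp0 (loop_path t);
  loop0 : loop_path 0 = symp_id;
  loop1 : loop_path 1 = symp_id
}.

(** Only smooth loops are considered: every class of
    [pi_1(Symp0)] has a smooth representative, and the flux only depends on the
    class. *)
Definition Gamma : set (H1 M) := range (fun psi : symp_loop => flux psi).

Section Evaluation.
Variables (x0 : M) (psi : symp_loop).

Definition orbit_fun (t : unitI R) : M := psi (val t) x0.

Lemma orbit_fun_continuous : continuous orbit_fun.
Proof.
case: (loop_smooth psi) => F [cF _] FE.
have -> : orbit_fun = F \o (fun t : unitI R => (val t, x0)).
  by apply/funext => t /=; rewrite FE ?val_unitI.
move=> t; apply: continuous_comp; last exact: cF.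
by apply: pair_continuous; [exact: val_continuous|exact: cst_continuous].
Qed.

Lemma orbit_fun0 : orbit_fun zero = x0.
Proof. by rewrite /orbit_fun val_zero loop0. Qed.

Lemma orbit_fun1 : orbit_fun one = x0.
Proof. by rewrite /orbit_fun val_one loop1. Qed.

Definition orbit_loop : {path unitI R from x0 to x0} :=
  mk_path orbit_fun_continuous orbit_fun0 orbit_fun1.

Definition ev : pi1 R x0 := \pi_(pi1 R x0) orbit_loop.

End Evaluation.

(** These equations determine [e], and imply that it is a homomorphism since
    flux and evaluation are. *)
Definition is_e_homomorphism (x0 : M) (e : Gamma -> pi1 R x0) : Prop :=
  forall (psi : symp_loop) (c : Gamma), val c = flux psi -> e c = ev x0 psi.

End Symplectic.

Definition group_center (G : groupType) : set G :=
  [set a | forall b, (a * b = b * a)%g].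

Arguments group_center : clear implicits.

(* Main.v *)
(** By the definition of [e] and its injectivity, loops of symplectic
    diffeomorphisms with the same evaluation have the same flux. Running a loop
    twice, with a time change that is constant near the end points, doubles its
    flux (the primitive of the integrand is composed with the time change).

    If the center is finite, then the evaluations of the iterated doubles of a
    loop, which are central, are not pairwise distinct; so a non-zero multiple
    of its flux vanishes, and [H1] is torsion free.

    If the Euler characteristic is not zero, then all the evaluations are
    trivial (Gottlieb): a loop [f] of self-maps of [M] starting at the identity
    has a null-homotopic orbit. To see this, count the fixed points of [f t] at
    which the orbit up to time [t] is null-homotopic. Algebraically, this is a
    supertrace on the nerve of a fine cover, weighted by the class of the orbit,
    which is locally constant near the fixed points; hence it does not depend on
    [t]. At [t = 0] it is the Euler characteristic, by the Hopf trace formula,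
    and at [t = 1] it is zero unless the orbits are null-homotopic. The
    comparison of the nerve with singular homology uses that [M] is a Euclidean
    neighbourhood retract, and iterated barycentric subdivision. *)

Require Import Defs.
From HB Require Import structures.
From mathcomp Require Import all_boot all_order all_algebra finmap monalg.
Import Order.TTheory GRing.Theory Num.Theory.

Set Implicit Arguments.
Unset Strict Implicit.
Unset Printing Implicit Defensive.

Local Open Scope ring_scope.

(** A weighted trace is not a homological invariant, as the weight does not commute with chain maps.
    So the traces at two nearby times are compared at chain level, in one finite complex and with
    one number of subdivisions for all times. A chain homotopy enters the difference of the traces
    only through pairs formed by a flag and one of its faces; their base points are close to each
    other and almost fixed, so that they carry the same weight. This is why a weight that is locally
    constant near the fixed points suffices. The chain maps and homotopies on tuples are built by
    coning off the image of the boundary, starting from the empty tuple. For the homotopies that are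
    pushed to [M], the point to check is that the cones stay in small sets, on whose hulls the
    retraction onto [M] is continuous. Smoothness is expressed by iterated directional derivatives,
    so that a change of time in an isotopy requires its own chain rule, proved from the mean value
    theorem. *)

Notation formal T := {malg rat[T]}.
Notation chain T := {malg rat[seq T]}.

(** * Linear extension of maps to finitely supported rational sums *)

Section LinearExtension.
Context {K : choiceType} {V : lmodType rat}.
Implicit Types (f g : K -> V) (c d : formal K).

Lemma mem_msupp c x : (x \in msupp c) = (c@_x != 0).
Proof. by rewrite -mcoeff_neq0. Qed.

Lemma scale_fsU (a k : rat) (x : K) :
  a *: << k *g x >> = << a * k *g x >> :> formal K.
Proof. by apply/malgP => y; rewrite mcoeffZ !mcoeffU mulrnAr. Qed.

Definition lin f c : V := \sum_(x <- msupp c) c@_x *: f x.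

Lemma lin_sub f c (S : {fset K}) : {subset msupp c <= S} ->
  lin f c = \sum_(x <- S) c@_x *: f x.
Proof.
move=> cS; rewrite /lin; apply: big_fset_incl => [|x xS xc]; first exact/fsubsetP.
by rewrite (mcoeff_outdom xc) scale0r.
Qed.

Lemma lin_is_linear f : linear (lin f).
Proof.
move=> a c d; pose S := (msupp c `|` msupp d)%fset.
have Sc : {subset msupp c <= S} by move=> x xc; rewrite in_fsetU xc.
have Sd : {subset msupp d <= S} by move=> x xd; rewrite in_fsetU xd orbT.
have Scd : {subset msupp (a *: c + d) <= S}.
  move=> x; rewrite in_fsetU !mem_msupp mcoeffD mcoeffZ.
  by case: (eqVneq c@_x 0) => //= ->; rewrite mulr0 add0r.
rewrite (lin_sub f Sc) (lin_sub f Sd) (lin_sub f Scd) scaler_sumr -big_split.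
by apply: eq_bigr => x _; rewrite mcoeffD mcoeffZ scalerDl scalerA.
Qed.
HB.instance Definition _ f :=
  GRing.isLinear.Build rat (formal K) V *:%R (lin f) (lin_is_linear f).

Lemma linU f x : lin f << x >> = f x.
Proof.
by rewrite /lin msuppU oner_eq0 big_seq_fset1 mcoeffUU scale1r.
Qed.

Lemma linE f c : lin f c = \sum_(x <- msupp c) c@_x *: f x.
Proof. by []. Qed.

Lemma eq_lin_in f g c : {in msupp c, f =1 g} -> lin f c = lin g c.
Proof. by move=> fg; rewrite !linE; apply: eq_big_seq => x /fg ->. Qed.

Lemma eq_lin f g : f =1 g -> lin f =1 lin g.
Proof. by move=> fg c; apply: eq_lin_in. Qed.

Lemma lin_unique (F : {linear formal K -> V}) c :
  F c = lin (fun x => F << x >>) c.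
Proof.
rewrite [in LHS](monalgE c) linE raddf_sum; apply: eq_bigr => x _.
by rewrite -linearZ /= scale_fsU mulr1.
Qed.

Lemma linB_fun f g c : lin (fun x => f x - g x) c = lin f c - lin g c.
Proof. by rewrite !linE -sumrB; apply: eq_bigr => x _; rewrite scalerBr. Qed.

End LinearExtension.

Lemma lin_id (K : choiceType) (c : formal K) : lin (fun x => << x >> : formal K) c = c.
Proof. by rewrite -(lin_unique idfun). Qed.

Lemma lin_comp (K : choiceType) (V W : lmodType rat) (F : {linear V -> W})
  (f : K -> V) c : F (lin f c) = lin (F \o f) c.
Proof. by rewrite !linE raddf_sum; apply: eq_bigr => x _; exact: linearZ_LR. Qed.

Lemma lin_compU (K L : choiceType) (V : lmodType rat) (f : K -> formal L)
  (g : L -> V) c : lin g (lin f c) = lin (fun x => lin g (f x)) c.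
Proof. exact: (lin_comp (lin g)). Qed.

Lemma coeff_lin (K L : choiceType) (f : K -> formal L) c y :
  (lin f c)@_y = \sum_(x <- msupp c) c@_x * (f x)@_y.
Proof. by rewrite linE raddf_sum; apply: eq_bigr => x _; rewrite /= mcoeffZ. Qed.

Lemma msupp_lin (K L : choiceType) (f : K -> formal L) c y :
  y \in msupp (lin f c) -> exists2 x, x \in msupp c & y \in msupp (f x).
Proof.
rewrite mem_msupp coeff_lin => cy.
have [x xc /andP[_ fx]] : exists2 x, x \in msupp c & (c@_x != 0) && ((f x)@_y != 0).
  apply/hasP; apply: contraNT cy => /hasPn H; rewrite big_seq big1// => x /H.
  by rewrite negb_and !negbK => /orP[]/eqP ->; rewrite ?mul0r ?mulr0.
by exists x => //; rewrite mem_msupp.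
Qed.

Section Carried.
Context {K : choiceType}.
Implicit Types (Q : K -> Prop) (c d : formal K).

Definition carried Q c := forall x, x \in msupp c -> Q x.

Lemma carried0 Q : carried Q 0.
Proof. by move=> x; rewrite mem_msupp mcoeff0 eqxx. Qed.

Lemma carriedU Q x : Q x -> carried Q << x >>.
Proof. by move=> Qx y; rewrite msuppU oner_eq0 in_fset1 => /eqP ->. Qed.

Lemma carriedD Q c d : carried Q c -> carried Q d -> carried Q (c + d).
Proof.
move=> Qc Qd x /(fsubsetP (msuppD_le _ _)).
by rewrite in_fsetU => /orP[/Qc|/Qd].
Qed.

Lemma carriedN Q c : carried Q c -> carried Q (- c).
Proof. by move=> Qc x; rewrite msuppN => /Qc. Qed.

Lemma carriedB Q c d : carried Q c -> carried Q d -> carried Q (c - d).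
Proof. by move=> Qc Qd; apply: carriedD => //; exact: carriedN. Qed.

Lemma sub_carried Q Q' c : (forall x, Q x -> Q' x) -> carried Q c -> carried Q' c.
Proof. by move=> QQ' Qc x /Qc/QQ'. Qed.

End Carried.

Lemma carried_lin (K L : choiceType) (Q : L -> Prop) (f : K -> formal L) c :
  (forall x, x \in msupp c -> carried Q (f x)) -> carried Q (lin f c).
Proof. by move=> Qf y /msupp_lin[x xc /(Qf x xc)]. Qed.

Definition ents (T : eqType) (Q : T -> Prop) (s : seq T) :=
  forall x, x \in s -> Q x.

(** * The augmented complex of ordered tuples *)

Section Cone.
Context {T : choiceType}.
Implicit Types (s : seq T) (c : chain T).

Definition cone (x : T) : chain T -> chain T :=
  lin (fun s => << x :: s >> : chain T).
HB.instance Definition _ x := GRing.Linear.on (cone x).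

Lemma coneU x s : cone x << s >> = << x :: s >>.
Proof. exact: linU. Qed.

(* The boundary of the augmented complex of ordered tuples: the empty tuple
   spans the degree -1. *)
Fixpoint bd1 s : chain T :=
  if s is x :: s' then << s' >> - cone x (bd1 s') else 0.
Definition bd : chain T -> chain T := lin bd1.
HB.instance Definition _ := GRing.Linear.on bd.

Lemma bdU s : bd << s >> = bd1 s.
Proof. exact: linU. Qed.

(** Thanks to the empty tuple in degree -1, degree 0 is no exception: the boundary of a single
    vertex is the empty tuple. *)
Lemma bd_cone x c : bd (cone x c) = c - cone x (bd c).
Proof.
rewrite /bd /cone !lin_compU -[X in X - _]lin_id -linB_fun.
by apply: eq_lin => s; rewrite linU.
Qed.

Lemma bd1K s : bd (bd1 s) = 0.
Proof.
elim: s => [|x s IH]; first by rewrite raddf0.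
by rewrite raddfB /= bd_cone IH raddf0 subr0 bdU subrr.
Qed.

Lemma bdK c : bd (bd c) = 0.
Proof.
rewrite /bd lin_compU (eq_lin (g := fun=> 0)); last exact: bd1K.
by rewrite linE big1 // => s _; rewrite scaler0.
Qed.

Lemma carried_cone (Q : seq T -> Prop) x c :
  carried (fun s => Q (x :: s)) c -> carried Q (cone x c).
Proof. by move=> Qc; apply: carried_lin => s /Qc; exact: carriedU. Qed.

Lemma carried_bd1 s :
  carried (fun t => subseq t s /\ size t = (size s).-1) (bd1 s).
Proof.
elim: s => [|x s IH] /=; first exact: carried0.
apply: carriedB; first by apply: carriedU; split=> //; exact: subseq_cons.
apply: carried_cone => t ts; have [sts st] := IH _ ts.
rewrite /= eqxx sts st; split=> //.
by case: s {IH sts} ts st => //= /(@carried0 _ (fun=> False)).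
Qed.

Lemma size_bd1 n s t : size s = n.+1 -> t \in msupp (bd1 s) -> size t = n.
Proof. by move=> sn /carried_bd1[_ ->]; rewrite sn. Qed.

End Cone.

Section ConeRecursion.
Context {T : choiceType} {V : lmodType rat}.
Variables (base : V) (Phi : seq T -> V -> V).

(** The recursive calls are on the faces in the support of a formal sum, which are not subterms of
    [s]; the length of [s] serves as fuel, and [crecE] recovers the intended equation. *)
Fixpoint crec_fuel n s : V :=
  if n is n'.+1 then Phi s (lin (crec_fuel n') (bd1 s)) else base.
Definition crec s := crec_fuel (size s) s.

Lemma crec_nil : crec [::] = base. Proof. by []. Qed.

Lemma crecE s : s <> [::] -> crec s = Phi s (lin crec (bd1 s)).
Proof.
case: s => // x s _; rewrite /crec /=; congr (Phi _ _).
by apply: eq_lin_in => t tb; rewrite (@size_bd1 _ (size s) (x :: s) t erefl tb).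
Qed.

End ConeRecursion.

(** Shaped for [crec]: by [subseq_bd1] the faces of [s] are shorter subsequences, and keeping
    [subseq] lets properties inherited by faces pass through the induction. *)
Lemma chain_ind (T : choiceType) (P : seq T -> Prop) :
  P [::] -> (forall s, s <> [::] ->
     (forall t, subseq t s -> (size t < size s)%N -> P t) -> P s) ->
  forall s, P s.
Proof.
move=> P0 IH s; move: {2}(size s).+1 (ltnSn (size s)) => n.
elim: n s => [|n IHn] [|x s] //.
rewrite ltnS => sn; apply: IH => // t _ ts; apply: IHn.
exact: leq_trans ts sn.
Qed.

Lemma subseq_bd1 (T : choiceType) (s t : seq T) : s <> [::] ->
  t \in msupp (bd1 s) -> subseq t s /\ (size t < size s)%N.
Proof.
by case: s => // x s _ /carried_bd1[ts ->]; rewrite /= ltnS leqnn.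
Qed.

(* A map defined by coning off the image of the boundary is a chain map, as
   soon as the cones are cones on these images. *)
Section ChainMaps.
Context {T U : choiceType}.

Section Coned.
Variable co : seq T -> chain U -> chain U.
Let F := crec (<<[::]>> : chain U) co.
Hypothesis bd_co : forall s, s <> [::] ->
  bd (co s (lin F (bd1 s))) = lin F (bd1 s) - co s (bd (lin F (bd1 s))).
Hypothesis co0 : forall s, co s 0 = 0.

Lemma coned_chain_map s : bd (F s) = lin F (bd1 s).
Proof.
elim/chain_ind: s => [|s s0 IH]; first by rewrite /F /= bdU raddf0.
rewrite {1}/F crecE// -/F bd_co// (_ : bd (lin F _) = 0) ?co0 ?subr0//.
rewrite (lin_comp (@bd U)); apply: etrans (_ : lin F (bd (bd1 s)) = 0); last by rewrite bd1K raddf0.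
rewrite /bd lin_compU; apply: eq_lin_in => t /(subseq_bd1 s0)[ts st].
exact: IH.
Qed.

End Coned.

Section Homotopy.
Variables (A B : seq T -> chain U) (p : seq T -> U).

(** Acyclic carriers made explicit: [A s - B s] minus the homotopy on the faces is a cycle, and it
    is bounded by its cone with apex [p s]. The convention is [bd h + h bd = A - B]. *)
Definition htpy := crec (0 : chain U)
  (fun s c => cone (p s) (A s - B s - c)).

Hypothesis bdA : forall s, bd (A s) = lin A (bd1 s).
Hypothesis bdB : forall s, bd (B s) = lin B (bd1 s).
Hypothesis AB0 : A [::] = B [::].

Lemma htpyE s : s <> [::] ->
  htpy s = cone (p s) (A s - B s - lin htpy (bd1 s)).
Proof. by move=> s0; rewrite {1}/htpy crecE. Qed.

Lemma bd_htpy s : bd (htpy s) = A s - B s - lin htpy (bd1 s).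
Proof.
elim/chain_ind: s => [|s s0 IH]; first by rewrite AB0 subrr /htpy crec_nil !raddf0 addr0.
rewrite htpyE// bd_cone (_ : bd _ = 0) ?raddf0 ?addr0//.
rewrite !raddfB /= bdA bdB (lin_comp (@bd U)).
rewrite (@eq_lin_in _ _ (bd \o htpy) (fun t => A t - B t - lin htpy (bd1 t))); last first.
  by move=> t /(subseq_bd1 s0)[ts st]; exact: IH.
rewrite !linB_fun /= opprB addrC subrK.
rewrite -(lin_compU (@bd1 T) htpy) -/(bd (bd1 s)).
by rewrite bd1K raddf0.
Qed.

(** With [Q] a small ball, this keeps the homotopy inside a region where a map is continuous. All
    nonempty faces enter the hypothesis, because the recursion visits them. *)
Lemma carried_htpy (Q : U -> Prop) s :
  (forall t, subseq t s -> t <> [::] ->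
     [/\ carried (ents Q) (A t),
         carried (ents Q) (B t) & Q (p t)]) ->
  carried (ents Q) (htpy s).
Proof.
elim/chain_ind: s => [|s s0 IH] H; first exact: carried0.
rewrite htpyE//; have [QA QB Qp] := H s (subseq_refl _) s0.
apply: carried_cone.
apply: (@sub_carried _ (ents Q)) => [u Qu x|].
  by rewrite inE => /orP[/eqP ->//|/Qu].
apply: carriedB; first exact: carriedB.
apply: carried_lin => t /(subseq_bd1 s0)[ts st]; apply: IH => // u ut.
by apply: H; exact: subseq_trans ts.
Qed.

End Homotopy.

Lemma size_htpy (A B : seq T -> chain U) p :
  (forall s, carried (fun u : seq U => size u = size s) (A s)) ->
  (forall s, carried (fun u : seq U => size u = size s) (B s)) ->
  forall s, carried (fun u : seq U => size u = (size s).+1) (htpy A B p s).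
Proof.
move=> sA sB; elim/chain_ind => [|s s0 IH]; first exact: carried0.
rewrite htpyE//; apply: carried_cone => u uc /=; congr _.+1; move: u uc.
apply: carriedB; first exact: carriedB.
apply: carried_lin => t tb; have [ts st] := subseq_bd1 s0 tb.
apply: sub_carried (IH _ ts st) => u ->.
by have [_ ->] := carried_bd1 tb; case: s s0 {IH tb ts st}.
Qed.

Definition mapc (f : T -> U) : chain T -> chain U :=
  lin (fun s => << map f s >> : chain U).
HB.instance Definition _ f := GRing.Linear.on (mapc f).

Lemma mapcU f s : mapc f << s >> = << map f s >>.
Proof. exact: linU. Qed.

Lemma mapc_cone f x c : mapc f (cone x c) = cone (f x) (mapc f c).
Proof. by rewrite /mapc /cone !lin_compU; apply: eq_lin => s; rewrite !linU. Qed.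

Lemma bd_mapc f c : bd (mapc f c) = mapc f (bd c).
Proof.
rewrite /bd /mapc !lin_compU; apply: eq_lin => s; rewrite linU -/(mapc f).
elim: s => [|x s IH] /=; first by rewrite raddf0.
by rewrite raddfB /= mapcU mapc_cone -IH.
Qed.

Lemma bd1_map f s : bd1 (map f s) = mapc f (bd1 s).
Proof. by rewrite -bdU -mapcU bd_mapc bdU. Qed.

Lemma eq_mapc_in (f g : T -> U) (c : chain T) :
  carried (fun s : seq T => {in s, f =1 g}) c -> mapc f c = mapc g c.
Proof. by move=> fg; apply: eq_lin_in => s /fg/eq_in_map ->. Qed.

Lemma carried_mapc (Q : seq U -> Prop) (f : T -> U) (c : chain T) :
  carried (fun s : seq T => Q (map f s)) c -> carried Q (mapc f c).
Proof. by move=> Qc; apply: carried_lin => s /Qc; exact: carriedU. Qed.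

End ChainMaps.

Lemma mapc_comp (T U W : choiceType) (f : T -> U) (g : U -> W) c :
  mapc g (mapc f c) = mapc (g \o f) c.
Proof. by rewrite /mapc lin_compU; apply: eq_lin => s; rewrite linU map_comp. Qed.

Lemma mapc_id (T : choiceType) (c : chain T) : mapc id c = c.
Proof. by rewrite -[RHS]lin_id; apply: eq_lin => s; rewrite map_id. Qed.

(* [eps] is the sign of the grading, [d] the differential (of odd degree) of a
   complex of row vectors, [f] a chain map of degree zero. *)
Section Supertrace.
Context {F : fieldType} {n : nat} (eps d : 'M[F]_n).
Hypotheses (eps_d : eps *m d = - (d *m eps)) (dd : d *m d = 0).

(** Write [1 = e + d *m s] with [d *m s *m d = d]. The rows of [e] are cycles, so [e *m f] factors
    through [d] as [e *m f *m s *m d]. Cycling this [d] to the front and past [eps] changes the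
    sign, and the contributions of the two summands of [f] cancel. *)
Lemma supertrace_acyclic (f : 'M[F]_n) :
  eps *m f = f *m eps -> f *m d = d *m f -> (kermx d *m f <= d)%MS ->
  \tr (eps *m f) = 0.
Proof.
move=> eps_f fd fker; pose s := pinvmx d; pose e := 1%:M - d *m s.
have dsd : d *m s *m d = d by rewrite mulmxKpV.
have ed : e *m d = 0 by rewrite mulmxBl mul1mx dsd subrr.
have de : d *m e = d by rewrite mulmxBr mulmx1 mulmxA dd mul0mx subr0.
have efs : e *m f *m s *m d = e *m f.
  rewrite mulmxKpV//; apply: submx_trans fker; apply: submxMr.
  exact/sub_kermxP.
have -> : f = e *m f + d *m s *m f by rewrite -mulmxDl subrK mul1mx.
rewrite mulmxDr raddfD /=.
have -> : \tr (eps *m (e *m f)) = - \tr (eps *m f *m d *m s).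
  rewrite -efs !mulmxA mxtrace_mulC !mulmxA -[d *m eps]opprK -eps_d !mulNmx.
  by rewrite raddfN /= -(mulmxA eps d e) de -(mulmxA eps d f) -fd mulmxA.
rewrite (mulmxA eps) (mxtrace_mulC _ f) (mulmxA eps d s) !mulmxA -eps_f.
by rewrite addNr.
Qed.

End Supertrace.

(** * Flags of subsets and their cones *)

Section OrderComplex.
Context {I : finType}.
Local Notation P := {set I}.
Implicit Types (S : P) (s : seq P) (c : chain P).

Definition flag s := sorted (fun A B : P => A \proper B) s.

Lemma proper_transitive : transitive (fun A B : P => A \proper B).
Proof. by move=> B A C; exact: proper_trans. Qed.

Lemma flag_cons S s : flag (S :: s) = all (fun B : {set I} => S \proper B) s && flag s.
Proof.
rewrite /flag /= path_sortedE//; exact: proper_transitive.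
Qed.

Lemma flag_subseq s t : subseq t s -> flag s -> flag t.
Proof. exact: subseq_sorted proper_transitive _ _. Qed.

Lemma flag_uniq s : flag s -> uniq s.
Proof.
apply: sorted_uniq; first exact: proper_transitive.
by move=> A; rewrite properxx.
Qed.

Definition flag_cons_chain S s : chain P :=
  if s is S' :: _ then if S \proper S' then << S :: s >> else 0 else << S :: s >>.

(* Cones in the complex of flags: a degenerate cone is dropped. *)
Definition flag_cone S : chain P -> chain P := lin (flag_cons_chain S).
HB.instance Definition _ S := GRing.Linear.on (flag_cone S).

Lemma flag_cone_proper S c :
  carried (fun s : seq P => all (fun B : {set I} => S \proper B) s) c -> flag_cone S c = cone S c.
Proof.
move=> Sc; apply: eq_lin_in => -[|S' s] //= /Sc /= /andP[SS' _].
by rewrite SS'.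
Qed.

Lemma flag_cone_refl S c : flag_cone S (cone S c) = 0.
Proof.
rewrite /flag_cone /cone lin_compU linE big1// => s _.
by rewrite linU /= properxx scaler0.
Qed.

(** The cone formula survives the removal of degenerate cones: if a flag already begins with [S],
    its face without [S] is coned back to the flag itself, while the other faces begin with [S] and
    give 0, so the right-hand side vanishes too. *)
Lemma bd_flag_cone S c :
  carried (fun s : seq P => flag s && all (fun B : {set I} => S \subset B) s) c ->
  bd (flag_cone S c) = c - flag_cone S (bd c).
Proof.
move=> Sc; rewrite /flag_cone (lin_comp (@bd _)) /bd lin_compU -[X in X - _]lin_id -linB_fun.
apply: eq_lin_in => s /Sc {c Sc}; rewrite -/(flag_cone S) -/bd /=.
case: s => [_|S' s /andP[fs /= /andP[SS' Ss]]].
  by rewrite /= bdU /= !raddf0.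
have [/= s1 fs1] := andP (etrans (esym (flag_cons S' s)) fs).
case: ifPn => SpS'.
  rewrite bdU /= flag_cone_proper//.
  move=> t tb; have [ts _] := @carried_bd1 _ (S' :: s) t tb.
  apply/allP => B /(mem_subseq ts); rewrite inE => /orP[/eqP ->//|Bs].
  by apply: proper_sub_trans SpS' (proper_sub _); exact: allP s1 _ Bs.
have ES : S = S'.
  by apply/eqP; rewrite eqEproper SS' SpS'.
rewrite raddf0 raddfB /= -ES flag_cone_refl subr0 flag_cone_proper ?coneU ?subrr//.
by apply: carriedU; rewrite ES.
Qed.

End OrderComplex.

(** * From tuples of points to flags in the nerve of a cover *)

Section Nerve.
Context {I : finType} {X : choiceType} (U : I -> X -> bool).
Implicit Types (s t : seq X).

Definition carrier_set s : {set I} := [set a | all (U a) s].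

(** The reversal of inclusions makes the carrier of the whole tuple the least one, so it belongs at
    the head of the flags obtained from the faces. *)
Lemma carrier_set_subseq s t : subseq t s -> carrier_set s \subset carrier_set t.
Proof.
move=> ts; apply/fintype.subsetP => a; rewrite !inE => /allP H.
by apply/allP => x /(mem_subseq ts)/H.
Qed.

(* Sends a tuple to the barycentric subdivision of the corresponding simplex of
   the nerve. *)
Definition nerve1 : seq X -> chain {set I} :=
  crec (<<[::]>> : chain {set I}) (fun s c => flag_cone (carrier_set s) c).
Definition nerve : chain X -> chain {set I} := lin nerve1.
HB.instance Definition _ := GRing.Linear.on nerve.

Lemma nerve1E s : s <> [::] ->
  nerve1 s = flag_cone (carrier_set s) (lin nerve1 (bd1 s)).
Proof. by move=> s0; rewrite {1}/nerve1 crecE. Qed.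

Lemma nerve_nil : nerve << [::] >> = << [::] >>.
Proof. exact: linU. Qed.

Lemma nerve1_carried s : carried (fun f => flag f /\
  (forall S, S \in f -> exists t, [/\ subseq t s, t <> [::] & S = carrier_set t]))
  (nerve1 s).
Proof.
elim/chain_ind: s => [|s s0 IH]; first by apply: carriedU; split.
rewrite nerve1E//; apply: carried_lin => f fc.
have [fl fS] : flag f /\
  (forall S, S \in f -> exists t, [/\ subseq t s, t <> [::] & S = carrier_set t]).
  move: f fc; apply: carried_lin => t /(subseq_bd1 s0)[ts st].
  apply: sub_carried (IH _ ts st) => f [fl fS]; split=> // S /fS[u [ut u0 ->]].
  by exists u; split=> //; exact: subseq_trans ts.
have sub : all (fun B : {set I} => carrier_set s \subset B) f.
  by apply/allP => B /fS[t [ts _ ->]]; exact: carrier_set_subseq.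
have H : flag (carrier_set s :: f) ->
  carried (fun f => flag f /\
  (forall S, S \in f -> exists t, [/\ subseq t s, t <> [::] & S = carrier_set t]))
  << carrier_set s :: f >>.
  move=> flf; apply: carriedU; split=> // S; rewrite inE => /orP[/eqP ->|/fS//].
  by exists s.
rewrite /flag_cons_chain; case: f fl fS {fc sub} H => [|S f] fl fS H.
  by apply: H.
case: ifPn => SS; last exact: carried0.
by apply: H; rewrite /flag /= SS.
Qed.

Lemma bd_nerve1 s : bd (nerve1 s) = lin nerve1 (bd1 s).
Proof.
apply: coned_chain_map => [t t0|t]; last exact: raddf0.
apply: bd_flag_cone; apply: carried_lin => u /(subseq_bd1 t0)[ut _].
move=> f /nerve1_carried[-> fS] /=.
apply/allP => B /fS[v [vu _ ->]]; apply: carrier_set_subseq.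
exact: subseq_trans ut.
Qed.

Lemma bd_nerve c : bd (nerve c) = nerve (bd c).
Proof.
by rewrite /nerve (lin_comp (@bd _)) /bd lin_compU; apply: eq_lin => s; exact: bd_nerve1.
Qed.

Lemma size_nerve1 s : carried (fun f : seq {set I} => size f = size s) (nerve1 s).
Proof.
elim/chain_ind: s => [|s s0 IH]; first exact: carriedU.
rewrite nerve1E//; apply: carried_lin => f fc.
have sf : (size f).+1 = size s.
  move: f fc; apply: carried_lin => t tb; have [ts st] := subseq_bd1 s0 tb.
  apply: sub_carried (IH _ ts st) => f ->.
  by have [_ ->] := carried_bd1 tb; case: s s0 {IH tb ts st}.
rewrite /flag_cons_chain -sf; case: f {fc sf} => [|S f]; first exact: carriedU.
by case: ifP => _; [exact: carriedU|exact: carried0].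
Qed.

End Nerve.

(** * Coordinates on the finite complex of flags *)

Section FlagMatrices.
Context {I : finType} (good : pred {set I}).
Local Notation P := {set I}.

(** The bound on the length makes the flags a finite type. The empty flag is left out: the
    supertrace must give the Euler characteristic and not the reduced one. *)
Definition flag_index_pred (s : #|P|.-bseq P) :=
  [&& flag s, all good s & s != [::] :> seq P].
Definition flag_index := {s : #|P|.-bseq P | flag_index_pred s}.
Definition flag_of (i : 'I_#|{: flag_index}|) : seq P := val (val (enum_val i)).

Definition good_flag (s : seq P) := flag s && all good s.

Lemma flag_of_inj : injective flag_of.
Proof. by move=> i j /val_inj/val_inj/enum_val_inj. Qed.

Lemma flag_of_good i : good_flag (flag_of i).
Proof. by rewrite /good_flag /flag_of; case: (enum_val i) => s /= /and3P[-> ->]. Qed.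

Lemma flag_of_neq0 i : flag_of i != [::].
Proof. by rewrite /flag_of; case: (enum_val i) => s /= /and3P[]. Qed.

Lemma flag_ofP s : good_flag s -> s <> [::] -> exists i, flag_of i = s.
Proof.
move=> /andP[fs gs] s0; have ss : (size s <= #|P|)%N.
  by rewrite -(card_uniqP (flag_uniq fs)); exact: max_card.
have H : flag_index_pred (Bseq ss) by apply/and3P; split => //; exact/eqP.
by exists (enum_rank (exist _ (Bseq ss) H : flag_index)); rewrite /flag_of enum_rankK.
Qed.

Lemma good_flag_subseq s t : subseq t s -> good_flag s -> good_flag t.
Proof.
move=> ts /andP[fs /allP gs]; rewrite /good_flag (flag_subseq ts fs) /=.
by apply/allP => x /(mem_subseq ts)/gs.
Qed.

Definition fvec (c : chain P) : 'rV[rat]_#|{: flag_index}| :=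
  \row_j c@_(flag_of j).

Lemma fvec_is_linear : linear fvec.
Proof. by move=> a c d; apply/rowP => j; rewrite !mxE mcoeffD mcoeffZ. Qed.
HB.instance Definition _ :=
  GRing.isLinear.Build rat (chain {set I}) _ *:%R fvec fvec_is_linear.

Definition fmx (F : seq P -> chain P) : 'M[rat]_#|{: flag_index}| :=
  \matrix_(i, j) (F (flag_of i))@_(flag_of j).

Definition unfvec (v : 'rV[rat]_#|{: flag_index}|) : chain P :=
  \sum_i v 0 i *: << flag_of i >>.

Lemma unfvec_is_linear : linear unfvec.
Proof.
move=> a u v; rewrite /unfvec scaler_sumr -big_split; apply: eq_bigr => i _.
by rewrite !mxE scalerDl scalerA.
Qed.
HB.instance Definition _ :=
  GRing.isLinear.Build rat _ (chain {set I}) *:%R unfvec unfvec_is_linear.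

Lemma unfvecK v : fvec (unfvec v) = v.
Proof.
apply/rowP => j; rewrite mxE raddf_sum (bigD1 j)//= mcoeffZ mcoeffUU mulr1.
rewrite big1 ?addr0// => i ij; rewrite mcoeffZ mcoeffU.
by rewrite (inj_eq flag_of_inj) (negbTE ij) mulr0.
Qed.

Lemma unfvec_carried v : carried (fun s => good_flag s /\ s <> [::]) (unfvec v).
Proof.
rewrite /unfvec; elim/big_ind: _ => [|c d|i _]; [exact: carried0|exact: carriedD|].
move=> s; rewrite mem_msupp mcoeffZ mcoeffU; case: (flag_of i =P s) => [<- _|_].
  by split; [exact: flag_of_good|apply/eqP; exact: flag_of_neq0].
by rewrite mulr0 eqxx.
Qed.

Lemma fvecK c : carried (fun s => good_flag s /\ s <> [::]) c -> unfvec (fvec c) = c.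
Proof.
move=> gc; apply/malgP => s.
have [/andP[gs /eqP s0]|sN] := boolP (good_flag s && (s != [::])); last first.
  have {}sN : ~ (good_flag s /\ s <> [::]) by move=> [gs /eqP s0]; rewrite gs s0 in sN.
  rewrite [RHS]mcoeff_outdom; last by apply/negP => /gc.
  by rewrite mcoeff_outdom//; apply/negP => /unfvec_carried.
have [i <-] := flag_ofP gs s0.
by have := congr1 (fun v : 'rV[rat]_#|{: flag_index}| => v 0 i) (unfvecK (fvec c)); rewrite !mxE.
Qed.

(** Coordinates forget the empty flag, so its image under [F] must have no visible coordinate
    either. *)
Lemma fvec_lin (F : seq P -> chain P) c :
  carried good_flag c -> fvec (F [::]) = 0 -> fvec (lin F c) = fvec c *m fmx F.
Proof.
move=> gc F0; apply/rowP => j; rewrite !mxE coeff_lin.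
pose h s := c@_s * (F s)@_(flag_of j).
have h0 : h [::] = 0 by have := congr1 (fun v : 'rV[rat]_#|{: flag_index}| => v 0 j) F0; rewrite /h !mxE => ->; rewrite mulr0.
rewrite -/(h _) (eq_bigr (fun i => h (flag_of i))); last by move=> i _; rewrite !mxE.
rewrite -[RHS](@big_map _ _ _ _ _ flag_of _ xpredT h).
rewrite (bigID (fun s => s == [::])) /= big1 => [|s /eqP -> //]; rewrite add0r.
rewrite [RHS](bigID (fun s => s \in msupp c)) /= [X in _ + X]big1 ?addr0; last first.
  by move=> s sc; rewrite /h mcoeff_outdom ?mul0r.
rewrite -[LHS]big_filter -[RHS]big_filter; apply: perm_big; apply: uniq_perm.
- by rewrite filter_uniq// fset_uniq.
- by rewrite filter_uniq// map_inj_uniq ?index_enum_uniq//; exact: flag_of_inj.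
move=> s; rewrite !mem_filter andbC; case sc : (s \in msupp c) => //=.
apply/idP/idP => [/eqP s0|].
  by have [i <-] := flag_ofP (gc _ sc) s0; rewrite map_f// mem_index_enum.
by move=> /mapP[i _ ->]; exact: flag_of_neq0.
Qed.

Lemma carried_good_bd c : carried good_flag c -> carried good_flag (bd c).
Proof.
move=> gc; apply: carried_lin => s /gc gs; apply: sub_carried (carried_bd1 (s := s)).
by move=> t [ts _]; exact: good_flag_subseq gs.
Qed.

End FlagMatrices.

Lemma mulmx_ext (F : fieldType) m n (A B : 'M[F]_(m, n)) :
  (forall v : 'rV_m, v *m A = v *m B) -> A = B.
Proof. by move=> H; apply/row_matrixP => i; rewrite !rowE H. Qed.

(** * Grading, boundary and chain maps as matrices *)

Section FlagComplex.
Context {I : finType} (good : pred {set I}).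
Local Notation P := {set I}.
Local Notation n := #|{: flag_index good}|.
Local Notation flag_of := (@flag_of I good).
Local Notation fvec := (@fvec I good).
Local Notation unfvec := (@unfvec I good).
Local Notation fmx := (@fmx I good).
Local Notation good_flag := (good_flag good).

(** A flag of [k.+1] sets has degree [k]; the exponent has the parity of the degree. *)
Definition flag_sign : 'M[rat]_n := diag_mx (\row_i (-1) ^+ (size (flag_of i)).+1).
Definition flag_bd : 'M[rat]_n := fmx (@bd1 P).
Definition flag_proj (k : nat) : 'M[rat]_n :=
  diag_mx (\row_i (size (flag_of i) == k.+1)%:R).

Lemma fvec_bd c : carried good_flag c -> fvec (bd c) = fvec c *m flag_bd.
Proof. by move=> gc; apply: fvec_lin => //=; exact: raddf0. Qed.

Lemma unfvec_good v : carried good_flag (unfvec v).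
Proof. by move=> s /unfvec_carried[]. Qed.

Lemma flag_bdE v : v *m flag_bd = fvec (bd (unfvec v)).
Proof. by rewrite fvec_bd ?unfvecK//; exact: unfvec_good. Qed.

Lemma flag_bdK : flag_bd *m flag_bd = 0.
Proof.
apply: mulmx_ext => v; rewrite mulmxA mulmx0 [v *m _]flag_bdE -fvec_bd; last first.
  by apply: carried_good_bd; exact: unfvec_good.
by rewrite bdK raddf0.
Qed.

Lemma flag_sign_bd : flag_sign *m flag_bd = - (flag_bd *m flag_sign).
Proof.
apply/matrixP => i j; rewrite mul_diag_mx [RHS]mxE mul_mx_diag !mxE.
have [->|] := eqVneq (bd1 (flag_of i))@_(flag_of j) 0; first by rewrite mulr0 mul0r oppr0.
rewrite -mem_msupp => /carried_bd1[_ ->].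
have := flag_of_neq0 i; case: (flag_of i) => // x s _ /=.
by rewrite exprS mulN1r mulNr mulrC.
Qed.

Section ChainMap.
Variable F : seq P -> chain P.
Hypothesis F_nil : F [::] = << [::] >>.
Hypothesis F_good : forall s, good_flag s -> carried good_flag (F s).
Hypothesis F_size : forall s, good_flag s -> carried (fun u : seq P => size u = size s) (F s).
Hypothesis F_bd : forall s, good_flag s -> bd (F s) = lin F (bd1 s).

Lemma fvec_nil : fvec << [::] >> = 0.
Proof.
apply/rowP => j; rewrite !mxE mcoeffU; case: eqP => // /esym/eqP.
by rewrite (negbTE (flag_of_neq0 j)).
Qed.

Lemma fvec_map c : carried good_flag c -> fvec (lin F c) = fvec c *m fmx F.
Proof. by move=> gc; apply: fvec_lin => //; rewrite F_nil fvec_nil. Qed.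

Lemma fmx_bd : fmx F *m flag_bd = flag_bd *m fmx F.
Proof.
apply: mulmx_ext => v; rewrite !mulmxA; have gv := @unfvec_good v.
rewrite -[v]unfvecK -fvec_map// -fvec_bd; last first.
  by apply: carried_lin => s /gv; exact: F_good.
rewrite -fvec_bd// -fvec_map; last exact: carried_good_bd.
congr fvec; rewrite (lin_comp (@bd P)) /bd lin_compU; apply: eq_lin_in => s /gv gs.
exact: F_bd.
Qed.

Lemma flag_sign_fmx : flag_sign *m fmx F = fmx F *m flag_sign.
Proof.
apply/matrixP => i j; rewrite mul_diag_mx mul_mx_diag !mxE.
have [->|] := eqVneq (F (flag_of i))@_(flag_of j) 0; first by rewrite mulr0 mul0r.
by rewrite -mem_msupp => /F_size ->; rewrite ?flag_of_good// mulrC.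
Qed.

Lemma supertrace_fmx : \tr (flag_sign *m fmx F) =
  \sum_i (-1) ^+ (size (flag_of i)).+1 * (F (flag_of i))@_(flag_of i).
Proof.
by apply: eq_bigr => i _; rewrite mul_diag_mx !mxE.
Qed.

End ChainMap.

Lemma flag_projE k (v : 'rV_n) i : (v *m flag_proj k) 0 i = v 0 i * (size (flag_of i) == k.+1)%:R.
Proof.
by rewrite mul_mx_diag !mxE.
Qed.

Lemma flag_proj_sum (K : nat) (v : 'rV_n) : (#|P| <= K)%N ->
  v = \sum_(k < K) v *m flag_proj k.
Proof.
move=> PK; apply/rowP => i; rewrite summxE.
have sK : ((size (flag_of i)).-1 < K)%N.
  have := flag_of_neq0 i; rewrite -size_eq0 -lt0n => s0; rewrite prednK//.
  apply: leq_trans PK; have /andP[fi _] := flag_of_good i.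
  by rewrite -(card_uniqP (flag_uniq fi)); exact: max_card.
rewrite (bigD1 (Ordinal sK))//= flag_projE prednK ?eqxx ?mulr1; last first.
  by rewrite lt0n size_eq0 flag_of_neq0.
rewrite big1 ?addr0// => k ki; rewrite flag_projE; case: eqP => [E|]; last by rewrite mulr0.
by case/eqP: ki; apply: val_inj; rewrite /= E.
Qed.

Lemma unfvec_proj k (v : 'rV_n) : carried (fun s : seq P => size s = k.+1) (unfvec (v *m flag_proj k)).
Proof.
move=> s sv; have [gs s0] := unfvec_carried sv.
have [i si] := flag_ofP gs s0; move: sv; rewrite mem_msupp -si.
have -> : (unfvec (v *m flag_proj k))@_(flag_of i) = (fvec (unfvec (v *m flag_proj k))) 0 i.
  by rewrite mxE.
rewrite unfvecK flag_projE.
by case: (size (flag_of i) =P k.+1) => // _; rewrite mulr0 eqxx.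
Qed.

Lemma flag_proj_bd k (v : 'rV_n) : v *m flag_bd = 0 -> v *m flag_proj k *m flag_bd = 0.
Proof.
move=> v0; apply/rowP => j; rewrite [RHS]mxE [LHS]mxE.
have bdN i j' : flag_bd i j' != 0 -> size (flag_of i) = (size (flag_of j')).+1.
  rewrite mxE -mem_msupp => /carried_bd1[_ ->].
  by have := flag_of_neq0 i; case: (flag_of i).
have [E|E] := eqVneq (size (flag_of j)) k.
  rewrite (eq_bigr (fun i => v 0 i * flag_bd i j)).
    by have /rowP/(_ j) := v0; rewrite !mxE.
  move=> i _; rewrite flag_projE; have [->|/bdN ->] := eqVneq (flag_bd i j) 0.
    by rewrite !mulr0.
  by rewrite E eqxx mulr1.
rewrite big1// => i _; rewrite flag_projE; have [->|/bdN ->] := eqVneq (flag_bd i j) 0.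
  by rewrite mulr0.
by rewrite eqSS (negbTE E) mulr0 mul0r.
Qed.

Lemma flag_proj_bdC k : flag_proj k.+1 *m flag_bd = flag_bd *m flag_proj k.
Proof.
apply/matrixP => i j; rewrite mul_diag_mx mul_mx_diag !mxE.
have [->|] := eqVneq (bd1 (flag_of i))@_(flag_of j) 0; first by rewrite mulr0 mul0r.
rewrite -mem_msupp => /carried_bd1[_ ->].
by have := flag_of_neq0 i; case: (flag_of i) => // x s _ /=; rewrite eqSS mulrC.
Qed.

Lemma flag_sign_proj k : flag_sign *m flag_proj k = (-1) ^+ k *: flag_proj k.
Proof.
apply/matrixP => i j; rewrite mul_diag_mx !mxE.
case: (i =P j) => [->|_]; last by rewrite mulr0n !mulr0.
rewrite mulr1n; case: eqP => [->|_]; last by rewrite !mulr0.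
by rewrite !mulr1 !exprS !mulN1r opprK.
Qed.

Lemma fvec_sign k c : carried (fun s : seq P => size s = k.+1) c ->
  fvec c *m flag_sign = (-1) ^+ k *: fvec c.
Proof.
move=> ck; apply/rowP => j; rewrite mul_mx_diag !mxE mulrC.
have [->|] := eqVneq (c@_(flag_of j)) 0; first by rewrite !mulr0.
by rewrite -mem_msupp => /ck ->; rewrite !exprS !mulN1r opprK.
Qed.

Lemma fvec_proj k l c : carried (fun s : seq P => size s = l.+1) c ->
  fvec c *m flag_proj k = (l == k)%:R *: fvec c.
Proof.
move=> cl; apply/rowP => i; rewrite flag_projE [RHS]mxE mulrC.
have [->|] := eqVneq (fvec c 0 i) 0; first by rewrite !mulr0.
by rewrite mxE -mem_msupp => /cl ->; rewrite eqSS.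
Qed.

End FlagComplex.

From mathcomp Require Import all_classical all_reals all_analysis lra.
Import Defs numFieldNormedType.Exports.

(** * Barycentric subdivision of tuples of vectors *)

Lemma mapc_htpy (T U T' U' : choiceType) (f : T -> T') (g : U -> U')
    (A B : seq T -> chain U) p (A' B' : seq T' -> chain U') p' s :
  (forall t, mapc g (A t) = A' (map f t)) ->
  (forall t, mapc g (B t) = B' (map f t)) ->
  (forall t, t <> [::] -> g (p t) = p' (map f t)) ->
  mapc g (htpy A B p s) = htpy A' B' p' (map f s).
Proof.
move=> gA gB gp; elim/chain_ind: s => [|s s0 IH]; first by rewrite raddf0.
rewrite !htpyE//; last by case: s s0 {IH}.
rewrite mapc_cone !raddfB /= gA gB gp// bd1_map /mapc !lin_compU.
congr (_ - cone _ _).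
apply: eq_lin_in => t /(subseq_bd1 s0)[ts st].
by rewrite linU; exact: IH.
Qed.

Lemma lin_crec_mapc (T U T' U' : choiceType) (f : T -> T') (g : U -> U')
    (F : seq T -> chain U) (F' : seq T' -> chain U') c :
  carried (fun s => mapc g (F s) = F' (map f s)) c ->
  mapc g (lin F c) = lin F' (mapc f c).
Proof.
move=> FF'; rewrite /mapc !lin_compU; apply: eq_lin_in => s /FF' E.
by rewrite linU.
Qed.

Section Subdivision.
Context {R : realType} {V : lmodType R}.
Implicit Types (s t : seq V).

Definition bary s : V := (size s)%:R^-1 *: \sum_(v <- s) v.

Definition sd1 : seq V -> chain V :=
  crec (<<[::]>> : chain V) (fun s c => cone (bary s) c).
Definition sd : chain V -> chain V := lin sd1.
HB.instance Definition _ := GRing.Linear.on sd.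

Lemma sd1E s : s <> [::] -> sd1 s = cone (bary s) (lin sd1 (bd1 s)).
Proof. by move=> s0; rewrite {1}/sd1 crecE. Qed.

Lemma bd_sd1 s : bd (sd1 s) = lin sd1 (bd1 s).
Proof.
by apply: coned_chain_map => [t _|t]; [exact: bd_cone|exact: raddf0].
Qed.

Lemma bd_sd c : bd (sd c) = sd (bd c).
Proof.
rewrite /sd (lin_comp (@bd V)) /bd lin_compU; apply: eq_lin => s.
exact: bd_sd1.
Qed.

Lemma sd_nil : sd <<[::]>> = <<[::]>>.
Proof. exact: linU. Qed.

Lemma size_sd1 s : carried (fun u : seq V => size u = size s) (sd1 s).
Proof.
elim/chain_ind: s => [|s s0 IH]; first exact: carriedU.
rewrite sd1E//; apply: carried_cone; apply: carried_lin => t tb.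
have [ts st] := subseq_bd1 s0 tb; apply: sub_carried (IH _ ts st) => u /= ->.
by have [_ ->] := carried_bd1 tb; case: s s0 {IH tb ts st}.
Qed.

Definition bary_closed (C : V -> Prop) :=
  forall t, t <> [::] -> ents C t -> C (bary t).

Lemma ents_subseq (C : V -> Prop) s t : subseq t s -> ents C s -> ents C t.
Proof. by move=> ts Cs x xt; apply: Cs; exact: mem_subseq ts _ xt. Qed.

Lemma ents_cons (C : V -> Prop) x s : C x -> ents C s -> ents C (x :: s).
Proof. by move=> Cx Cs y; rewrite inE => /orP[/eqP ->//|/Cs]. Qed.

Lemma carried_sd1 (C : V -> Prop) s : bary_closed C -> ents C s ->
  carried (ents C) (sd1 s).
Proof.
move=> Cb; elim/chain_ind: s => [|s s0 IH] Cs; first exact: carriedU.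
rewrite sd1E//; apply: carried_cone.
apply: (@sub_carried _ (ents C)) => [u|]; first by apply: ents_cons; exact: Cb.
apply: carried_lin => t /(subseq_bd1 s0)[ts st]; apply: IH => //.
exact: ents_subseq Cs.
Qed.

Lemma carried_sdm (C : V -> Prop) m c : bary_closed C -> carried (ents C) c ->
  carried (ents C) (iter m sd c).
Proof.
move=> Cb Cc; elim: m => //= m IH; apply: carried_lin => s /IH.
exact: carried_sd1.
Qed.

Lemma size_sdm k m c : carried (fun s : seq V => size s = k) c ->
  carried (fun s : seq V => size s = k) (iter m sd c).
Proof.
move=> kc; elim: m => //= m IH; apply: carried_lin => s /IH <-.
exact: size_sd1.
Qed.

Lemma bd_sdm m c : bd (iter m sd c) = iter m sd (bd c).
Proof. by elim: m => //= m IH; rewrite bd_sd IH. Qed.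

Definition sdm m s := iter m sd << s >>.

Lemma iter_sd_lin m c : iter m sd c = lin (sdm m) c.
Proof.
elim: m => [|m IH] /=; first by rewrite lin_id.
by rewrite IH lin_comp.
Qed.

Lemma bd_sdm1 m s : bd (sdm m s) = lin (sdm m) (bd1 s).
Proof. by rewrite bd_sdm bdU iter_sd_lin. Qed.

Lemma sdm_nil m : sdm m [::] = <<[::]>>.
Proof. by elim: m => //= m IH; rewrite /sdm /= -/(sdm m _) IH sd_nil. Qed.

(** The barycentre as apex commutes with linear maps, so that the homotopy is natural ([mapc_sdh])
    and passes to singular chains; it also keeps the homotopy in any set closed under
    barycentres. *)
Definition sdh m := htpy (fun s => << s >>) (sdm m) bary.

Lemma bd_sdh m s : bd (sdh m s) = << s >> - sdm m s - lin (sdh m) (bd1 s).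
Proof.
apply: bd_htpy => [t|t|]; first by rewrite bdU lin_id.
  exact: bd_sdm1.
by rewrite sdm_nil.
Qed.

Lemma carried_sdh m (C : V -> Prop) s : bary_closed C -> ents C s ->
  carried (ents C) (sdh m s).
Proof.
move=> Cb Cs; apply: carried_htpy => t ts t0; have Ct := ents_subseq ts Cs.
split; [exact: carriedU| |exact: Cb].
by apply: carried_sdm => //; exact: carriedU.
Qed.

Lemma size_sdh m s : carried (fun u : seq V => size u = (size s).+1) (sdh m s).
Proof.
apply: size_htpy => t; first exact: carriedU.
by apply: size_sdm; exact: carriedU.
Qed.

(* The prism from [s] at height 0 to its subdivision at height 1. *)
Definition prism : seq V -> chain (V * R^o)%type :=
  htpy (fun s => << map (fun v => (v, 0 : R^o)) s >>)
       (fun s => mapc (fun v => (v, 1 : R^o)) (sd1 s)) (fun s => (bary s, 1)).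

Lemma bd_prism s : bd (prism s) =
  << map (fun v => (v, 0 : R^o)) s >> - mapc (fun v => (v, 1 : R^o)) (sd1 s)
    - lin prism (bd1 s).
Proof.
apply: bd_htpy => [t|t|]; first by rewrite bdU bd1_map.
  by rewrite bd_mapc bd_sd1 /mapc lin_compU.
by rewrite /sd1 crec_nil mapcU.
Qed.

Lemma carried_prism (C : V -> Prop) s : bary_closed C -> ents C s ->
  carried (ents (fun p : V * R^o => C p.1 /\ 0 <= p.2 <= 1)) (prism s).
Proof.
move=> Cb Cs; apply: carried_htpy => t ts t0; have Ct := ents_subseq ts Cs.
split=> [||/=]; last by rewrite ler01 lexx; split=> //; exact: Cb.
  by apply: carriedU => _ /mapP[v vt ->]/=; rewrite lexx ler01; split=> //; exact: Ct.
apply: carried_mapc; apply: sub_carried (carried_sd1 Cb Ct) => u Cu.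
by move=> _ /mapP[v vt ->]/=; rewrite lexx ler01; split=> //; exact: Cu.
Qed.

Lemma size_prism s : carried (fun u : seq (V * R^o) => size u = (size s).+1) (prism s).
Proof.
apply: size_htpy => t; first by apply: carriedU; rewrite size_map.
by apply: carried_mapc => u /size_sd1; rewrite size_map.
Qed.

End Subdivision.

Section SubdivisionNatural.
Context {R : realType} {V W : lmodType R} (f : {linear V -> W}).

Lemma map_bary s : f (bary s) = bary (map f s).
Proof. by rewrite /bary linearZ /= raddf_sum size_map big_map. Qed.

Lemma mapc_sd1 s : mapc f (sd1 s) = sd1 (map f s).
Proof.
elim/chain_ind: s => [|s s0 IH]; first by rewrite mapcU.
rewrite !sd1E//; last by case: s s0 {IH}.
rewrite mapc_cone map_bary bd1_map; congr cone.
by apply: lin_crec_mapc => t /(subseq_bd1 s0)[ts st]; exact: IH.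
Qed.

Lemma mapc_sd c : mapc f (sd c) = sd (mapc f c).
Proof. by apply: lin_crec_mapc => s _; exact: mapc_sd1. Qed.

Lemma mapc_iter_sd m c : mapc f (iter m sd c) = iter m sd (mapc f c).
Proof. by elim: m => //= m IH; rewrite mapc_sd IH. Qed.

Lemma mapc_sdm m s : mapc f (sdm m s) = sdm m (map f s).
Proof. by rewrite mapc_iter_sd mapcU. Qed.

Lemma mapc_sdh m s : mapc f (sdh m s) = sdh m (map f s).
Proof.
apply: mapc_htpy => t; first by rewrite mapcU.
  exact: mapc_sdm.
by move=> _; exact: map_bary.
Qed.

Lemma mapc_prism s :
  mapc (fun p : V * R^o => (f p.1, p.2)) (prism s) = prism (map f s).
Proof.
apply: mapc_htpy => t; first by rewrite mapcU -!map_comp.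
  by rewrite -mapc_sd1 !mapc_comp.
by move=> _ /=; rewrite map_bary.
Qed.

End SubdivisionNatural.

(** * The mesh of iterated subdivisions *)

Section Mesh.
Context {R : realType} {V : normedModType R}.
Implicit Types (s t : seq V).

Definition diam_le (d : R) s := forall x y, x \in s -> y \in s -> `|x - y| <= d.

Lemma bary_closed_ball (a : V) (r : R) : bary_closed (fun x => `|a - x| <= r).
Proof.
move=> t t0 ta; have t1 : (size t)%:R != 0 :> R by case: t t0 {ta} => // *; rewrite pnatr_eq0.
have -> : a - bary t = (size t)%:R^-1 *: \sum_(v <- t) (a - v).
  rewrite sumrB scalerBr; congr (_ - _).
  by rewrite big_const_seq count_predT iter_addr_0 -[a *+ _]scaler_nat scalerA mulVf// scale1r.
rewrite normrZ ger0_norm ?invr_ge0// ler_pdivrMl ?lt0r ?t1 ?ler0n//.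
apply: le_trans (ler_norm_sum _ _ _) _.
rewrite [X in _ <= X]mulrC.
elim: t {t0 t1} ta => [|v t IH] ta; first by rewrite big_nil mulr0.
rewrite big_cons /= -natr1 mulrDr mulr1 addrC; apply: lerD.
  by apply: IH => x xt; apply: ta; rewrite inE xt orbT.
by apply: ta; rewrite inE eqxx.
Qed.

Definition mesh_ratio n : R := n%:R / n.+1%:R.

Lemma mesh_ratio_ge0 n : 0 <= mesh_ratio n.
Proof. by rewrite /mesh_ratio divr_ge0. Qed.

Lemma mesh_ratio_lt1 n : mesh_ratio n < 1.
Proof. by rewrite /mesh_ratio ltr_pdivrMr ?ltr0n// mul1r ltr_nat. Qed.

Lemma mesh_ratio_le n m : (n <= m)%N -> mesh_ratio n <= mesh_ratio m.
Proof.
move=> nm; rewrite /mesh_ratio ler_pdivrMr ?ltr0n// mulrAC ler_pdivlMr ?ltr0n//.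
by rewrite -!natrM ler_nat !mulnS (mulnC m n) leq_add2r.
Qed.

(** [bary s - x] is the mean of the [n.+1] differences [v - x], one of which is zero; hence the
    ratio [n / (n + 1)]. *)
Lemma dist_bary d n s x : size s = n.+1 -> diam_le d s -> x \in s ->
  `|bary s - x| <= mesh_ratio n * d.
Proof.
move=> sn ds xs; have n0 : n.+1%:R != 0 :> R by rewrite pnatr_eq0.
have -> : bary s - x = n.+1%:R^-1 *: \sum_(v <- s) (v - x).
  rewrite sumrB scalerBr /bary sn; congr (_ - _).
  by rewrite big_const_seq count_predT iter_addr_0 sn -[x *+ _]scaler_nat scalerA mulVf// scale1r.
rewrite normrZ ger0_norm ?invr_ge0// /mesh_ratio [_ / _]mulrC -mulrA ler_pM2l ?invr_gt0 ?ltr0n//.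
rewrite (big_rem x xs)/= subrr add0r.
apply: le_trans (ler_norm_sum _ _ _) _.
have: size (rem x s) = n by rewrite size_rem// sn.
have: forall y, y \in rem x s -> `|y - x| <= d by move=> y /mem_rem ys; exact: ds.
elim: (rem x s) n {sn ds xs n0} => [|v t IH] n Ht <-; first by rewrite big_nil mul0r.
rewrite big_cons /= -natr1 mulrDl mul1r addrC; apply: lerD.
  by apply: IH => // y yt; apply: Ht; rewrite inE yt orbT.
by apply: Ht; rewrite inE eqxx.
Qed.

(** Of two entries of a subdivided tuple, either one is the barycentre of [s] and the other lies in
    a ball around it that contains [s], or both come from a proper face. The length is only bounded
    by [n.+1], so that the induction covers the faces. *)
Lemma mesh_sd1 d n s : (size s <= n.+1)%N -> 0 <= d -> diam_le d s ->
  carried (diam_le (mesh_ratio n * d)) (sd1 s).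
Proof.
move=> + d0; elim/chain_ind: s => [|s s0 IH] sn ds; first exact: carriedU.
case E: (size s) => [|k]; first by case: s s0 E {IH sn ds}.
have kn : (k <= n)%N by rewrite E in sn.
rewrite sd1E//; apply: carried_cone => u uc.
have ub : ents (fun x => `|bary s - x| <= mesh_ratio n * d) u.
  move: u uc; apply: carried_lin => t /(subseq_bd1 s0)[ts st].
  apply: carried_sd1; first exact: bary_closed_ball.
  move=> x /(mem_subseq ts) xs; apply: le_trans (dist_bary E ds xs) _.
  by rewrite ler_wpM2r// mesh_ratio_le.
have ud : diam_le (mesh_ratio n * d) u.
  move: u uc {ub}; apply: carried_lin => t /(subseq_bd1 s0)[ts st]; apply: IH => //.
    exact: leq_trans (ltnW st) sn.
  by move=> x y xt yt; apply: ds; exact: mem_subseq ts _ _.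
move=> x y; rewrite !inE => /orP[/eqP ->|xu] /orP[/eqP ->|yu].
- by rewrite subrr normr0 mulr_ge0// mesh_ratio_ge0.
- exact: ub.
- by rewrite distrC; exact: ub.
- exact: ud.
Qed.

Lemma mesh_sdm d n s m : size s = n.+1 -> 0 <= d -> diam_le d s ->
  carried (diam_le (mesh_ratio n ^+ m * d)) (sdm m s).
Proof.
move=> sn d0 ds; rewrite /sdm; elim: m => [|m IH] /=.
  by rewrite expr0 mul1r; exact: carriedU.
apply: carried_lin => t tm; rewrite exprS -mulrA; apply: mesh_sd1.
- by rewrite (size_sdm (carriedU (Q := fun s : seq V => size s = n.+1) sn) tm).
- by rewrite mulr_ge0// exprn_ge0// mesh_ratio_ge0.
- exact: IH.
Qed.

Lemma mesh_small n (d e : R) : 0 < e ->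
  exists m0, forall m, (m0 <= m)%N -> mesh_ratio n ^+ m * d <= e.
Proof.
move=> e0; have : ((fun m => mesh_ratio n ^+ m * d) @ \oo --> (0 * d : R))%classic.
  apply: cvgMr_tmp; apply: cvg_expr.
  by rewrite ger0_norm ?mesh_ratio_ge0 ?mesh_ratio_lt1.
rewrite mul0r => /cvgrPdist_le/(_ _ e0)[m0 _ Hm]; exists m0 => m mm.
have := Hm m mm; rewrite /= sub0r normrN; apply: le_trans; exact: ler_norm.
Qed.

End Mesh.

Local Open Scope classical_set_scope.
Local Open Scope ring_scope.

(** * Continuity of algebraic expressions *)

Lemma cvg_sumr (R : realType) (V : normedModType R) (T I : Type)
    (F : set_system T) {FF : Filter F} (r : seq I) (f : I -> T -> V) (l : I -> V) :
  (forall i, f i x @[x --> F] --> l i) ->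
  (\sum_(i <- r) f i x) @[x --> F] --> \sum_(i <- r) l i.
Proof.
move=> fl; elim: r => [|i r IH].
  by under eq_fun do rewrite big_nil; rewrite big_nil; exact: cvg_cst.
under eq_fun do rewrite big_cons; rewrite big_cons.
by apply: cvgD.
Qed.

Lemma continuous_sumr (R : realType) (V : normedModType R) (T : topologicalType)
    (I : Type) (r : seq I) (f : I -> T -> V) :
  (forall i, continuous (f i)) -> continuous (fun x => \sum_(i <- r) f i x).
Proof. by move=> fc x; apply: (@cvg_sumr _ _ _ _ (nbhs x)) => i; exact: fc. Qed.

Lemma mx_norm_lt (R : realType) m n (A : 'M[R]_(m, n)) (e : R) : 0 < e ->
  (forall i j, `|A i j| < e) -> `|A| < e.
Proof.
move=> e0 H; rewrite -[Num.norm A]/(mx_norm A) mx_normrE.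
by apply/bigmax_ltP; split=> // -[i j] _; exact: H.
Qed.

Lemma coord_le_mx_norm (R : realType) m n (A : 'M[R]_(m, n)) i j : `|A i j| <= `|A|.
Proof.
rewrite -[Num.norm A]/(mx_norm A) mx_normrE.
exact: (@le_bigmax _ _ _ 0 (fun ij : 'I_m * 'I_n => `|A ij.1 ij.2|) (i, j)).
Qed.

Lemma cvg_mx (R : realType) (T : Type) m n (F : set_system T) {FF : Filter F}
    (f : T -> 'M[R]_(m, n)) (l : 'M[R]_(m, n)) :
  (forall i j, f x i j @[x --> F] --> l i j) -> f @ F --> l.
Proof.
move=> fl; apply/cvgrPdist_lt => e e0.
have : \forall x \near F, forall ij : 'I_m * 'I_n, `|l ij.1 ij.2 - f x ij.1 ij.2| < e.
  apply: filter_forall => -[i j]; have /cvgrPdist_lt := fl i j; exact.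
apply: filterS => x Hx; apply: mx_norm_lt => // i j.
by rewrite !mxE; exact: (Hx (i, j)).
Qed.

Lemma continuous_mx (R : realType) (T : topologicalType) m n
    (f : T -> 'M[R]_(m, n)) :
  (forall i j, continuous (fun x => f x i j)) -> continuous f.
Proof. by move=> fc x; apply: cvg_mx => i j; exact: fc. Qed.

Lemma mulmxr_continuous (R : realType) m n p (A : 'M[R]_(n, p)) :
  continuous (fun v : 'M[R]_(m, n) => v *m A).
Proof.
apply: continuous_mx => i j.
rewrite (_ : (fun x => _) = fun x : 'M[R]_(m, n) => \sum_k x i k * A k j); last first.
  by apply/funext => x; rewrite mxE.
apply: continuous_sumr => k v; apply: (@continuousM _ _ (fun x : 'M[R]_(m, n) => x i k) (cst (A k j))); last exact: cst_continuous.
exact: coord_continuous.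
Qed.

Section ContinuousAlgebra.
Context {R : realType} {V : normedModType R} {T : topologicalType}.
Implicit Types (f g : T -> V) (a : T -> R).

Lemma contD f g : continuous f -> continuous g -> continuous (fun x => f x + g x).
Proof. by move=> cf cg x; exact: (cvgD (cf x) (cg x)). Qed.

Lemma contB f g : continuous f -> continuous g -> continuous (fun x => f x - g x).
Proof. by move=> cf cg x; exact: (cvgB (cf x) (cg x)). Qed.

Lemma contZ a f : continuous a -> continuous f -> continuous (fun x => a x *: f x).
Proof. by move=> ca cf x; exact: (cvgZ (ca x) (cf x)). Qed.

Lemma contM a (b : T -> R) : continuous a -> continuous b -> continuous (fun x => a x * b x).
Proof. by move=> ca cb x; exact: (cvgM (ca x) (cb x)). Qed.

Lemma cont_cst (c : V) : continuous (fun _ : T => c).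
Proof. exact: cst_continuous. Qed.

End ContinuousAlgebra.

Lemma cont_comp (S T U : topologicalType) (f : S -> T) (g : T -> U) :
  continuous f -> continuous g -> continuous (fun x => g (f x)).
Proof. by move=> cf cg x; apply: continuous_comp; [exact: cf|exact: cg]. Qed.

Lemma cont_pair (S T U : topologicalType) (f : S -> T) (g : S -> U) :
  continuous f -> continuous g -> continuous (fun x => (f x, g x)).
Proof. by move=> cf cg x; apply: cvg_pair; [exact: cf|exact: cg]. Qed.

Lemma cont_fst (S T : topologicalType) : continuous (fun x : S * T => x.1).
Proof. by move=> x; exact: cvg_fst. Qed.

Lemma cont_snd (S T : topologicalType) : continuous (fun x : S * T => x.2).
Proof. by move=> x; exact: cvg_snd. Qed.

Lemma cont_id (S : topologicalType) : continuous (fun x : S => x).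
Proof. by move=> x; exact: cvg_id. Qed.

Lemma cont_cstT (S T : topologicalType) (c : T) : continuous (fun _ : S => c).
Proof. by move=> x; exact: cvg_cst. Qed.

Lemma closed_preimage (S T : topologicalType) (f : S -> T) (D : set T) :
  continuous f -> closed D -> closed (f @^-1` D).
Proof. by move=> cf; apply: preimage_closed => x _; exact: cf. Qed.

(** * Singular simplices obtained from tuples of vectors *)

Section Deletion.
Context {T : choiceType}.
Implicit Types s : seq T.

Definition del i s := take i s ++ drop i.+1 s.

Lemma size_del i s n : size s = n.+1 -> (i < n.+1)%N -> size (del i s) = n.
Proof.
move=> sn i_n; have i_s : (i <= size s)%N by rewrite sn; exact: ltnW.
by rewrite size_cat size_drop size_takel// sn subSS subnKC.
Qed.

Lemma nth_del x0 i s j : (i < size s)%N -> nth x0 (del i s) j = nth x0 s (bump i j).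
Proof.
move=> si; rewrite nth_cat size_takel; last exact: ltnW; case: ltnP => ij.
  by rewrite nth_take// /bump leqNgt ij add0n.
by rewrite nth_drop /bump ij add1n addSn subnKC.
Qed.

Lemma bd1_sum s : bd1 s = \sum_(i < size s) (-1) ^+ i *: << del i s >>.
Proof.
elim: s => [|x s IH] /=; first by rewrite big_ord0.
rewrite big_ord_recl expr0 scale1r /del /= drop0; congr (_ + _).
rewrite IH (raddf_sum (cone x)) -sumrN; apply: eq_bigr => i _ /=.
by rewrite linearZ_LR /= coneU exprS mulN1r scaleNr.
Qed.

End Deletion.

Lemma map_del (T U : choiceType) (f : T -> U) i s : map f (del i s) = del i (map f s).
Proof. by rewrite /del map_cat map_take map_drop. Qed.

Section Singular.
Context {R : realType} {X : topologicalType} (x0 : X).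
Local Notation Delta k := (set_type (@std_simplex R k)).
Local Notation simplex k := (singular_simplex R X k).

Lemma simplex_val k (v : Delta k) : std_simplex (val v).
Proof. exact: set_mem (valP v). Qed.

(** A singular simplex as a function on the whole space, with the junk value
    [x0] off the standard simplex. *)
Definition ext k (g : simplex k) (v : 'rV[R]_k.+1) : X :=
  if pselect (std_simplex v) is left H then g (SigSub (mem_set H)) else x0.

Lemma extE k (g : simplex k) (v : Delta k) : ext g (val v) = g v.
Proof.
rewrite /ext; case: pselect => [H|/(_ (simplex_val v))//].
by congr (g _); apply: val_inj.
Qed.

Definition vertices k : seq 'rV[R]_k.+1 := [seq delta_mx 0 i | i <- enum 'I_k.+1].

Lemma size_vertices k : size (vertices k) = k.+1.
Proof. by rewrite size_map size_enum_ord. Qed.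

Lemma nth_vertices k (i : 'I_k.+1) : nth 0 (vertices k) i = delta_mx 0 i.
Proof. by rewrite (nth_map i) ?size_enum_ord// nth_ord_enum. Qed.

Lemma std_simplex_delta k (i : 'I_k.+1) : @std_simplex R k (delta_mx 0 i).
Proof.
split=> [j|]; first by rewrite mxE eqxx ler0n.
by rewrite (bigD1 i)//= mxE !eqxx big1 ?addr0// => j ij; rewrite mxE eqxx (negbTE ij).
Qed.

Lemma ents_vertices k : ents (@std_simplex R k) (vertices k).
Proof. by move=> _ /mapP[i _ ->]; exact: std_simplex_delta. Qed.

Lemma bary_closed_simplex k : bary_closed (@std_simplex R k).
Proof.
move=> t t0 tD; have n0 : (size t)%:R != 0 :> R.
  by case: t t0 {tD} => // *; rewrite pnatr_eq0.
rewrite /bary; split=> [i|].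
  rewrite mxE summxE mulr_ge0 ?invr_ge0// big_seq sumr_ge0// => v /tD[+ _]; exact.
under eq_bigr do rewrite mxE summxE.
rewrite -mulr_sumr exchange_big /= big_seq (eq_bigr (fun=> 1)); last by move=> v /tD[].
by rewrite -big_seq big_const_seq count_predT iter_addr_0 mulVf.
Qed.

Section Affine.
Context {W : normedModType R}.
Implicit Types s : seq W.

Definition aff s k (v : 'rV[R]_k.+1) : W := \sum_(j < k.+1) v 0 j *: nth 0 s j.

Lemma aff_is_linear s k : linear (@aff s k).
Proof.
move=> a u v; rewrite /aff scaler_sumr -big_split; apply: eq_bigr => j _.
by rewrite !mxE scalerDl scalerA.
Qed.
HB.instance Definition _ s k :=
  GRing.isLinear.Build R 'rV[R]_k.+1 W *:%R (@aff s k) (@aff_is_linear s k).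

Lemma aff_continuous s k : continuous (@aff s k).
Proof.
apply: continuous_sumr => j; apply: contZ; last exact: cont_cst.
  exact: coord_continuous.
Qed.

Lemma aff_delta s k (i : 'I_k.+1) : aff s (delta_mx 0 i) = nth 0 s i.
Proof.
rewrite /aff (bigD1 i)//= mxE !eqxx scale1r big1 ?addr0// => j ij.
by rewrite mxE eqxx (negbTE ij) scale0r.
Qed.

Lemma aff_vertices s k : size s = k.+1 -> map (@aff s k) (vertices k) = s.
Proof.
move=> sk; apply: (@eq_from_nth _ 0); rewrite size_map size_vertices// => i ik.
by rewrite (nth_map 0) ?size_vertices// (nth_vertices (Ordinal ik)) aff_delta.
Qed.

Lemma aff_face s k (i : 'I_k.+2) (v : 'rV[R]_k.+1) : size s = k.+2 ->
  aff s (face_map i v) = aff (del i s) v.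
Proof.
move=> sk; rewrite /aff (bigD1_ord i)//= mxE unlift_none scale0r add0r.
apply: eq_bigr => j _; rewrite mxE liftK /= nth_del//.
by rewrite sk.
Qed.

(* Points of the convex hull. *)
Lemma aff_close s k (v : 'rV[R]_k.+1) (a : W) (d : R) : std_simplex v ->
  size s = k.+1 -> ents (fun x => `|a - x| <= d) s -> `|a - aff s v| <= d.
Proof.
move=> [v0 v1] sk sd; have -> : a - aff s v = \sum_(j < k.+1) v 0 j *: (a - nth 0 s j).
  under eq_bigr do rewrite scalerBr.
  by rewrite sumrB -scaler_suml v1 scale1r.
apply: le_trans (ler_norm_sum _ _ _) _.
apply: (@le_trans _ _ (\sum_(j < k.+1) v 0 j * d)); last by rewrite -mulr_suml v1 mul1r.
apply: ler_sum => j _; rewrite normrZ ger0_norm// ler_wpM2l//.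
by apply: sd; rewrite mem_nth// sk.
Qed.

Definition pushable k (g : W -> X) s :=
  continuous (fun v : Delta k => g (aff s (val v))).

(** Made total in order to extend linearly: a constant simplex stands in when [g] is not continuous
    on the affine simplex. *)
Definition push k (g : W -> X) s : simplex k :=
  if pselect (pushable k g s) is left H then mkcts H else mkcts (@cont_cstT _ _ x0).

Lemma pushE k (g : W -> X) s (v : Delta k) : pushable k g s ->
  push k g s v = g (aff s (val v)).
Proof. by move=> H; rewrite /push; case: pselect. Qed.

Definition pushc k (g : W -> X) : chain W -> formal (simplex k) :=
  lin (fun s => << push k g s >>).
HB.instance Definition _ k g := GRing.Linear.on (@pushc k g).

Lemma pushcU k g s : pushc k g << s >> = << push k g s >>.
Proof. exact: linU. Qed.

Lemma face_map_continuous k (i : 'I_k.+2) : continuous (@face_map R k i).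
Proof.
have -> : @face_map R k i = fun v => v *m (\matrix_(a, j) (lift i a == j)%:R).
  apply/funext => v; apply/rowP => j; rewrite !mxE; case: unliftP => [j' ->|->] /=.
    rewrite (bigD1 j')//= mxE eqxx mulr1 big1 ?addr0// => a aj.
    by rewrite mxE (inj_eq (@lift_inj _ i)) (negbTE aj) mulr0.
  by rewrite big1// => a _; rewrite mxE eq_sym (negbTE (neq_lift _ _)) mulr0.
exact: mulmxr_continuous.
Qed.

Lemma face_continuous k (i : 'I_k.+2) : continuous (@face R k i).
Proof.
apply: (@continuous_comp_initial _ _ _ set_val) => v.
apply: (@continuous_comp _ _ _ set_val (@face_map R k i)).
  exact: initial_continuous.
exact: face_map_continuous.
Qed.

Definition sface k (i : 'I_k.+2) (g : simplex k.+1) : simplex k :=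
  mkcts (fun v => continuous_comp (@face_continuous k i v) (@cts_fun _ _ g _)).

Lemma sfaceE k (i : 'I_k.+2) (g : simplex k.+1) v : sface i g v = g (face i v).
Proof. by []. Qed.

Lemma pushable_del k (g : W -> X) s (i : 'I_k.+2) : size s = k.+2 ->
  pushable k.+1 g s -> pushable k g (del i s).
Proof.
move=> sk gs; rewrite /pushable.
have -> : (fun v : Delta k => g (aff (del i s) (val v))) =
    (fun v => g (aff s (val v))) \o (@face R k i).
  by apply/funext => v /=; rewrite -aff_face.
by move=> v; apply: continuous_comp; [exact: face_continuous|exact: gs].
Qed.

Lemma sface_push k (g : W -> X) s (i : 'I_k.+2) : size s = k.+2 ->
  pushable k.+1 g s -> sface i (push k.+1 g s) = push k g (del i s).
Proof.
move=> sk gs; apply/continuousEP => v.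
rewrite sfaceE !pushE//; first by rewrite -aff_face.
exact: pushable_del.
Qed.

End Affine.

Definition sbd k : formal (simplex k.+1) -> formal (simplex k) :=
  lin (fun g => \sum_(i < k.+2) (-1) ^+ i *: << sface i g >>).
HB.instance Definition _ k := GRing.Linear.on (@sbd k).

Lemma sbdU k (g : simplex k.+1) :
  sbd << g >> = \sum_(i < k.+2) (-1) ^+ i *: << sface i g >>.
Proof. exact: linU. Qed.

Lemma sbd_pushc (W : normedModType R) k (g : W -> X) c :
  carried (fun s => size s = k.+2 /\ pushable k.+1 g s) c ->
  sbd (pushc k.+1 g c) = pushc k g (bd c).
Proof.
move=> gc; rewrite /sbd /pushc /bd !lin_compU; apply: eq_lin_in => s /gc[sk gs].
rewrite linU bd1_sum sk raddf_sum /=; apply: eq_bigr => i _.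
by rewrite linearZ_LR /= linU sface_push.
Qed.

Lemma face_map_linear k (i : 'I_k.+2) : linear (@face_map R k i).
Proof.
move=> a u v; apply/rowP => j; rewrite !mxE; case: unlift => [j'|] /=; last by rewrite mulr0 addr0.
by rewrite !mxE.
Qed.
HB.instance Definition _ k (i : 'I_k.+2) :=
  GRing.isLinear.Build R 'rV[R]_k.+1 'rV[R]_k.+2 *:%R (@face_map R k i)
    (@face_map_linear k i).

Lemma face_map_vertices k (i : 'I_k.+2) :
  map (@face_map R k i) (vertices k) = del i (vertices k.+1).
Proof.
apply: (@eq_from_nth _ 0).
  by rewrite size_map (size_del (n := k.+1)) ?size_vertices.
rewrite size_map size_vertices => j jk.
rewrite (nth_map 0) ?size_vertices// nth_del ?size_vertices//.
rewrite (nth_vertices (Ordinal jk)) -[bump i j]/(nat_of_ord (lift i (Ordinal jk))) nth_vertices.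
apply/rowP => a; rewrite !mxE; case: unliftP => [b ->|->] /=.
  by rewrite mxE (inj_eq (@lift_inj _ i)).
by rewrite (negbTE (neq_lift _ _)).
Qed.

Lemma bd1_vertices k :
  bd1 (vertices k.+1) = \sum_(i < k.+2) (-1) ^+ i *: << map (@face_map R k i) (vertices k) >>.
Proof.
rewrite bd1_sum size_vertices; apply: eq_bigr => i _.
by rewrite face_map_vertices.
Qed.

Lemma std_simplex_face k (i : 'I_k.+2) (v : 'rV[R]_k.+1) :
  std_simplex (face_map i v) <-> std_simplex v.
Proof.
have sumE : \sum_j face_map i v 0 j = \sum_j v 0 j.
  rewrite (bigD1_ord i)//= mxE unlift_none add0r; apply: eq_bigr => j _.
  by rewrite mxE liftK.
rewrite /std_simplex /= sumE; split=> -[v0 v1]; split=> // j.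
  by have := v0 (lift i j); rewrite mxE liftK.
by rewrite mxE; case: unliftP => [j' _|_] /=.
Qed.

Lemma ext_sface k (i : 'I_k.+2) (g : simplex k.+1) v :
  ext (sface i g) v = ext g (face_map i v).
Proof.
rewrite /ext; case: pselect => H; case: pselect => H' //.
- by rewrite sfaceE; congr (g _); apply: val_inj.
- by case: H'; exact/std_simplex_face.
- by case: H; move/std_simplex_face: H'.
Qed.

(** The tautological tuple: through it, constructions on tuples of vectors apply to any singular
    simplex. *)
Lemma vertices_push k (g : simplex k) : push k (ext g) (vertices k) = g.
Proof.
have E (v : Delta k) : ext g (aff (vertices k) (val v)) = g v.
  rewrite -[in RHS]extE; congr ext; rewrite /aff.
  under eq_bigr do rewrite nth_vertices.
  by rewrite -[RHS]mulmx1 mulmx_sum_row; apply: eq_bigr => j _; rewrite rowE mulmx1.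
have H : pushable k (ext g) (vertices k).
  by rewrite /pushable (_ : (fun _ => _) = g); [exact: cts_fun|exact/funext].
by apply/continuousEP => v; rewrite pushE.
Qed.

(* Operations on the tuples of points of the standard simplices that commute
   with the face maps extend to singular chains. *)
Lemma natural_sbd (V : lmodType rat) k (N1 : simplex k.+1 -> seq 'rV[R]_k.+2 -> V)
    (N0 : simplex k -> V) :
  (forall (i : 'I_k.+2) g,
     N1 g (map (@face_map R k i) (vertices k)) = N0 (sface i g)) ->
  forall g, lin (N1 g) (bd1 (vertices k.+1)) = lin N0 (sbd << g >>).
Proof.
move=> NE g; rewrite bd1_vertices sbdU !raddf_sum; apply: eq_bigr => i _.
by rewrite /= !linearZ_LR /= !linU NE.
Qed.

Lemma map_aff (W W' : normedModType R) (f : {linear W -> W'}) k s (v : 'rV[R]_k.+1) :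
  size s = k.+1 -> aff (map f s) v = f (aff s v).
Proof.
move=> sk; rewrite /aff raddf_sum; apply: eq_bigr => j _.
by rewrite /= linearZ_LR /= (nth_map 0) ?sk.
Qed.

Lemma push_comp (W W' : normedModType R) (f : {linear W -> W'}) k (g : W' -> X) s :
  size s = k.+1 -> push k g (map f s) = push k (g \o f) s.
Proof.
move=> sk; have E v := map_aff f v sk.
rewrite /push.
have EE : pushable k g (map f s) = pushable k (g \o f) s.
  rewrite /pushable (_ : (fun v : Delta k => g (aff (map f s) (val v))) =
    (fun v => (g \o f) (aff s (val v))))//.
  by apply/funext => v /=; rewrite E.
case: pselect => H; case: pselect => H'.
- by apply/continuousEP => v; exact: (congr1 g (E (val v))).
- by case: H'; rewrite -EE.
- by case: H; rewrite EE.
- by apply/continuousEP => v.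
Qed.

Lemma pushc_mapc (W W' : normedModType R) (f : {linear W -> W'}) k (g : W' -> X) c :
  carried (fun s => size s = k.+1) c ->
  pushc k g (mapc f c) = pushc k (g \o f) c.
Proof.
move=> sc; rewrite /pushc /mapc lin_compU; apply: eq_lin_in => s /sc sk.
by rewrite linU push_comp.
Qed.

End Singular.

(** * Compactness and uniform continuity *)

Section Compactness.
Context {R : realType}.

Lemma compact_set_type (T : topologicalType) (A : set T) :
  compact A -> compact [set: set_type A].
Proof.
move=> cA; have [->|/set0P[a0 Aa0]] := eqVneq A set0.
  rewrite (_ : setT = set0); first exact: compact0.
  by apply/seteqP; split=> // -[x xA] _; have := set_mem xA.
pose f (x : T) : set_type A :=
  if pselect (A x) is left H then SigSub (mem_set H) else SigSub (mem_set Aa0).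
have fE x : A x -> val (f x) = x by move=> Ax; rewrite /f; case: pselect.
rewrite (_ : setT = f @` A); last first.
  apply/seteqP; split=> // -[x Ax] _; exists x; first exact: set_mem.
  by apply: val_inj; rewrite fE//; exact: set_mem.
apply: continuous_compact cA.
apply: (@continuous_comp_initial _ _ _ set_val).
have H : {within A, continuous (fun x : T => val (f x))}.
  apply: (@subspace_eq_continuous _ A _ (from_subspace A id)).
    by move=> x /set_mem Ax; rewrite /from_subspace /= fE.
  by apply: continuous_subspaceT => x; exact: cvg_id.
exact: H.
Qed.

(** On the compact set where [a >= e], [b] attains a minimum, which is positive since [a] vanishes
    wherever [b] does. Uniform continuity is the case where [T] consists of pairs, [b] is the
    distance of the arguments and [a] that of the values. *)
Lemma heine (T : topologicalType) (a b : T -> R) : compact [set: T] ->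
  continuous a -> continuous b -> (forall t, 0 <= b t) ->
  (forall t, b t = 0 -> a t = 0) ->
  forall e, 0 < e -> exists2 h, 0 < h & forall t, b t < h -> a t < e.
Proof.
move=> cT ca cb b0 ab e e0; pose K := [set t | e <= a t].
have cK : compact K.
  apply: subclosed_compact cT _ => //.
  by apply: (@closed_preimage _ _ a [set x | e <= x]); [|exact: closed_ge].
have [K0|/set0P K0] := eqVneq K set0.
  exists 1 => // t _; rewrite ltNge; apply/negP => ae.
  by have : K t := ae; rewrite K0.
have [t Kt tmin] := compact_EVT_min K0 cK (continuous_subspaceT cb).
exists (b t) => [|s bs].
  rewrite lt_def b0 andbT; apply/eqP => /ab at0.
  by move: Kt; rewrite inE /K /= at0 leNgt e0.
rewrite ltNge; apply/negP => ae.
by have := tmin s; rewrite inE => /(_ ae); rewrite leNgt bs.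
Qed.

Lemma std_simplex_compact k : compact (@std_simplex R k).
Proof.
apply: bounded_closed_compact.
  exists 1; split; first exact: num_real.
  move=> x x1 v [v0 v1] /=; apply: ltW; apply: mx_norm_lt => [|i j].
    exact: lt_trans x1.
  rewrite [i]ord1; apply: le_lt_trans x1; rewrite ger0_norm// -v1.
  by rewrite (bigD1 j)//= lerDl sumr_ge0.
rewrite (_ : @std_simplex R k = (\bigcap_(i in [set: 'I_k.+1])
    ((fun v : 'rV[R]_k.+1 => v 0 i) @^-1` [set x | 0 <= x])) `&`
    ((fun v : 'rV[R]_k.+1 => \sum_i v 0 i) @^-1` [set 1])); last first.
  by apply/seteqP; split=> v [v0 v1]; split=> // i; [move=> _; exact: v0|exact: v0 i I].
apply: closedI.
  apply: closed_bigI => i _; apply: closed_preimage; last exact: closed_ge.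
  exact: coord_continuous.
apply: closed_preimage; last exact: closed_eq.
by apply: continuous_sumr => i; exact: coord_continuous.
Qed.

Lemma simplex_compact k : compact [set: set_type (@std_simplex R k)].
Proof. exact/compact_set_type/std_simplex_compact. Qed.

End Compactness.

(** * Betti numbers in terms of formal sums *)

Section Betti.
Context {R : realType} {X : topologicalType}.
Local Notation simplex k := (singular_simplex R X k).

Definition coef_fun k (c : formal (simplex k)) : simplex k -> rat := fun s => c@_s.

Lemma coef_fun_chain k (c : formal (simplex k)) : is_chain (coef_fun c).
Proof.
apply: (sub_finite_set (B := [set` msupp c])); last exact: finite_fset.
by move=> s /= cs; rewrite mem_msupp.
Qed.

Lemma chain_coef_fun k (f : simplex k -> rat) : is_chain f ->
  exists c : formal (simplex k), f = coef_fun c.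
Proof.
move=> fc; exists (\sum_(s <- fset_set [set s | f s != 0]) << f s *g s >>).
apply/funext => t; rewrite /coef_fun raddf_sum /=.
have [ft|ft] := eqVneq (f t) 0.
  rewrite ft big_seq big1// => s; rewrite in_fset_set// => /set_mem /= fs.
  by rewrite mcoeffU; case: eqP => // st; move: fs; rewrite st ft eqxx.
rewrite (big_fsetD1 t)/=; last by rewrite in_fset_set// mem_set.
rewrite mcoeffUU big1_seq ?addr0// => s /andP[_]; rewrite !inE => /andP[st _].
by rewrite mcoeffU (negbTE st).
Qed.

Lemma coef_fun_inj k : injective (@coef_fun k).
Proof. by move=> c d cd; apply/malgP => s; exact: (congr1 (fun f : simplex k -> rat => f s) cd). Qed.

Lemma boundary_coef_fun k (c : formal (simplex k.+1)) :
  boundary (coef_fun c) = coef_fun (sbd c).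
Proof.
apply/funext => t; rewrite /boundary /coef_fun /sbd coeff_lin.
under [RHS]eq_bigr => g _.
  rewrite (raddf_sum (mcoeff t)) /= mulr_sumr.
  under eq_bigr => i _ do rewrite mcoeffZ mcoeffU mulrCA.
  over.
rewrite exchange_big /=; apply: eq_bigr => i _; rewrite -mulr_sumr; congr (_ * _).
have AE s : (s \in [set s : simplex k.+1 | s \o face i = t]) = (sface i s == t).
  apply/idP/eqP => [/set_mem/= st|<-]; last by apply/mem_set.
  by apply/continuousEP => v; rewrite -st.
rewrite (fsbigE [seq s <- msupp c | sface i s == t]).
- rewrite big_filter_cond (eq_bigl (fun s => sface i s == t)); last first.
    by move=> s; rewrite AE andbb.
  by rewrite big_mkcond; apply: eq_bigr => s _; case: eqP; rewrite ?mulr1 ?mulr0.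
- by rewrite filter_uniq// fset_uniq.
- by move=> s /=; rewrite mem_filter -AE => /andP[/set_mem].
- move=> s /mem_set; rewrite AE mem_filter => -> /= sc.
  by rewrite mcoeff_outdom.
Qed.

Definition sing_cycle k : formal (simplex k) -> Prop :=
  match k with 0 => fun _ => True | k'.+1 => fun c => sbd c = 0 end.

Lemma is_cycle_coef_fun k (c : formal (simplex k)) :
  is_cycle (coef_fun c) <-> sing_cycle c.
Proof.
case: k c => [|k] c /=; first by split=> // _; exact: coef_fun_chain.
rewrite boundary_coef_fun; split=> [[_ c0]|->].
  by apply/malgP => s; rewrite mcoeff0; exact: (congr1 (fun f : simplex k -> rat => f s) c0).
split; first exact: coef_fun_chain.
by apply/funext => s; rewrite /coef_fun mcoeff0.
Qed.

Lemma is_betti_formal k b : is_betti R X k b ->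
  exists2 z : 'I_b -> formal (simplex k), forall i, sing_cycle (z i) &
    forall c, sing_cycle c ->
      exists! a : 'rV[rat]_b, exists d, c - \sum_i a 0 i *: z i = sbd d.
Proof.
move=> [z zc zB].
have zch i : exists c : formal (simplex k), z i = coef_fun c.
  by apply: chain_coef_fun; have := zc i; case: k z {zB} zc => [|k'] z zc //= [].
have [w wE] := choice zch; exists w => [i|c cc].
  by apply/is_cycle_coef_fun; rewrite -wE.
have sE (a : 'rV[rat]_b) :
    (fun s => \sum_i a 0 i * z i s) = coef_fun (\sum_i a 0 i *: w i).
  apply/funext => s; rewrite /coef_fun raddf_sum; apply: eq_bigr => i _.
  by rewrite /= mcoeffZ wE.
have hE (a : 'rV[rat]_b) : homologous (coef_fun c) (fun s => \sum_i a 0 i * z i s) <->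
    exists d, c - \sum_i a 0 i *: w i = sbd d.
  rewrite sE; split=> [[d dc]|[d dE]].
    have [e ->] := chain_coef_fun dc; rewrite boundary_coef_fun => E; exists e.
    apply: coef_fun_inj; rewrite -E; apply/funext => s.
    by rewrite /coef_fun mcoeffB.
  exists (coef_fun d); first exact: coef_fun_chain.
  rewrite boundary_coef_fun -dE; apply/funext => s.
  by rewrite /coef_fun mcoeffB.
have [a [/hE ha ua]] := zB _ ((is_cycle_coef_fun c).2 cc).
by exists a; split=> // a' /hE; exact: ua.
Qed.

End Betti.

Lemma std_simplex_aff (R : realType) n k (s : seq 'rV[R]_n.+1) (v : 'rV[R]_k.+1) :
  std_simplex v -> size s = k.+1 -> ents (@std_simplex R n) s -> std_simplex (aff s v).
Proof.
move=> [v0 v1] sk sD; have sj (j : 'I_k.+1) : std_simplex (nth 0 s j).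
  by apply: sD; rewrite mem_nth// sk.
split=> [i|].
  by rewrite /aff summxE sumr_ge0// => j _; rewrite mxE mulr_ge0//; have [] := sj j.
rewrite /aff; under eq_bigr do rewrite summxE.
rewrite exchange_big /= -v1; apply: eq_bigr => j _.
under eq_bigr do rewrite mxE.
by rewrite -mulr_sumr; have [_ ->] := sj j; rewrite mulr1.
Qed.

(** A 0-chain always is a cycle in singular homology, but its augmented boundary is a multiple of
    the empty tuple, possibly nonzero; this is what [F [::] = 0] takes care of. *)
Lemma lin_bd_cycle (T : choiceType) (V : lmodType rat) (F : seq T -> V) k
    (w : chain T) : F [::] = 0 -> carried (fun s : seq T => size s = k.+1) w ->
  (k = 0%N \/ bd w = 0) -> lin F (bd w) = 0.
Proof.
move=> F0 wk [k0|->]; last by rewrite raddf0.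
rewrite linE big_seq big1// => s /= /msupp_lin[t /wk tk /(size_bd1 tk)].
by rewrite k0 => /size0nil ->; rewrite F0 scaler0.
Qed.

(** * Subdivision of singular chains *)

Section Subdivide.
Context {R : realType} {X : topologicalType} (x0 : X).
Local Notation Delta k := (set_type (@std_simplex R k)).
Local Notation simplex k := (singular_simplex R X k).
Local Notation ext := (ext x0).
Local Notation pushc := (pushc x0).
Local Notation vertices := (@vertices R).

Lemma pushable_ext k q (g : simplex k) s : size s = q.+1 ->
  ents (@std_simplex R k) s -> pushable q (ext g) s.
Proof.
move=> sq sD; have H (v : Delta q) : aff s (val v) \in @std_simplex R k.
  by apply/mem_set/std_simplex_aff => //; exact: simplex_val.
rewrite /pushable.
rewrite (_ : (fun _ => _) = fun v => g (SigSub (H v))); last first.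
  by apply/funext => v; rewrite -(extE x0).
apply: (@cont_comp _ _ _ (fun v : Delta q => SigSub (H v) : Delta k) g); last exact: cts_fun.
apply: (@continuous_comp_initial _ _ _ set_val).
apply: (@cont_comp _ _ _ (fun v : Delta q => val v) (@aff R _ s q)); last exact: aff_continuous.
exact: initial_continuous.
Qed.

(** Keeps only the vertices of the subdivided simplices. By [bd_svert] this is compatible with
    boundaries, so it links singular chains of [X] to tuples, from which the nerve map starts. *)
Definition svert m k : formal (simplex k) -> chain X :=
  lin (fun g => mapc (ext g) (sdm m (vertices k))).
HB.instance Definition _ m k := GRing.Linear.on (@svert m k).

Definition ssd m k : formal (simplex k) -> formal (simplex k) :=
  lin (fun g => pushc k (ext g) (sdm m (vertices k))).
HB.instance Definition _ m k := GRing.Linear.on (@ssd m k).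

Lemma ext_sface_fun k (i : 'I_k.+2) (g : simplex k.+1) :
  ext g \o @face_map R k i = ext (sface i g).
Proof. by apply/funext => v; rewrite /= -ext_sface. Qed.

Lemma mapc_sdm_face m k (i : 'I_k.+2) (g : simplex k.+1) :
  mapc (ext g) (sdm m (map (@face_map R k i) (vertices k))) =
  mapc (ext (sface i g)) (sdm m (vertices k)).
Proof. by rewrite -mapc_sdm mapc_comp ext_sface_fun. Qed.

Lemma size_sdm1 (W : lmodType R) m (s : seq W) k : size s = k ->
  carried (fun u : seq W => size u = k) (sdm m s).
Proof. by move=> sk; apply: size_sdm; exact: carriedU. Qed.

Lemma bd_svert m k (c : formal (simplex k.+1)) : bd (svert m c) = svert m (sbd c).
Proof.
rewrite /svert /sbd lin_compU (lin_comp (@bd X)); apply: eq_lin => g /=.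
rewrite bd_mapc bd_sdm1 /mapc lin_compU -/(mapc _).
rewrite (@natural_sbd _ _ _ _ (fun g s => mapc (ext g) (sdm m s))
  (fun h => mapc (ext h) (sdm m (vertices k)))) ?sbdU//.
by move=> i h; exact: mapc_sdm_face.
Qed.

Lemma size_svert m k (c : formal (simplex k)) :
  carried (fun u : seq X => size u = k.+1) (svert m c).
Proof.
apply: carried_lin => g _; apply: carried_mapc => u.
by rewrite size_map; apply: size_sdm1; exact: size_vertices.
Qed.

Lemma ents_sdm_vertices m k :
  carried (fun s => size s = k.+1 /\ ents (@std_simplex R k) s) (sdm m (vertices k)).
Proof.
move=> s sm; split; first by apply: (size_sdm1 (k := k.+1)) sm; exact: size_vertices.
by apply: carried_sdm sm; [exact: bary_closed_simplex|apply: carriedU; exact: ents_vertices].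
Qed.

Lemma svert0_ssd m k (c : formal (simplex k)) : svert 0 (ssd m c) = svert m c.
Proof.
rewrite /svert /ssd lin_compU; apply: eq_lin => g.
rewrite /pushc /pushc /mapc lin_compU; apply: eq_lin_in => s /ents_sdm_vertices[sk sD].
rewrite !linU; congr << _ >>; rewrite -[in RHS](aff_vertices sk) -[RHS]map_comp.
apply/eq_in_map => v /ents_vertices vD /=.
rewrite -[v]/(val (SigSub (mem_set vD) : Delta k)) extE pushE//.
exact: pushable_ext.
Qed.

Lemma sbd_ssd m k (c : formal (simplex k.+1)) : sbd (ssd m c) = ssd m (sbd c).
Proof.
rewrite /ssd (lin_comp (@sbd R X k)) [in RHS]/sbd lin_compU; apply: eq_lin => g /=.
rewrite sbd_pushc; last first.
  by move=> s /ents_sdm_vertices[sk sD]; split => //; exact: pushable_ext.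
rewrite bd_sdm1 {1}/pushc /pushc lin_compU -/(pushc _ _ _).
rewrite (@natural_sbd _ _ _ _ (fun g s => pushc k (ext g) (sdm m s))
  (fun h => pushc k (ext h) (sdm m (vertices k)))) ?sbdU//.
move=> i h; rewrite -mapc_sdm pushc_mapc ?ext_sface_fun//.
by apply: size_sdm1; exact: size_vertices.
Qed.

Lemma ssd_cycle m k (c : formal (simplex k)) : sing_cycle c -> sing_cycle (ssd m c).
Proof. by case: k c => //= k c c0; rewrite sbd_ssd c0 raddf0. Qed.

Lemma ssd_homologous m k (c : formal (simplex k)) : sing_cycle c ->
  exists e, c - ssd m c = sbd e.
Proof.
move=> cc; exists (lin (fun g => pushc k.+1 (ext g) (sdh m (vertices k))) c).
rewrite (lin_comp (@sbd R X k)).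
pose E (g : simplex k) := pushc k (ext g) (lin (sdh m) (bd1 (vertices k))).
rewrite (@eq_lin _ _ _ (fun g => << g >> - pushc k (ext g) (sdm m (vertices k)) - E g)).
  rewrite !linB_fun lin_id -/(ssd m c) (_ : lin E c = 0) ?subr0//.
  (* [E] collects the homotopy on the faces. In degree 0 only the empty face is left; in higher
     degrees naturality rewrites it as the homotopy of [sbd c], which is 0. *)
  rewrite /E {E}; case: k c cc => [|k] c cc /=.
    rewrite linE big1// => g _.
    have -> : lin (sdh m) (bd1 (vertices 0)) = 0; last by rewrite raddf0 scaler0.
    rewrite -bdU (@lin_bd_cycle _ _ _ 0)//; last by left.
    by apply: carriedU; rewrite size_vertices.
  rewrite (@eq_lin _ _ _ (fun g => lin (fun h => pushc k.+1 (ext h) (sdh m (vertices k)))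
     (sbd << g >>))).
    rewrite -lin_compU; have -> : lin (fun g : simplex k.+1 => sbd << g >>) c = sbd c.
      by rewrite -(lin_unique (@sbd R X k)).
    by rewrite cc raddf0.
  move=> g; rewrite {1}/pushc /pushc lin_compU -/(pushc _ _ _).
  apply: (@natural_sbd _ _ _ _ (fun g s => pushc k.+1 (ext g) (sdh m s))
     (fun h => pushc k.+1 (ext h) (sdh m (vertices k)))) => i h.
  rewrite -mapc_sdh pushc_mapc ?ext_sface_fun// => s /size_sdh ->.
  by rewrite size_vertices.
move=> g /=; rewrite sbd_pushc; last first.
  move=> s sh; have sk : size s = k.+2 by rewrite (size_sdh sh) size_vertices.
  split=> //; apply: pushable_ext => //.
  apply: carried_sdh sh; [exact: bary_closed_simplex|exact: ents_vertices].
by rewrite bd_sdh !raddfB /= pushcU vertices_push.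
Qed.

End Subdivide.

(** * Straightening small simplices through a neighbourhood retraction *)

Definition times_id (R : realType) (W W' : lmodType R) (f : W -> W') (p : W * R^o) : W' * R^o :=
  (f p.1, p.2).

Lemma times_id_is_linear (R : realType) (W W' : lmodType R) (f : {linear W -> W'}) :
  linear (times_id f).
Proof. by move=> a p q; rewrite /times_id /= linearP. Qed.
HB.instance Definition _ (R : realType) (W W' : lmodType R) (f : {linear W -> W'}) :=
  GRing.isLinear.Build R (W * R^o)%type (W' * R^o)%type *:%R (times_id f)
    (times_id_is_linear f).

Section Retract.
Context {R : realType} {V : normedModType R} {X : topologicalType} (x0 : X).
Context (iota : X -> V) (r : V -> X) (delta : R).
Hypotheses (iota_cont : continuous iota) (rK : cancel iota r).
Hypothesis r_cont : forall x y, `|iota x - y| < delta -> {for y, continuous r}.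
Local Notation Delta k := (set_type (@std_simplex R k)).
Local Notation simplex k := (singular_simplex R X k).
Local Notation ext := (ext x0).
Local Notation pushc := (pushc x0).
Local Notation vertices := (@vertices R).

(** One centre for the whole tuple: balls are convex, so for [d < delta] the hull of the tuple stays
    where [r] is continuous. *)
Definition near_image d (s : seq V) :=
  exists x, ents (fun y => `|iota x - y| <= d) s.

Lemma pushable_retraction d q s : d < delta -> size s = q.+1 -> near_image d s ->
  pushable q r s.
Proof.
move=> d_delta sq [x sx] v.
apply: (@continuous_comp _ _ _ (fun v : Delta q => aff s (val v)) r).
  apply: cont_comp; last exact: aff_continuous.
  exact: initial_continuous.
apply: (@r_cont x); apply: le_lt_trans d_delta; apply: aff_close => //.
exact: simplex_val.
Qed.

Definition small d k (g : simplex k) :=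
  forall v v' : Delta k, `|iota (g v) - iota (g v')| <= d.

(* The straight homotopy from a singular simplex to the affine simplex with the
   same vertices. *)
Definition straighten k (g : simplex k) (p : 'rV[R]_k.+1 * R^o) : X :=
  r ((1 - p.2) *: iota (ext g p.1) +
     p.2 *: aff (map iota (map (ext g) (vertices k))) p.1).

Lemma straighten_face k (i : 'I_k.+2) (g : simplex k.+1) :
  straighten g \o times_id (@face_map R k i) = straighten (sface i g).
Proof.
apply/funext => p; rewrite /straighten /= ext_sface aff_face; last first.
  by rewrite 2!size_map size_vertices.
suff -> : del i (map iota (map (ext g) (vertices k.+1))) =
    map iota (map (ext (sface i g)) (vertices k)) by [].
rewrite -2!map_del -face_map_vertices -[LHS]map_comp -[LHS]map_comp -[RHS]map_comp; apply: eq_map => v /=.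
by rewrite ext_sface.
Qed.

Lemma aff_fst (W W' : normedModType R) k (s : seq (W * W')) (v : 'rV[R]_k.+1) :
  size s = k.+1 -> (aff s v).1 = aff (map fst s) v.
Proof.
move=> sk; rewrite /aff.
have -> : (\sum_(j < k.+1) v 0 j *: nth 0 s j).1 = \sum_(j < k.+1) (v 0 j *: nth 0 s j).1.
  by elim/big_rec2: _ => //= j a b _ <-.
by apply: eq_bigr => j _; rewrite (nth_map 0) ?sk.
Qed.

Lemma aff_snd (W W' : normedModType R) k (s : seq (W * W')) (v : 'rV[R]_k.+1) :
  size s = k.+1 -> (aff s v).2 = aff (map snd s) v.
Proof.
move=> sk; rewrite /aff.
have -> : (\sum_(j < k.+1) v 0 j *: nth 0 s j).2 = \sum_(j < k.+1) (v 0 j *: nth 0 s j).2.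
  by elim/big_rec2: _ => //= j a b _ <-.
by apply: eq_bigr => j _; rewrite (nth_map 0) ?sk.
Qed.

Lemma aff_itv k (s : seq R^o) (v : 'rV[R]_k.+1) : size s = k.+1 -> std_simplex v ->
  ents (fun t => 0 <= t <= 1) s -> 0 <= aff s v <= 1.
Proof.
move=> sk [v0 v1] s01; have sj (j : 'I_k.+1) : 0 <= nth 0 s j <= 1.
  by apply: s01; rewrite mem_nth// sk.
apply/andP; split.
  by rewrite sumr_ge0// => j _; rewrite mulr_ge0//; have /andP[] := sj j.
rewrite -v1; apply: ler_sum => j _; rewrite ler_piMr//.
by have /andP[] := sj j.
Qed.

(** All the vertices of [g] are within [d] of [g w], hence so are their hull and the segment from
    [iota (g w)] into it; thus the homotopy never leaves the domain of continuity of [r]. *)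
Lemma straighten_near d k (g : simplex k) (w : Delta k) (t : R) :
  small d g -> 0 <= t <= 1 ->
  `|iota (g w) - ((1 - t) *: iota (ext g (val w)) +
     t *: aff (map iota (map (ext g) (vertices k))) (val w))| <= d.
Proof.
move=> sg /andP[t0 t1]; rewrite extE.
set a := aff _ _; have -> : iota (g w) - ((1 - t) *: iota (g w) + t *: a) =
    t *: (iota (g w) - a).
  by rewrite scalerBl scale1r scalerBr opprD opprB addrA [X in X - _ = _]addrC subrK.
have ad : `|iota (g w) - a| <= d.
  apply: aff_close; first exact: simplex_val.
    by rewrite 2!size_map size_vertices.
  move=> _ /mapP[_ /mapP[v /ents_vertices vD ->] ->].
  by rewrite -[v]/(val (SigSub (mem_set vD) : Delta k)) extE.
rewrite normrZ ger0_norm//; apply: le_trans ad; rewrite ler_piMl//.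
Qed.

Lemma pushable_straighten d k q (g : simplex k) s : d < delta -> small d g ->
  size s = q.+1 ->
  ents (fun p : 'rV[R]_k.+1 * R^o => std_simplex p.1 /\ 0 <= p.2 <= 1) s ->
  pushable q (straighten g) s.
Proof.
move=> d_delta sg sq sD.
have H1 (v : Delta q) : (aff s (val v)).1 \in @std_simplex R k.
  rewrite aff_fst//; apply/mem_set/std_simplex_aff.
  - exact: simplex_val.
  - by rewrite size_map.
  - by move=> _ /mapP[p /sD[pD _] ->].
have H2 (v : Delta q) : 0 <= (aff s (val v)).2 <= 1.
  rewrite aff_snd//; apply: aff_itv; last by move=> _ /mapP[p /sD[_ p01] ->].
    by rewrite size_map.
  exact: simplex_val.
pose w (v : Delta q) : Delta k := SigSub (H1 v).
have cv : continuous (fun v : Delta q => aff s (val v)).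
  apply: (@cont_comp _ _ _ (fun v : Delta q => val v) (@aff R _ s q)).
    exact: initial_continuous.
  exact: aff_continuous.
have c1 : continuous (fun v : Delta q => (aff s (val v)).1).
  by apply: cont_comp cv _; exact: cont_fst.
have c2 : continuous (fun v : Delta q => (aff s (val v)).2).
  by apply: cont_comp cv _; exact: cont_snd.
have cw : continuous w by apply: (@continuous_comp_initial _ _ _ set_val).
pose h (v : Delta q) : V := (1 - (aff s (val v)).2) *: iota (g (w v)) +
  (aff s (val v)).2 *: aff (map iota (map (ext g) (vertices k))) (val (w v)).
have ch : continuous h.
  apply: contD; apply: contZ => //.
  - by apply: contB => //; exact: cont_cst.
  - by apply: cont_comp => //; apply: cont_comp => //; exact: cts_fun.
  - by apply: (cont_comp c1); exact: aff_continuous.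
rewrite /pushable (_ : (fun _ => _) = r \o h).
  move=> v; apply: continuous_comp; first exact: ch.
  apply: (@r_cont (g (w v))); apply: le_lt_trans d_delta.
  rewrite /h -(extE x0 g); rewrite {1}extE.
  exact: straighten_near.
by apply/funext => v; rewrite /straighten /= /h -(extE x0).
Qed.

Lemma straighten0 k (g : simplex k) :
  push x0 k (straighten g) (map (fun v => (v, 0 : R^o)) (vertices k)) = g.
Proof.
have E (v : Delta k) : aff (map (fun v => (v, 0 : R^o)) (vertices k)) (val v) = (val v, 0).
  have sk : size (map (fun v => (v, 0 : R^o)) (vertices k)) = k.+1.
    by rewrite size_map size_vertices.
  apply: injective_projections.
    rewrite aff_fst// -map_comp (eq_map (g := id)) ?map_id//= /aff.
    under eq_bigr do rewrite nth_vertices.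
    by rewrite -[RHS]mulmx1 mulmx_sum_row; apply: eq_bigr => j _; rewrite rowE mulmx1.
  rewrite aff_snd// -map_comp /= /aff big1// => j _.
  by rewrite (nth_map 0) ?size_vertices// scaler0.
have SE (v : Delta k) : straighten g (aff (map (fun v => (v, 0 : R^o)) (vertices k)) (val v)) = g v.
  by rewrite E /straighten /= subr0 scale1r scale0r addr0 extE rK.
apply/continuousEP => v; rewrite pushE ?SE//.
by rewrite /pushable (_ : (fun _ => _) = g); [exact: cts_fun|exact/funext].
Qed.

Lemma straighten1 k (g : simplex k) (c : chain 'rV[R]_k.+1) :
  carried (fun s : seq 'rV[R]_k.+1 => size s = k.+1) c ->
  pushc k (straighten g) (mapc (fun v => (v, 1 : R^o)) c) =
  pushc k r (mapc (@aff R _ (map iota (map (ext g) (vertices k))) k) c).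
Proof.
move=> ck; rewrite [RHS]pushc_mapc//.
rewrite /pushc /pushc /mapc lin_compU; apply: eq_lin_in => s /ck sk.
rewrite linU; congr << _ >>.
have E (v : Delta k) : straighten g (aff (map (fun v => (v, 1 : R^o)) s) (val v)) =
    r (aff (map iota (map (ext g) (vertices k))) (aff s (val v))).
  have -> : aff (map (fun v => (v, 1 : R^o)) s) (val v) = (aff s (val v), 1).
    apply: injective_projections.
      by rewrite aff_fst ?size_map// -map_comp (eq_map (g := id)) ?map_id.
    rewrite aff_snd ?size_map// -map_comp /= /aff -[RHS](proj2 (simplex_val v)).
    apply: eq_bigr => j _; rewrite (nth_map 0) ?sk//.
    exact: mulr1.
  by rewrite /straighten /= subrr scale0r scale1r add0r.
have EE : pushable k (straighten g) (map (fun v => (v, 1 : R^o)) s) =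
    pushable k (r \o @aff R _ (map iota (map (ext g) (vertices k))) k) s.
  by rewrite /pushable; under eq_fun do rewrite E.
rewrite /push; case: pselect => H; case: pselect => H'.
- by apply/continuousEP => v; exact: E.
- by case: H'; rewrite -EE.
- by case: H; rewrite EE.
- by apply/continuousEP => v.
Qed.

(** The bounding chain is the prism over each simplex, mapped by the straight homotopy. Its lower
    end is [c]; its upper end is subdivided, whence the [sd] in the conclusion. *)
Lemma straighten_homologous d k (c : formal (simplex k)) : d < delta ->
  carried (small d (k := k)) c -> sing_cycle c ->
  exists e, c - pushc k r (sd (mapc iota (svert x0 0 c))) = sbd e.
Proof.
move=> d_delta sc cc.
exists (lin (fun g => pushc k.+1 (straighten g) (prism (vertices k))) c).
rewrite (lin_comp (@sbd R X k)).
pose E (g : simplex k) := pushc k (straighten g) (lin prism (bd1 (vertices k))).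
pose B (g : simplex k) := pushc k r (sd (mapc iota (mapc (ext g) (sdm 0 (vertices k))))).
rewrite (@eq_lin_in _ _ _ (fun g => << g >> - B g - E g)).
  rewrite !linB_fun lin_id (_ : lin E c = 0) ?subr0.
    congr (_ - _); rewrite /B /svert.
    rewrite (lin_comp (mapc iota)) (lin_comp (@sd R V)).
    by rewrite (lin_comp (pushc k r)).
  rewrite /E {E B}; case: k c cc sc => [|k] c cc sc /=.
    rewrite linE big1// => g _.
    have -> : lin (@prism R _) (bd1 (vertices 0)) = 0; last by rewrite raddf0 scaler0.
    rewrite -bdU (@lin_bd_cycle _ _ _ 0)//; last by left.
    by apply: carriedU; rewrite size_vertices.
  rewrite (@eq_lin _ _ _ (fun g => lin (fun h => pushc k.+1 (straighten h) (prism (vertices k)))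
     (sbd << g >>))).
    rewrite -lin_compU; have -> : lin (fun g : simplex k.+1 => sbd << g >>) c = sbd c.
      by rewrite -(lin_unique (@sbd R X k)).
    by rewrite cc raddf0.
  move=> g; rewrite {1}/pushc /pushc lin_compU -/(pushc _ _ _).
  apply: (@natural_sbd _ _ _ _ (fun g s => pushc k.+1 (straighten g) (prism s))
     (fun h => pushc k.+1 (straighten h) (prism (vertices k)))) => i h.
  rewrite -(mapc_prism (@face_map R k i)) -straighten_face -/(times_id _).
  rewrite pushc_mapc// => s /size_prism ->.
  by rewrite size_vertices.
move=> g gc /=; rewrite sbd_pushc; last first.
  move=> s sh; have sk : size s = k.+2 by rewrite (size_prism sh) size_vertices.
  split=> //; apply: pushable_straighten d_delta (sc _ gc) sk _.
  apply: carried_prism sh; [exact: bary_closed_simplex|exact: ents_vertices].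
rewrite bd_prism !raddfB /= pushcU straighten0 straighten1; last first.
  by move=> s /size_sd1 ->; rewrite size_vertices.
rewrite /B mapc_sd1 aff_vertices; last by rewrite 2!size_map size_vertices.
by rewrite /sdm /= !mapcU /sd linU.
Qed.

End Retract.

Lemma fset_uniform (K : choiceType) (A : {fset K}) (P : K -> nat -> Prop) :
  (forall x, x \in A -> exists m0, forall m, (m0 <= m)%N -> P x m) ->
  exists m0, forall m, (m0 <= m)%N -> forall x, x \in A -> P x m.
Proof.
move=> H; have H' (x : K) : exists m0, x \in A -> forall m, (m0 <= m)%N -> P x m.
  case: (boolP (x \in A)) => [/H[m0 Hm]|_]; first by exists m0.
  by exists 0%N.
have [f fP] := choice H'; exists (\max_(x <- A) f x)%N => m mm x xA.
apply: fP => //; apply: leq_trans mm.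
by rewrite (big_fsetD1 x xA) leq_maxl.
Qed.

(** * Chain homotopies pushed through the retraction *)

Section Approximation.
Context {R : realType} {V : normedModType R} {X : topologicalType} (x0 : X).
Context (iota : X -> V) (r : V -> X) (delta : R).
Hypotheses (iota_cont : continuous iota) (rK : cancel iota r).
Hypothesis r_cont : forall x y, `|iota x - y| < delta -> {for y, continuous r}.
Local Notation Delta k := (set_type (@std_simplex R k)).
Local Notation simplex k := (singular_simplex R X k).
Local Notation ext := (ext x0).
Local Notation pushc := (pushc x0).
Local Notation vertices := (@vertices R).
Local Notation near_image := (near_image iota).
Local Notation small := (small iota).

Lemma pushable_near d q s : d < delta -> size s = q.+1 -> near_image d s ->
  pushable q r s.
Proof. exact: (@pushable_retraction _ _ _ iota r delta r_cont). Qed.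

(** Serves to remove the [sd] left by the upper end of the prism. *)
Lemma pushc_sd_homologous d k (w : chain V) : d < delta ->
  carried (fun s : seq V => size s = k.+1 /\ near_image d s) w ->
  (k = 0%N \/ bd w = 0) ->
  exists e, pushc k r w - pushc k r (sd w) = sbd e.
Proof.
move=> d_delta wk w0; exists (pushc k.+1 r (lin (sdh 1) w)).
rewrite sbd_pushc; last first.
  apply: carried_lin => s /wk[sk [x sx]] t ts.
  have tk : size t = k.+2 by rewrite (size_sdh ts) sk.
  split=> //; apply: pushable_near d_delta tk _; exists x.
  by apply: carried_sdh ts => //; exact: bary_closed_ball.
rewrite (lin_comp (@bd V)).
rewrite (@eq_lin _ _ _ (fun s => << s >> - sdm 1 s - lin (sdh 1) (bd1 s))); last first.
  by move=> s; exact: bd_sdh.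
rewrite !linB_fun lin_id.
have E : lin (fun s => lin (sdh 1) (bd1 s)) w = 0.
  apply: etrans (esym (lin_compU (@bd1 V) (sdh 1) w)) _.
  by apply: (@lin_bd_cycle _ _ _ k) => // s /wk[].
transitivity (pushc k r (w - lin (sdm 1) w - 0)); last first.
  exact: (esym (congr1 (fun z => pushc k r (w - lin (sdm 1) w - z)) E)).
rewrite subr0 raddfB; congr (_ - pushc _ _ _).
by rewrite -iter_sd_lin.
Qed.

(** [P] is a chain map on tuples of points whose homotopy to the identity is so small that the
    affine simplices on its tuples can be pushed by [r]. *)
Lemma pushc_htpy_homologous d k (w : chain X) (P : seq X -> chain X) p :
  d < delta -> (forall s, bd (P s) = lin P (bd1 s)) -> P [::] = << [::] >> ->
  (forall s, carried (fun u : seq X => size u = size s) (P s)) ->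
  carried (fun s : seq X => size s = k.+1 /\
    exists x, carried (ents (fun y => `|iota x - iota y| <= d))
      (htpy (fun t => << t >>) P p s)) w ->
  (k = 0%N \/ bd w = 0) ->
  exists e, pushc k r (mapc iota w) - pushc k r (mapc iota (lin P w)) = sbd e.
Proof.
move=> d_delta bdP P0 sP wk w0; pose h := htpy (fun t => << t >>) P p.
have sh s : carried (fun u : seq X => size u = (size s).+1) (h s).
  by apply: size_htpy => // t; exact: carriedU.
exists (pushc k.+1 r (mapc iota (lin h w))).
rewrite sbd_pushc; last first.
  apply: carried_mapc; apply: carried_lin => s /wk[sk [x sx]] t ts.
  have tk : size (map iota t) = k.+2 by rewrite size_map (sh _ _ ts) sk.
  split=> //; apply: pushable_near d_delta tk _; exists x.
  by move=> _ /mapP[y yt ->]; exact: sx ts _ yt.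
rewrite bd_mapc (lin_comp (@bd X)).
rewrite (@eq_lin _ _ (@bd X \o h) (fun s => << s >> - P s - lin h (bd1 s))); last first.
  by move=> s /=; rewrite /h bd_htpy // => t; rewrite bdU lin_id.
rewrite !linB_fun lin_id -(lin_compU (@bd1 X) h) -/(bd w) (@lin_bd_cycle _ _ _ k)//; last first.
  by move=> s /wk[].
by rewrite subr0 !raddfB.
Qed.

Lemma diam_vertices k : diam_le 2 (vertices k).
Proof.
move=> x y /mapP[i _ ->] /mapP[j _ ->]; apply/ltW/mx_norm_lt => // a b.
rewrite !mxE; case: (_ && _); case: (_ && _); rewrite ?subrr ?subr0 ?sub0r ?normrN ?normr0 ?normr1; lra.
Qed.

(** The two alternatives for [v] and [v'] prepare [ssd_small]: points of the affine simplex on [s]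
    for subdivided simplices, entries of [s] for tuples of vertices. *)
Lemma simplex_small k (g : simplex k) (d : R) : 0 < d ->
  exists m0, forall m, (m0 <= m)%N -> forall s, s \in msupp (sdm m (vertices k)) ->
    (forall v v', std_simplex v -> std_simplex v' ->
      (exists a : 'rV[R]_k.+1, [/\ std_simplex a & v = aff s a]) \/ v \in s ->
      (exists a : 'rV[R]_k.+1, [/\ std_simplex a & v' = aff s a]) \/ v' \in s ->
      `|iota (ext g v) - iota (ext g v')| <= d).
Proof.
move=> d0.
have [|||||h h0 Hh] := @heine R (Delta k * Delta k)%type
  (fun p => `|iota (g p.1) - iota (g p.2)|) (fun p => `|val p.1 - val p.2|) _ _ _ _ _ _ d0.
- rewrite -setXTT; apply: compact_setX; exact: simplex_compact.
- apply: cont_comp; last exact: norm_continuous.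
  apply: contB; (apply: cont_comp => //; apply: cont_comp; last exact: cts_fun).
    exact: cont_fst.
  exact: cont_snd.
- apply: cont_comp; last exact: norm_continuous.
  by apply: contB; (apply: cont_comp; last exact: initial_continuous); [exact: cont_fst|exact: cont_snd].
- by [].
- by move=> [v v'] /= /normr0_eq0/eqP; rewrite subr_eq0 => /eqP/val_inj ->; rewrite subrr normr0.
(* The mesh bounds are weak inequalities while [Hh] asks for a strict one. *)
have h20 : 0 < h / 2 by rewrite divr_gt0.
have [m0 Hm] := @mesh_small R k 2 (h / 2) h20.
exists m0 => m mm s sm v v' vD v'D va va'.
have [sk sD] := ents_sdm_vertices sm.
have ds : diam_le (h / 2) s.
  move=> x y xs ys; apply: le_trans (Hm _ mm).
  by apply: (mesh_sdm _ _ (@diam_vertices k) sm); rewrite ?size_vertices.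
have sub (b : 'rV[R]_k.+1) : (exists a : 'rV[R]_k.+1, [/\ std_simplex a & b = aff s a]) \/ b \in s ->
    forall y, y \in s -> `|y - b| <= h / 2.
  move=> [[a [aD ->]]|bs] y ys; last exact: ds.
  by apply: aff_close => // z zs; exact: ds.
have vv' : `|v - v'| <= h / 2.
  case: va => [[a [aD ->]]|vs]; last exact: sub va' _ vs.
  rewrite distrC; apply: aff_close => // z zs.
  by rewrite distrC; exact: sub va' _ zs.
apply/ltW; rewrite -[v]/(val (SigSub (mem_set vD) : Delta k)) -[v']/(val (SigSub (mem_set v'D) : Delta k)) !extE.
apply: (Hh (_, _)) => /=; apply: le_lt_trans vv' _.
by rewrite ltr_pdivrMr// ltr_pMr// ltr1n.
Qed.

Definition diam_im (d : R) (s : seq X) :=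
  forall x y, x \in s -> y \in s -> `|iota x - iota y| <= d.

Lemma ssd_small k (c : formal (simplex k)) (d : R) : 0 < d ->
  exists m0, forall m, (m0 <= m)%N ->
    carried (small d (k := k)) (ssd x0 m c) /\ carried (diam_im d) (svert x0 m c).
Proof.
move=> d0.
have [m0 Hm] := @fset_uniform _ (msupp c) _ (fun g gc => @simplex_small k g d d0).
exists m0 => m mm; have {}Hm := Hm m mm; split.
  apply: carried_lin => g gc; apply: carried_lin => s sm; apply: carriedU => v v'.
  have [sk sD] := ents_sdm_vertices sm.
  rewrite !pushE; try exact: pushable_ext.
  have aD (w : Delta k) : std_simplex (aff s (val w)).
    by apply: std_simplex_aff => //; exact: simplex_val.
  by apply: (Hm g gc s sm) => //; left; [exists (val v)|exists (val v')]; split=> //; exact: simplex_val.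
apply: carried_lin => g gc; apply: carried_mapc => s sm _ _ /mapP[v vs ->] /mapP[v' v's ->].
have [sk sD] := ents_sdm_vertices sm.
by apply: (Hm g gc s sm); [exact: sD|exact: sD|right|right].
Qed.

Lemma svert_push m k s : size s = k.+1 -> pushable k r s ->
  svert x0 m << push x0 k r s >> = mapc r (sdm m s).
Proof.
move=> sk rs; rewrite /svert linU -[in RHS](aff_vertices sk) -mapc_sdm mapc_comp.
apply: eq_mapc_in => t /ents_sdm_vertices[_ tD] v /tD vD.
by rewrite -[v]/(val (SigSub (mem_set vD) : Delta k)) extE pushE.
Qed.

Lemma svert_pushc m k (w : chain V) :
  carried (fun s : seq V => size s = k.+1 /\ pushable k r s) w ->
  svert x0 m (pushc k r w) = mapc r (iter m sd w).
Proof.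
move=> wk; rewrite iter_sd_lin (lin_comp (mapc r)) /pushc /pushc.
rewrite (lin_comp (@svert _ _ _ m k)); apply: eq_lin_in => s /wk[sk rs] /=.
exact: svert_push.
Qed.

End Approximation.

Local Notation svert_at R X x0 m k := (@svert R X x0 m k).

(** * The nerve of a fine cover as a finite model of the homology *)

Section FiniteModel.
Context {R : realType} {V : normedModType R} {X : topologicalType} (x0 : X).
Context (iota : X -> V) (r : V -> X) (delta : R).
Hypotheses (iota_cont : continuous iota) (rK : cancel iota r).
Hypothesis r_cont : forall x y, `|iota x - y| < delta -> {for y, continuous r}.
Context {I : finType} (U : I -> X -> bool) (eps eta : R).
Hypothesis U_close : forall a x y, U a x -> U a y -> `|iota x - iota y| <= eps.
Hypothesis U_lebesgue : forall s, s <> [::] -> diam_im iota eta s -> carrier_set U s != finset.set0.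
Hypotheses (eta0 : 0 < eta) (eta_eps : eta <= eps) (eps_delta : 2 * eps < delta).
Local Notation P := {set I}.
Local Notation simplex k := (singular_simplex R X k).
Local Notation pushc := (pushc x0).
Local Notation svert := (@svert R X x0).

(** The simplices of the nerve; good flags are then the simplices of its barycentric subdivision,
    and [pt] picks a point in the intersection. *)
Definition good (S : P) : bool := `[< S != finset.set0 /\ exists x, forall a, a \in S -> U a x >].
Definition pt (S : P) : X := xget x0 [set x | forall a, a \in S -> U a x].

Lemma ptP S : good S -> forall a, a \in S -> U a (pt S).
Proof. by move=> /asboolP[_ [x Sx]]; exact: (xgetPex x0 (ex_intro [set y | forall a, a \in S -> U a y] x Sx)). Qed.

Let good_flag := (good_flag good).

Lemma eps_ge0 : 0 <= eps. Proof. exact: le_trans (ltW eta0) eta_eps. Qed.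

Lemma diam_im_subseq d (s t : seq X) : subseq t s -> diam_im iota d s -> diam_im iota d t.
Proof. by move=> ts sd x y xt yt; apply: sd; exact: (mem_subseq ts). Qed.

Lemma nerve_good s : diam_im iota eta s ->
  carried (fun f => good_flag f /\ forall S y, S \in f -> y \in s ->
    `|iota (pt S) - iota y| <= 2 * eps) (nerve1 U s).
Proof.
move=> sd f /nerve1_carried[fl fS].
have H S : S \in f -> good S /\ exists t, [/\ subseq t s, t <> [::] & S = carrier_set U t].
  move=> /fS[t [ts t0 SE]]; split; last by exists t.
  apply/asboolP; split; first by rewrite SE U_lebesgue//; exact: diam_im_subseq sd.
  case: t t0 ts SE => // x t _ _ ->; exists x => a.
  by rewrite inE => /= /andP[].
split; first by apply/andP; split; [exact: fl|apply/allP => S /H[]].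
move=> S y /H[gS [t [ts t0 SE]]] ys.
have /finset.set0Pn[a aS] : S != finset.set0 by have /asboolP[] := gS.
case: t t0 ts SE => // x t _ ts SE.
have Uax : U a x by move: aS; rewrite SE inE /= => /andP[].
have xs : x \in s by apply: (mem_subseq ts); rewrite inE eqxx.
(* [x] is a point of the tuple lying in the same [U a] as [pt S]: [eps] accounts for this set, and
   [eta], at most [eps], for the tuple. *)
have -> : iota (pt S) - iota y = (iota (pt S) - iota x) + (iota x - iota y).
  by rewrite addrA subrK.
apply: le_trans (ler_normD _ _) _; rewrite mulr2n mulrDl mul1r; apply: lerD.
  exact: U_close (ptP gS aS) Uax.
exact: le_trans (sd _ _ xs ys) eta_eps.
Qed.

Lemma near_image_diam d s : s <> [::] -> diam_im iota d s -> near_image iota d (map iota s).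
Proof.
case: s => // x s _ sd; exists x => _ /mapP[y ys ->]; apply: sd => //.
by rewrite inE eqxx.
Qed.

Lemma eps_lt_delta : eps < delta.
Proof. by have := eps_ge0; have := eps_delta; lra. Qed.

Lemma eta_lt_delta : eta < delta.
Proof. exact: le_lt_trans eta_eps eps_lt_delta. Qed.

Lemma sing_cycle_svert m k (c : formal (simplex k)) : sing_cycle c ->
  k = 0%N \/ bd (svert m c) = 0.
Proof. by case: k c => [|k] c cc; [left|right; rewrite bd_svert cc raddf0]. Qed.

Definition realize k : chain P -> formal (simplex k) :=
  pushc k r \o (mapc iota \o mapc pt).
HB.instance Definition _ k := GRing.Linear.on (realize k).

(** Four homologies are composed: subdivide, straighten (which leaves an [sd]), undo this [sd], and
    replace the tuples by the points [pt] of the carriers of their faces. The last homotopy stays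
    within [2 * eps] of a vertex of the tuple, hence the bound [eps_delta]. *)
Lemma nerve_approx k (c : formal (simplex k)) : sing_cycle c ->
  \forall m \near \oo, exists e, c - realize k (nerve U (svert m c)) = sbd e.
Proof.
move=> cc; have [m0 Hm] := ssd_small x0 iota_cont c eta0.
exists m0 => // m /= mm; have [sm dm] := Hm m mm.
have [e1 E1] := ssd_homologous x0 m cc.
have cc1 := ssd_cycle x0 m cc.
have [e2 E2] := straighten_homologous x0 iota_cont rK r_cont eta_lt_delta sm cc1.
rewrite svert0_ssd in E2.
have w0 := sing_cycle_svert m cc.
have iw0 : k = 0%N \/ bd (mapc iota (svert m c)) = 0.
  by case: w0 => [k0|w0]; [left|right; rewrite bd_mapc w0 raddf0].
have [e3 E3] : exists e, pushc k r (mapc iota (svert m c)) -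
    pushc k r (sd (mapc iota (svert m c))) = sbd e.
  apply: (pushc_sd_homologous x0 r_cont eta_lt_delta) => //.
  apply: carried_mapc => s sw; have sk := size_svert sw.
  split; first by rewrite size_map.
  by apply: near_image_diam; [case: s sk {sw}|exact: dm].
have [e4 E4] : exists e, pushc k r (mapc iota (svert m c)) - pushc k r (mapc iota
    (lin (fun s => mapc pt (nerve1 U s)) (svert m c))) = sbd e.
  apply: (pushc_htpy_homologous x0 (p := head x0) r_cont eps_delta) => //.
  - by move=> s; rewrite bd_mapc bd_nerve1 /mapc lin_compU.
  - by rewrite /nerve1 crec_nil mapcU.
  - by move=> s; apply: carried_mapc => f /size_nerve1; rewrite size_map.
  move=> s sw; have sk := size_svert sw; split=> //.
  exists (head x0 s); apply: carried_htpy => t ts t0.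
  have hs : head x0 s \in s by case: s sk {sw ts} => // x s _; rewrite inE eqxx.
  have two : eta <= 2 * eps by have := eta_eps; have := eps_ge0; lra.
  have ht : head x0 t \in s.
    by apply: (mem_subseq ts); case: t t0 {ts} => // x t _; rewrite inE eqxx.
  split.
  - apply: carriedU => y yt; apply: le_trans two; apply: (dm s sw) => //.
    exact: mem_subseq ts _ yt.
  - apply: carried_mapc => f /nerve1_carried[fl fS] _ /mapP[S Sf ->].
    have [u [ut u0 SE]] := fS _ Sf; rewrite distrC.
    have uf := nerve_good (diam_im_subseq (subseq_trans ut ts) (dm s sw)).
    have [y yu] : exists y, y \in u by case: u u0 {ut SE uf} => // y u _; exists y; rewrite inE eqxx.
    have ys : y \in s by apply: (mem_subseq ts); exact: mem_subseq ut _ yu.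
    have gS : good S.
      apply/asboolP; split.
        by rewrite SE U_lebesgue//; exact: diam_im_subseq (subseq_trans ut ts) (dm s sw).
      by exists y => a; rewrite SE inE => /allP/(_ _ yu).
    have /finset.set0Pn[a aS] : S != finset.set0 by have /asboolP[] := gS.
    have Uay : U a y by move: aS; rewrite SE inE => /allP/(_ _ yu).
    have -> : iota (pt S) - iota (head x0 s) = (iota (pt S) - iota y) + (iota y - iota (head x0 s)).
      by rewrite addrA subrK.
    apply: le_trans (ler_normD _ _) _; rewrite mulr2n mulrDl mul1r; apply: lerD.
      exact: U_close (ptP gS aS) Uay.
    by apply: le_trans eta_eps; exact: (dm s sw).
  - by apply: le_trans two; exact: (dm s sw).
have NE : lin (fun s => mapc pt (nerve1 U s)) (svert m c) = mapc pt (nerve U (svert m c)).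
  by rewrite /nerve (lin_comp (mapc pt)).
rewrite NE in E4.
exists (e1 + e2 - e3 + e4); rewrite !raddfD raddfN /= -E1 -E2 -E3 -E4.
by rewrite opprB !addrA subrK subrK subrK.
Qed.

(** An index in the least set of the flag belongs to all its sets, so all the points [pt] lie in one
    set of the cover. *)
Lemma flag_diam s : good_flag s -> diam_im iota eps (map pt s).
Proof.
case: s => [_ x y|S0 s]; first by rewrite in_nil.
move=> /andP[]; rewrite flag_cons => /andP[/allP S0s _] /allP gs.
have gS0 : good S0 by apply: gs; rewrite inE eqxx.
have /finset.set0Pn[a aS0] : S0 != finset.set0 by have /asboolP[] := gS0.
have H S : S \in S0 :: s -> U a (pt S).
  move=> Ss; apply: ptP; first exact: gs.
  move: Ss; rewrite inE => /orP[/eqP ->//|/S0s/proper_sub/fintype.subsetP]; exact.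
by move=> _ _ /mapP[S Ss ->] /mapP[S' Ss' ->]; apply: U_close; exact: H.
Qed.

Lemma flag_pushable k s : good_flag s -> size s = k.+1 ->
  pushable k r (map iota (map pt s)).
Proof.
move=> gs sk; apply: (pushable_near r_cont eps_lt_delta).
  by rewrite !size_map.
by apply: near_image_diam; [case: s sk {gs}|exact: flag_diam].
Qed.

Definition sub_tuples m (s : seq P) : chain X := mapc r (sdm m (map iota (map pt s))).

(* The self-map [f] of [X] as a map of the complex of flags. *)
Definition model m (f : X -> X) (s : seq P) : chain P :=
  nerve U (mapc f (sub_tuples m s)).

Lemma lin_model m f c : lin (model m f) c =
  nerve U (mapc f (mapc r (iter m sd (mapc iota (mapc pt c))))).
Proof.
rewrite [in RHS]/mapc iter_sd_lin !lin_compU.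
rewrite /model /sub_tuples (lin_comp (nerve U)); apply: eq_lin => s /=.
by rewrite 2!linU [in LHS]/mapc lin_compU.
Qed.

Lemma model_nil m f : model m f [::] = << [::] >>.
Proof. by rewrite /model /sub_tuples sdm_nil !mapcU nerve_nil. Qed.

Lemma model_bd m f s : bd (model m f s) = lin (model m f) (bd1 s).
Proof.
rewrite lin_model /model /sub_tuples bd_nerve !bd_mapc bd_sdm bdU.
by rewrite !bd1_map.
Qed.

Lemma size_sub_tuples m s : carried (fun u : seq X => size u = size s) (sub_tuples m s).
Proof.
apply: carried_mapc => u um; rewrite size_map.
by apply: (size_sdm1 _ um); rewrite !size_map.
Qed.

Lemma model_size m f s : carried (fun u : seq P => size u = size s) (model m f s).
Proof.
apply: carried_lin => u um; have us : size u = size s.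
  move: u um; apply: carried_mapc => u /size_sub_tuples; by rewrite size_map.
by move=> v /size_nerve1 ->.
Qed.

Definition fine_map m (f : X -> X) :=
  forall s, good_flag s -> carried (diam_im iota eta) (mapc f (sub_tuples m s)).

Lemma model_good m f : fine_map m f ->
  forall s, good_flag s -> carried good_flag (model m f s).
Proof.
by move=> ff s /ff sm; apply: carried_lin => u /sm/nerve_good ug v /ug[].
Qed.

Lemma sub_tuples_svert m k s : good_flag s -> size s = k.+1 ->
  sub_tuples m s = svert m (realize k << s >>).
Proof.
move=> gs sk; rewrite /realize /= !mapcU pushcU svert_push//; last exact: flag_pushable.
by rewrite !size_map.
Qed.

Lemma sub_tuples_small d : 0 < d ->
  \forall m \near \oo, forall s, good_flag s -> carried (diam_im iota d) (sub_tuples m s).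
Proof.
move=> d0.
have H : \forall m \near \oo, forall i : 'I_#|{: flag_index good}|,
    carried (diam_im iota d) (sub_tuples m (flag_of i)).
  apply: filter_forall => i.
  case E : (size (flag_of i)) => [|k].
    by have := flag_of_neq0 i; rewrite -size_eq0 E.
  have [m0 Hm] := ssd_small x0 iota_cont (realize k << flag_of i >>) d0.
  exists m0 => // m /= mm; rewrite (@sub_tuples_svert _ k)//; last exact: flag_of_good.
  by have [] := Hm m mm.
apply: filterS H => m Hm s gs; have [->|/eqP s0] := eqVneq s [::].
  rewrite /sub_tuples sdm_nil mapcU; apply: carriedU => x y.
  by rewrite in_nil.
by have [i <-] := flag_ofP gs s0.
Qed.

Lemma realize_cycle k c : carried (fun s : seq P => size s = k.+1 /\ good_flag s) c ->
  fvec good (bd c) = 0 -> sing_cycle (realize k c).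
Proof.
case: k => // k ck c0 /=; rewrite /realize /= sbd_pushc; last first.
  apply: carried_mapc; apply: carried_mapc => s /ck[sk gs].
  by rewrite !size_map; split=> //; exact: flag_pushable.
rewrite !bd_mapc -(@fvecK _ good (bd c)) ?c0 ?raddf0//.
apply: carried_lin => s /ck[sk gs] t tb.
have [ts st] := carried_bd1 tb; split; first exact: good_flag_subseq gs.
by move=> t0; rewrite t0 sk in st.
Qed.

Lemma sbd_realize k c : carried (fun s : seq P => size s = k.+2 /\ good_flag s) c ->
  sbd (realize k.+1 c) = realize k (bd c).
Proof.
move=> ck; rewrite /realize /= sbd_pushc ?bd_mapc//.
apply: carried_mapc; apply: carried_mapc => s /ck[sk gs].
by rewrite !size_map; split=> //; exact: flag_pushable.
Qed.

Lemma svert_realize m k c : carried (fun s : seq P => size s = k.+1 /\ good_flag s) c ->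
  nerve U (svert m (realize k c)) = lin (model m id) c.
Proof.
move=> ck; rewrite lin_model mapc_id /realize /= svert_pushc//.
apply: carried_mapc; apply: carried_mapc => s /ck[sk gs].
by rewrite !size_map; split=> //; exact: flag_pushable.
Qed.

Local Notation n := #|{: flag_index good}|.

Section Coordinates.
Context (k b : nat) (z : 'I_b -> formal (simplex k)).
Hypothesis z_basis : forall c, sing_cycle c ->
  exists! a : 'rV[rat]_b, exists d, c - \sum_i a 0 i *: z i = sbd d.

Lemma coord_unique c (a a' : 'rV[rat]_b) : sing_cycle c ->
  (exists e, c - \sum_i a 0 i *: z i = sbd e) ->
  (exists e, c - \sum_i a' 0 i *: z i = sbd e) -> a = a'.
Proof. by move=> /z_basis[a0 [_ ua]] /ua <- /ua. Qed.

Let ker_k := row_base (kermx (flag_bd good) *m flag_proj good k).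

Lemma ker_k_row i : row i ker_k *m flag_bd good = 0 /\
  carried (fun s : seq P => size s = k.+1 /\ good_flag s) (unfvec (row i ker_k)).
Proof.
have /submxP[y ->] : (row i ker_k <= kermx (flag_bd good) *m flag_proj good k)%MS.
  by apply: submx_trans (row_sub i _) _; rewrite eq_row_base.
rewrite mulmxA; split.
  by apply: flag_proj_bd; rewrite -mulmxA mulmx_ker mulmx0.
move=> s sv; split; first exact: unfvec_proj sv.
exact: unfvec_good sv.
Qed.

Lemma ker_k_cycle i : sing_cycle (realize k (unfvec (row i ker_k))).
Proof.
by have [r0 rk] := ker_k_row i; apply: realize_cycle => //; rewrite -flag_bdE.
Qed.

Let ker_coord i : {a : 'rV[rat]_b |
  exists e, realize k (unfvec (row i ker_k)) - \sum_j a 0 j *: z j = sbd e}.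
Proof. by apply: cid; have [a [ha _]] := z_basis (ker_k_cycle i); exists a. Qed.

(** The bounding chains are fixed before the number [m] of subdivisions is chosen, so that [m] can
    be required to be fine enough for these finitely many chains. *)
Let ker_bound i : {e | realize k (unfvec (row i ker_k)) -
  \sum_j (proj1_sig (ker_coord i)) 0 j *: z j = sbd e}.
Proof. by apply: cid; exact: proj2_sig (ker_coord i). Qed.

Let coord0 : 'M[rat]_(_, b) := \matrix_i proj1_sig (ker_coord i).

(* Coordinates, in the basis [z], of the homology class of the degree [k] part
   of a cycle of flags. *)
Definition flag_coord : 'M[rat]_(n, b) := flag_proj good k *m pinvmx ker_k *m coord0.

Lemma flag_coordE (u : 'rV_n) :
  u *m flag_coord = u *m flag_proj good k *m pinvmx ker_k *m coord0.
Proof. by rewrite /flag_coord mulmxA (mulmxA u (flag_proj good k)). Qed.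

Lemma flag_coordP (u : 'rV_n) : u *m flag_bd good = 0 ->
  exists e, realize k (unfvec (u *m flag_proj good k)) -
    \sum_j (u *m flag_coord) 0 j *: z j = sbd e.
Proof.
move=> u0; have uk : (u *m flag_proj good k <= ker_k)%MS.
  by rewrite eq_row_base submxMr//; apply/sub_kermxP.
rewrite flag_coordE; set x := _ *m pinvmx _.
have -> : u *m flag_proj good k = x *m ker_k by rewrite /x mulmxKpV.
exists (\sum_i x 0 i *: proj1_sig (ker_bound i)).
rewrite (raddf_sum (@sbd R X k)) /=.
under [RHS]eq_bigr => i _ do rewrite linearZ_LR /= -(proj2_sig (ker_bound i)) scalerBr.
rewrite sumrB; congr (_ - _).
  rewrite mulmx_sum_row (raddf_sum (@unfvec _ good)) (raddf_sum (realize k)).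
  apply: eq_bigr => i _ /=.
  by rewrite (linearZ_LR (@unfvec _ good)) (linearZ_LR (realize k)).
under [RHS]eq_bigr => i _ do rewrite scaler_sumr.
rewrite exchange_big; apply: eq_bigr => j _ /=.
rewrite mxE scaler_suml; apply: eq_bigr => i _.
by rewrite scalerA [coord0 i j]mxE.
Qed.

(** The realization of a boundary of flags bounds, so zero coordinates represent it as well; the
    coordinates in a basis are unique. *)
Lemma flag_coord_bd : flag_bd good *m flag_coord = 0.
Proof.
apply: mulmx_ext => v; rewrite mulmxA mulmx0.
set u := v *m flag_bd good.
have u0 : u *m flag_bd good = 0 by rewrite -mulmxA flag_bdK mulmx0.
have uE : u *m flag_proj good k = fvec good (bd (unfvec (v *m flag_proj good k.+1))).
  by rewrite -flag_bdE /u -!mulmxA flag_proj_bdC.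
have vk : carried (fun s : seq P => size s = k.+2 /\ good_flag s)
    (unfvec (v *m flag_proj good k.+1)).
  by move=> s sv; split; [exact: unfvec_proj sv|exact: unfvec_good sv].
have uk : realize k (unfvec (u *m flag_proj good k)) =
    sbd (realize k.+1 (unfvec (v *m flag_proj good k.+1))).
  rewrite (sbd_realize vk) uE; congr (realize k _); apply: fvecK.
  apply: carried_lin => s /vk[sk gs] t tb; have [ts st] := carried_bd1 tb.
  split; first exact: good_flag_subseq gs.
  by move=> t0; rewrite t0 sk in st.
have uc : sing_cycle (realize k (unfvec (u *m flag_proj good k))).
  apply: realize_cycle; last by rewrite -flag_bdE flag_proj_bd.
  by move=> s su; split; [exact: unfvec_proj su|exact: unfvec_good su].
apply: (coord_unique uc); first exact: flag_coordP.
exists (realize k.+1 (unfvec (v *m flag_proj good k.+1))).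
by rewrite big1 ?subr0// => j _; rewrite mxE scale0r.
Qed.

Lemma flag_sign_coord : flag_sign good *m flag_coord = (-1) ^+ k *: flag_coord.
Proof. by rewrite /flag_coord !mulmxA flag_sign_proj -!scalemxAl. Qed.

Definition basis_rows m : 'M[rat]_(b, n) := \matrix_j fvec good (nerve U (svert m (z j))).

Hypothesis z_cycle : forall j, sing_cycle (z j).

(** Conditions on finitely many chains, hence valid for all large [m]. The bounds on diameters
    ensure that the nerve map yields good flags. *)
Definition approximates m := [/\
  forall j, exists e, z j - realize k (nerve U (svert m (z j))) = sbd e,
  forall j, carried (diam_im iota eta) (svert m (z j)) &
  forall i, carried (diam_im iota eta) (svert m (proj1_sig (ker_bound i)))].

Lemma near_approximates : \forall m \near \oo, approximates m.
Proof.
have small l (c : formal (simplex l)) :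
    \forall m \near \oo, carried (diam_im iota eta) (svert m c).
  have [m0 Hm] := ssd_small x0 iota_cont c eta0.
  by exists m0 => // m /= /Hm[].
near=> m; split; near: m; apply: filter_forall => i; [exact: nerve_approx|exact: small|exact: small].
Unshelve. all: by end_near. Qed.

Lemma nerve_svert_good m l (c : formal (simplex l)) :
  carried (diam_im iota eta) (svert m c) ->
  carried (fun s : seq P => size s = l.+1 /\ good_flag s) (nerve U (svert m c)).
Proof.
move=> dm; apply: carried_lin => s sm f fs; split.
  by rewrite (size_nerve1 fs) (size_svert sm).
by have [] := nerve_good (dm s sm) fs.
Qed.

Variable m : nat.
Hypothesis am : approximates m.

Lemma basis_row_good j : carried (fun s : seq P => size s = k.+1 /\ good_flag s)
  (nerve U (svert m (z j))).
Proof. by apply: nerve_svert_good; have [] := am. Qed.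

Lemma basis_rows_bd : basis_rows m *m flag_bd good = 0.
Proof.
apply/row_matrixP => j; rewrite row_mul rowK row0 -fvec_bd; last first.
  by move=> s /basis_row_good[].
rewrite bd_nerve; case: (sing_cycle_svert m (z_cycle j)) => [k0|->]; last by rewrite !raddf0.
apply/rowP => i; rewrite !mxE; apply/eqP; rewrite mcoeff_eq0; apply/negP => ib.
have := flag_of_neq0 i; rewrite -size_eq0 => /negP; apply.
move: ib => /msupp_lin[s /msupp_lin[t /size_svert tk /(size_bd1 tk) sk] /size_nerve1 ->].
by rewrite sk k0.
Qed.

Lemma basis_rows_sign : basis_rows m *m flag_sign good = (-1) ^+ k *: basis_rows m.
Proof.
apply/row_matrixP => j; rewrite row_mul linearZ /= rowK; apply: fvec_sign.
by move=> s /basis_row_good[].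
Qed.

(** By [nerve_approx], realizing the image of [z j] in the nerve gives back its homology class,
    whose coordinates are the [j]-th unit vector. *)
Lemma basis_rows_coord : basis_rows m *m flag_coord = 1%:M.
Proof.
apply/row_matrixP => j; rewrite row_mul row1.
set u := row j _; have u0 : u *m flag_bd good = 0.
  by rewrite /u -row_mul basis_rows_bd row0.
have uE : unfvec (u *m flag_proj good k) = nerve U (svert m (z j)).
  rewrite /u rowK (@fvec_proj _ _ _ k); last by move=> s /basis_row_good[].
  rewrite eqxx scale1r fvecK// => s sn; have [sk gs] := basis_row_good sn.
  by split=> // s0; rewrite s0 in sk.
have uc : sing_cycle (realize k (unfvec (u *m flag_proj good k))).
  apply: realize_cycle; last by rewrite -flag_bdE flag_proj_bd.
  by move=> s su; split; [exact: unfvec_proj su|exact: unfvec_good su].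
apply: (coord_unique uc); first exact: flag_coordP.
have [/(_ j)[e E] _ _] := am; exists (- e); rewrite raddfN /= -E uE opprB; congr (_ - _).
rewrite (bigD1 j)//= mxE !eqxx scale1r big1 ?addr0// => i ij.
by rewrite mxE eqxx (negbTE ij) scale0r.
Qed.

(** On a cycle of flags the model of the identity realizes, subdivides and returns to the nerve. The
    realization differs from a combination of the [z j] by the boundary of a chain from [ker_bound],
    and the image of that chain in the nerve bounds the difference. *)
Lemma model_coord (u : 'rV_n) : u *m flag_bd good = 0 ->
  (u *m flag_proj good k *m fmx good (model m id) - u *m flag_coord *m basis_rows m
    <= flag_bd good)%MS.
Proof.
move=> u0; have uk : (u *m flag_proj good k <= ker_k)%MS.
  by rewrite eq_row_base submxMr//; apply/sub_kermxP.
rewrite flag_coordE -{1}(mulmxKpV uk); set x := _ *m pinvmx _.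
rewrite -(mulmxA x ker_k) -(mulmxA x coord0) -mulmxBr; apply: submx_trans (submxMl _ _) _.
apply/row_subP => i; rewrite raddfB /= (row_mul i ker_k) (row_mul i coord0) [row i coord0]rowK.
have [_ rk] := ker_k_row i; have [_ _ /(_ i)] := am.
move: (proj1_sig (ker_bound i)) (proj2_sig (ker_bound i)) => e.
move: (proj1_sig (ker_coord i)) => a E de.
have -> : row i ker_k *m fmx good (model m id) =
    fvec good (nerve U (svert m (realize k (unfvec (row i ker_k))))).
  rewrite svert_realize// fvec_map; first by rewrite unfvecK.
    exact: model_nil.
  by move=> s /rk[].
have -> : a *m basis_rows m = fvec good (nerve U (svert m (\sum_j a 0 j *: z j))).
  rewrite mulmx_sum_row (raddf_sum (svert_at R X x0 m k)) (raddf_sum (nerve U)) (raddf_sum (fvec good)).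
  apply: eq_bigr => j _ /=.
  by rewrite rowK (linearZ_LR (svert_at R X x0 m k)) (linearZ_LR (nerve U)) (linearZ_LR (fvec good)).
rewrite -(raddfB (fvec good)) -(raddfB (nerve U)) -(raddfB (svert_at R X x0 m k)) /= E.
rewrite -bd_svert -bd_nerve fvec_bd; first exact: submxMl.
by move=> s /(nerve_svert_good de)[].
Qed.

End Coordinates.

Lemma homology_coordinates k b : is_betti R X k b ->
  \forall m \near \oo, exists (j : 'M[rat]_(n, b)) (q : 'M[rat]_(b, n)),
  [/\ flag_sign good *m j = (-1) ^+ k *: j /\ flag_bd good *m j = 0,
      q *m flag_sign good = (-1) ^+ k *: q /\ q *m flag_bd good = 0,
      q *m j = 1%:M &
      forall u : 'rV_n, u *m flag_bd good = 0 ->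
        (u *m flag_proj good k *m fmx good (model m id) - u *m j *m q <= flag_bd good)%MS].
Proof.
move=> /is_betti_formal[z zc zb].
apply: filterS (near_approximates zb zc) => m am.
exists (flag_coord zb), (basis_rows z m); split.
- by split; [exact: flag_sign_coord|exact: flag_coord_bd].
- by split; [exact: basis_rows_sign am|exact: basis_rows_bd am].
- exact: basis_rows_coord am.
- exact: model_coord am.
Qed.

(** Subtracting the projections [j k *m q k] from the model of the identity leaves a map that sends
    cycles to boundaries, hence of supertrace 0. The trace of [j k *m q k] is that of [q k *m j k],
    an identity matrix of size the Betti number. *)
Lemma supertrace_euler chi : is_euler_char R X chi ->
  \forall m \near \oo, \tr (flag_sign good *m fmx good (model m id)) = chi%:~R.
Proof.
(* [K] exceeds both the degrees with nonzero Betti number and the degrees of flags. *)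
move=> [b [N [bB bN ->]]]; pose K := maxn N #|P|.
have Hc : \forall m \near \oo, forall k : 'I_K,
  exists (j : 'M[rat]_(n, b k)) (q : 'M[rat]_(b k, n)),
  [/\ flag_sign good *m j = (-1) ^+ k *: j /\ flag_bd good *m j = 0,
      q *m flag_sign good = (-1) ^+ k *: q /\ q *m flag_bd good = 0,
      q *m j = 1%:M &
      forall u : 'rV_n, u *m flag_bd good = 0 ->
        (u *m flag_proj good k *m fmx good (model m id) - u *m j *m q <= flag_bd good)%MS].
  by apply: filter_forall => k; exact: homology_coordinates.
apply: filterS2 Hc (sub_tuples_small eta0) => m Hc Hm.
have fine : fine_map m id by move=> s gs; rewrite mapc_id; exact: Hm.
pose Hj k := cid (Hc k); pose j k := sval (Hj k).
pose Hq k := cid (svalP (Hj k)); pose q k := sval (Hq k).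
have Hc' (k : 'I_K) : [/\ flag_sign good *m j k = (-1) ^+ k *: j k /\ flag_bd good *m j k = 0,
      q k *m flag_sign good = (-1) ^+ k *: q k /\ q k *m flag_bd good = 0,
      q k *m j k = 1%:M &
      forall u : 'rV_n, u *m flag_bd good = 0 ->
        (u *m flag_proj good k *m fmx good (model m id) - u *m j k *m q k <= flag_bd good)%MS].
  exact: svalP (Hq k).
clearbody q; clearbody j; clear Hq Hj Hc; rename Hc' into Hc.
pose M := fmx good (model m id).
have Mgood := model_good fine.
have M_bd : M *m flag_bd good = flag_bd good *m M.
  apply: fmx_bd => //; first exact: model_nil.
  by move=> s gs; exact: model_bd.
have M_sign : flag_sign good *m M = M *m flag_sign good.
  by apply: flag_sign_fmx => s gs; exact: model_size.
have H0 : \tr (flag_sign good *m (M - \sum_(k < K) j k *m q k)) = 0.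
  apply: supertrace_acyclic (flag_sign_bd good) (flag_bdK good) _ _ _ _.
  - rewrite mulmxBr mulmxBl M_sign mulmx_sumr mulmx_suml; congr (_ - _).
    apply: eq_bigr => k _; have [[js _] [qs _] _ _] := Hc k.
    by rewrite mulmxA js -mulmxA qs -scalemxAl -scalemxAr.
  - rewrite mulmxBr mulmxBl M_bd mulmx_sumr mulmx_suml; congr (_ - _).
    apply: eq_bigr => k _; have [[_ jd] [_ qd] _ _] := Hc k.
    by rewrite -mulmxA qd mulmx0 mulmxA jd mul0mx.
  apply/row_subP => i; rewrite row_mul; set u := row i _.
  have u0 : u *m flag_bd good = 0 by rewrite /u -row_mul mulmx_ker row0.
  rewrite mulmxBr mulmx_sumr [X in X *m M](@flag_proj_sum _ _ K u) ?leq_maxr// mulmx_suml -sumrB.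
  apply: summx_sub => k _; have [_ _ _ /(_ u u0)] := Hc k.
  by rewrite mulmxA.
move/eqP: H0; rewrite mulmxBr raddfB /= subr_eq0 => /eqP ->.
rewrite mulmx_sumr raddf_sum /= -[LHS]/(\sum_(k < K) \tr _).
rewrite (eq_bigr (fun k : 'I_K => (-1) ^+ k * (b k)%:R)); last first.
  move=> k _; have [[js _] _ qj _] := Hc k.
  by rewrite mulmxA js -scalemxAl mxtraceZ mxtrace_mulC qj mxtrace1.
rewrite raddf_sum /= -(big_mkord xpredT (fun k => (-1) ^+ k * (b k)%:R)).
rewrite (big_cat_nat (n := N))//= ?leq_maxl// [X in _ + X]big1_seq ?addr0; last first.
  by move=> k /andP[_]; rewrite mem_index_iota => /andP[/bN -> _]; rewrite mulr0.
rewrite big_mkord; apply: eq_bigr => k _.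
by rewrite rmorphM /= rmorphXn /= rmorphN1.
Qed.

End FiniteModel.

(** * Invariance of the weighted trace under a small change of the map *)

Section WeightedTrace.
Context {R : realType} {V : normedModType R} {X : topologicalType} (x0 : X).
Context (iota : X -> V) (r : V -> X) (delta : R).
Hypotheses (iota_cont : continuous iota) (rK : cancel iota r).
Hypothesis r_cont : forall x y, `|iota x - y| < delta -> {for y, continuous r}.
Context {I : finType} (U : I -> X -> bool) (eps eta : R).
Hypothesis U_close : forall a x y, U a x -> U a y -> `|iota x - iota y| <= eps.
Hypothesis U_lebesgue :
  forall s, s <> [::] -> diam_im iota eta s -> carrier_set U s != finset.set0.
Hypotheses (eta0 : 0 < eta) (eta_eps : eta <= eps) (eps_delta : 2 * eps < delta).
Local Notation P := {set I}.
Local Notation good := (good U).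
Local Notation pt := (pt x0 U).
Local Notation n := #|{: flag_index good}|.
Local Notation model := (model x0 iota r U).
Local Notation sub_tuples := (sub_tuples x0 iota r U).
Local Notation flag_of := (@flag_of I good).

Variable rho : R.
Hypothesis r_close : forall x y, `|iota x - y| <= eps -> `|iota x - iota (r y)| <= rho.

Definition flag_pt (s : seq P) : X := pt (head finset.set0 s).

Lemma sub_tuples_near m s : good_flag good s -> s <> [::] ->
  carried (ents (fun x => `|iota (flag_pt s) - iota x| <= rho)) (sub_tuples m s).
Proof.
move=> gs s0; apply: carried_mapc => u um _ /mapP[y yu ->]; apply: r_close.
move: u um y yu.
have H : carried (ents (fun y => `|iota (flag_pt s) - y| <= eps))
    (sdm m (map iota (map pt s))).
  apply: carried_sdm; first exact: bary_closed_ball.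
  apply: carriedU => _ /mapP[x xs ->].
  apply: (flag_diam (x0 := x0) U_close gs) => //.
  by rewrite /flag_pt map_f//; case: s s0 {gs xs} => // S s _; rewrite inE eqxx.
by move=> u /H uH y /uH.
Qed.

Section Step.
Variables (m : nat) (f g : X -> X).

Definition close_maps := forall s, good_flag good s ->
  carried (fun u : seq X => forall x y, x \in u -> y \in u ->
    [/\ `|iota (f x) - iota (f y)| <= eta, `|iota (f x) - iota (g y)| <= eta &
        `|iota (g x) - iota (g y)| <= eta]) (sub_tuples m s).

Hypothesis fg : close_maps.

(** A homotopy between tuples of images, with no path from [f x] to [g x]: their closeness is enough
    for the nerve map to give good flags. *)
Let hmap : seq X -> chain X :=
  htpy (fun s => << map f s >>) (fun s => << map g s >>) (fun s => f (head x0 s)).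

Let hmodel (s : seq P) : chain P := nerve U (lin hmap (sub_tuples m s)).

Lemma bd_hmap s : bd (hmap s) = << map f s >> - << map g s >> - lin hmap (bd1 s).
Proof. by apply: bd_htpy => // t; rewrite bdU bd1_map. Qed.

Lemma hmap_ents (u : seq X) : carried (ents (fun y : X => exists2 x, x \in u & y = f x \/ y = g x)) (hmap u).
Proof.
apply: carried_htpy => t tu t0; have sub x : x \in t -> x \in u by apply: mem_subseq.
split; [apply: carriedU| apply: carriedU|].
- by move=> _ /mapP[x /sub xu ->]; exists x => //; left.
- by move=> _ /mapP[x /sub xu ->]; exists x => //; right.
- exists (head x0 t); last by left.
  by apply: sub; case: t t0 {tu} => // x t _; rewrite inE eqxx.
Qed.

Lemma size_hmap u : carried (fun v : seq X => size v = (size u).+1) (hmap u).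
Proof. by apply: size_htpy => t; apply: carriedU; rewrite size_map. Qed.

Lemma hmap_diam s u : good_flag good s -> u \in msupp (sub_tuples m s) ->
  carried (diam_im iota eta) (hmap u).
Proof.
move=> gs us v vu y1 y2 /(hmap_ents vu)[x xu xv] /(hmap_ents vu)[y yu yv].
have [ff fg' gg] := fg gs us xu yu; have [_ gf _] := fg gs us yu xu.
by case: xv => ->; case: yv => -> //; rewrite distrC.
Qed.

Lemma hmodel_carried s : good_flag good s -> carried (fun t => good_flag good t /\
  exists u v, [/\ u \in msupp (sub_tuples m s), v \in msupp (hmap u) & t \in msupp (nerve1 U v)])
  (hmodel s).
Proof.
move=> gs t /msupp_lin[v /msupp_lin[u us vu] tv]; split; last by exists u, v.
by have [] := nerve_good x0 U_close U_lebesgue eta_eps (hmap_diam gs us vu) tv.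
Qed.

Lemma bd_hmodel s : bd (hmodel s) = model m f s - model m g s - lin hmodel (bd1 s).
Proof.
rewrite /hmodel bd_nerve (lin_comp (@bd X)) (eq_lin (g := fun u => << map f u >> - << map g u >> - lin hmap (bd1 u))); last exact: bd_hmap.
rewrite !linB_fun !raddfB /= -/(mapc f _) -/(mapc g _); congr (_ - _ - _).
rewrite -lin_compU -/(bd _) /hmodel -(lin_comp (nerve U)) -lin_compU.
congr (nerve U (lin hmap _)).
by rewrite /sub_tuples bd_mapc bd_sdm bdU !bd1_map iter_sd_lin !lin_compU (lin_comp (mapc r)); apply: eq_lin => t /=; rewrite !linU.
Qed.

Lemma hmodel_nil : hmodel [::] = 0.
Proof. by rewrite /hmodel /sub_tuples sdm_nil mapcU linU raddf0. Qed.

Lemma fmx_hmodel : fmx good (model m f) - fmx good (model m g) =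
  fmx good hmodel *m flag_bd good + flag_bd good *m fmx good hmodel.
Proof.
have rE F i : row i (fmx good F) = fvec good (F (flag_of i)).
  by apply/rowP => j; rewrite !mxE.
apply/row_matrixP => i.
have DL : row i (fmx good (model m f) - fmx good (model m g)) =
    fvec good (model m f (flag_of i)) - fvec good (model m g (flag_of i)).
  by rewrite raddfB; congr (_ - _); exact: rE.
have DR : row i (fmx good hmodel *m flag_bd good + flag_bd good *m fmx good hmodel) =
    fvec good (hmodel (flag_of i)) *m flag_bd good +
    fvec good (bd1 (flag_of i)) *m fmx good hmodel.
  by rewrite raddfD /=; congr (_ + _); rewrite row_mul; congr (_ *m _); exact: rE.
rewrite DL DR.
have E1 : fvec good (bd (hmodel (flag_of i))) = fvec good (hmodel (flag_of i)) *m flag_bd good.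
  by apply: fvec_bd => s /(hmodel_carried (flag_of_good i))[].
have E2 : fvec good (lin hmodel (bd1 (flag_of i))) = fvec good (bd1 (flag_of i)) *m fmx good hmodel.
  apply: fvec_lin; last by rewrite hmodel_nil raddf0.
  by move=> t tb; have [ts _] := carried_bd1 tb; exact: good_flag_subseq ts (flag_of_good i).
rewrite bd_hmodel in E1; apply: etrans (congr2 +%R E1 E2).
by rewrite -(raddfD (fvec good)) /= subrK raddfB.
Qed.

Variable theta : seq P -> bool.
Hypothesis theta_face : forall s t, good_flag good s -> good_flag good t ->
  t \in msupp (hmodel s) -> s \in msupp (bd1 t) -> s <> [::] -> theta s = theta t.

(** The difference is the weighted supertrace of [h *m d + d *m h]. Each product [h i j * d j i]
    occurs twice, on the diagonal at [i] and at [j], with opposite signs since the degrees differ by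
    one; [theta_face] makes the weights equal. *)
Lemma weighted_trace_step :
  \sum_i (-1) ^+ (size (flag_of i)).+1 * ((theta (flag_of i))%:R * (model m f (flag_of i))@_(flag_of i)) =
  \sum_i (-1) ^+ (size (flag_of i)).+1 * ((theta (flag_of i))%:R * (model m g (flag_of i))@_(flag_of i)) :> rat.
Proof.
apply/eqP; rewrite -subr_eq0 -sumrB; apply/eqP.
pose h := fmx good hmodel; pose d := flag_bd good.
pose e (i : 'I_n) : rat := (-1) ^+ (size (flag_of i)).+1.
pose th (i : 'I_n) : rat := (theta (flag_of i))%:R.
transitivity (\sum_i \sum_j (e i * th i * (h i j * d j i) + e i * th i * (d i j * h j i))).
  apply: eq_bigr => i _; rewrite -mulrBr -mulrBr.
  have -> : (model m f (flag_of i))@_(flag_of i) - (model m g (flag_of i))@_(flag_of i) =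
    (fmx good (model m f) - fmx good (model m g)) i i by rewrite !mxE.
  rewrite fmx_hmodel mxE [X in X + _]mxE [X in _ + X]mxE -big_split mulrA mulr_sumr.
  by apply: eq_bigr => j _; rewrite mulrDr.
under eq_bigr do rewrite big_split; rewrite big_split /=.
rewrite [X in _ + X]exchange_big -big_split big1// => i _ /=.
rewrite -big_split big1// => j _ /=.
have [->|dji] := eqVneq (d j i) 0; first by rewrite !(mulr0, mul0r) addr0.
have [->|hij] := eqVneq (h i j) 0; first by rewrite !(mulr0, mul0r) addr0.
have ib : flag_of i \in msupp (bd1 (flag_of j)) by move: dji; rewrite /d mxE mem_msupp.
have jh : flag_of j \in msupp (hmodel (flag_of i)) by move: hij; rewrite /h mxE mem_msupp.
have -> : th i = th j.
  rewrite /th (theta_face (flag_of_good i) (flag_of_good j) jh ib)//.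
  exact/eqP/flag_of_neq0.
have -> : e i = - e j.
  rewrite /e; have [_ ->] := carried_bd1 ib.
  by have := flag_of_neq0 j; case: (flag_of j) => // x s _ /=; rewrite [in RHS]exprS mulN1r opprK.
by rewrite [d j i * _]mulrC !mulNr addNr.
Qed.

End Step.
End WeightedTrace.

Lemma mem_of_size (T : eqType) (s : seq T) : (0 < size s)%N -> exists x, x \in s.
Proof. by case: s => // x s _; exists x; rewrite inE eqxx. Qed.

(** * The Euler characteristic as a weighted count of fixed points *)

Section FixedPointClasses.
Context {R : realType} {V : normedModType R} {X : topologicalType} (x0 : X).
Context (iota : X -> V) (r : V -> X) (delta : R).
Hypotheses (iota_cont : continuous iota) (rK : cancel iota r) (delta0 : 0 < delta).
Hypothesis r_cont : forall x y, `|iota x - y| < delta -> {for y, continuous r}.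
Hypothesis X_compact : compact [set: X].

Lemma iota_inj x y : `|iota x - iota y| = 0 -> x = y.
Proof. by move/normr0_eq0/eqP; rewrite subr_eq0 => /eqP/(can_inj rK). Qed.

(** Here [y] runs over [V], which is not compact, so [heine] does not apply; the covering form of
    compactness of [X] makes the modulus uniform. *)
Lemma retraction_uniform (rho : R) : 0 < rho -> exists2 e, 0 < e &
  forall x y, `|iota x - y| <= e -> `|iota x - iota (r y)| <= rho.
Proof.
move=> rho0; have rho20 : 0 < rho / 2 by rewrite divr_gt0.
have /compact_near_coveringP/(_ R (0^'+) (fun e x => forall y, `|iota x - y| <= e ->
    `|iota x - iota (r y)| <= rho)) := X_compact.
have H : forall x, [set: X] x -> \forall x' \near x & e \near 0^'+, forall y, `|iota x' - y| <= e ->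
    `|iota x' - iota (r y)| <= rho.
  move=> x _; have cr : {for iota x, continuous (iota \o r)}.
    apply: continuous_comp; last exact: iota_cont.
    by apply: (@r_cont x); rewrite subrr normr0.
  have /cvgrPdist_lt/(_ _ rho20)/nbhs_normP[e /= e0 He] := cr.
  have e20 : 0 < e / 2 by rewrite divr_gt0.
  have /cvgrPdist_lt/(_ (Num.min (e / 2) (rho / 2))) := @iota_cont x.
  rewrite lt_min e20 rho20 => /(_ isT) Hx.
  exists ([set x' | `|iota x - iota x'| < Num.min (e / 2) (rho / 2)], [set e' | e' < e / 2]) => /=.
    by split=> //; exact: nbhs_right_lt.
  move=> [x' e'] /= [+ e'e] y yx'; rewrite lt_min => /andP[xx'1 xx'2].
  have : `|iota x - iota (r y)| < rho / 2.
    rewrite -[X in X - _](congr1 iota (rK x)); apply: He => /=.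
    have -> : iota x - y = (iota x - iota x') + (iota x' - y) by rewrite addrA subrK.
    by apply: le_lt_trans (ler_normD _ _) _; lra.
  have -> : iota x' - iota (r y) = (iota x' - iota x) + (iota x - iota (r y)).
    by rewrite addrA subrK.
  by move=> H; apply: le_trans (ler_normD _ _) _; rewrite distrC; lra.
move=> /(_ _ H) {}H.
have [e [e0 He]] := filter_ex (filterI (nbhs_right_gt 0) H).
by exists e => // x y; exact: He x I y.
Qed.

Lemma finite_net (e : R) : 0 < e ->
  exists D : {fset X}, forall x, exists2 c, c \in D & `|iota x - iota c| < e.
Proof.
move=> e0; have : cover_compact [set: X].
  pose X' : ptopologicalType := HB.pack (X : Type) (isPointed.Build X x0) X.
  have cX : @compact X' [set: X] by exact: X_compact.
  by rewrite compact_cover in cX.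
move=> /(_ X setT (fun c => [set x | `|iota x - iota c| < e])).
case=> [c _|x _|D _ HD].
- pose g x := `|iota x - iota c|.
  have gc : continuous g.
    apply: cont_comp; last exact: norm_continuous.
    by apply: contB => //; exact: cont_cstT.
  exact: (@open_comp _ _ g [set y | y < e]).
- by exists x => //=; rewrite subrr normr0.
- by exists D => x; have [c cD xc] := HD x I; exists c.
Qed.

Local Notation I01 := (unitI R).

Lemma I01_compact : compact [set: I01].
Proof. by apply: compact_set_type; exact: segment_compact. Qed.

Lemma compactT_prod (S T : topologicalType) : compact [set: S] -> compact [set: T] ->
  compact [set: (S * T)%type].
Proof. by move=> cS cT; rewrite -setXTT; exact: compact_setX. Qed.

Context (f : I01 -> X -> X) (theta : I01 -> X -> bool).
Hypothesis f_cont : continuous (fun p : I01 * X => f p.1 p.2).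
Hypotheses (f0 : forall x, f zero x = x) (f1 : forall x, f one x = x).
Hypotheses (theta0 : forall x, theta zero x) (theta1 : forall x, ~~ theta one x).
Hypothesis theta_locally_constant : exists2 d, 0 < d & forall s t x y,
  `|val s - val t| <= d -> `|iota x - iota y| <= d -> `|iota x - iota (f s x)| <= d ->
  theta s x = theta t y.

Lemma f_uniform_space (e : R) : 0 < e -> exists2 h, 0 < h &
  forall t x y, `|iota x - iota y| < h -> `|iota (f t x) - iota (f t y)| < e.
Proof.
move=> e0.
have cf1 : continuous (fun p : (I01 * X) * X => iota (f p.1.1 p.1.2)).
  apply: cont_comp iota_cont; apply: (@cont_comp _ _ _ (fun p : (I01 * X) * X => p.1) (fun p : I01 * X => f p.1 p.2)) => //.
  exact: cont_fst.
have cf2 : continuous (fun p : (I01 * X) * X => iota (f p.1.1 p.2)).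
  apply: cont_comp iota_cont; apply: (@cont_comp _ _ _ (fun p : (I01 * X) * X => (p.1.1, p.2)) (fun p : I01 * X => f p.1 p.2)) => //.
  by apply: cont_pair; [apply: cont_comp; exact: cont_fst|exact: cont_snd].
have [||||| h h0 Hh] := @heine R ((I01 * X) * X)%type
  (fun p => `|iota (f p.1.1 p.1.2) - iota (f p.1.1 p.2)|)
  (fun p => `|iota p.1.2 - iota p.2|) _ _ _ _ _ _ e0.
- by apply: compactT_prod => //; apply: compactT_prod => //; exact: I01_compact.
- by apply: cont_comp; [exact: contB cf1 cf2|exact: norm_continuous].
- apply: cont_comp; last exact: norm_continuous; apply: contB; apply: cont_comp iota_cont.
    by apply: (@cont_comp _ _ _ fst snd); [exact: cont_fst|exact: cont_snd].
  exact: cont_snd.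
- by [].
- by move=> [[t x] y] /= /iota_inj ->; rewrite subrr normr0.
by exists h => // t x y; exact: (Hh ((t, x), y)).
Qed.

Lemma f_uniform_time (e : R) : 0 < e -> exists2 h, 0 < h &
  forall s t x, `|val s - val t| < h -> `|iota (f s x) - iota (f t x)| < e.
Proof.
move=> e0.
have cf1 : continuous (fun p : (I01 * I01) * X => iota (f p.1.1 p.2)).
  apply: cont_comp iota_cont; apply: (@cont_comp _ _ _ (fun p : (I01 * I01) * X => (p.1.1, p.2)) (fun p : I01 * X => f p.1 p.2)) => //.
  by apply: cont_pair; [apply: cont_comp; exact: cont_fst|exact: cont_snd].
have cf2 : continuous (fun p : (I01 * I01) * X => iota (f p.1.2 p.2)).
  apply: cont_comp iota_cont; apply: (@cont_comp _ _ _ (fun p : (I01 * I01) * X => (p.1.2, p.2)) (fun p : I01 * X => f p.1 p.2)) => //.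
  apply: cont_pair; last exact: cont_snd.
  by apply: (@cont_comp _ _ _ fst snd); [exact: cont_fst|exact: cont_snd].
have [||||| h h0 Hh] := @heine R ((I01 * I01) * X)%type
  (fun p => `|iota (f p.1.1 p.2) - iota (f p.1.2 p.2)|)
  (fun p => `|val p.1.1 - val p.1.2|) _ _ _ _ _ _ e0.
- by apply: compactT_prod => //; apply: compactT_prod; exact: I01_compact.
- by apply: cont_comp; [exact: contB cf1 cf2|exact: norm_continuous].
- apply: cont_comp; last exact: norm_continuous.
  apply: (@contB _ R^o); (apply: cont_comp; last exact: val_continuous).
    by apply: cont_comp; exact: cont_fst.
  by apply: (@cont_comp _ _ _ fst snd); [exact: cont_fst|exact: cont_snd].
- by [].
- by move=> [[s t] x] /= /normr0_eq0/eqP; rewrite subr_eq0 => /eqP/val_inj ->; rewrite subrr normr0.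
by exists h => // s t x; exact: (Hh ((s, t), x)).
Qed.

Lemma euler_char_eq0 chi : is_euler_char R X chi -> chi = 0.
Proof.
move=> Xchi; have [d d0 theta_loc] := theta_locally_constant.
have d20 : 0 < d / 2 by rewrite divr_gt0.
have [rho rho0 f_space] := f_uniform_space d20.
have rho20 : 0 < rho / 2 by rewrite divr_gt0.
have [e1 e10 r_close1] := retraction_uniform rho20.
(* [delta / 4] yields [2 * eps < delta], and [d / 6] makes the final bound [2 * eps + eta + d / 2]
   on displacements at most [d]. *)
pose eps := Num.min e1 (Num.min (d / 6) (delta / 4)).
have [eps_e1 [eps_d eps_delta4]] : eps <= e1 /\ eps <= d / 6 /\ eps <= delta / 4.
  by rewrite /eps !ge_min !lexx !orbT.
have eps0 : 0 < eps by rewrite !lt_min e10 /= !divr_gt0.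
have r_close x y : `|iota x - y| <= eps -> `|iota x - iota (r y)| <= rho / 2.
  by move=> xy; apply: r_close1; exact: le_trans eps_e1.
(* The sets [U a] have radius [eps / 2], that is, [eta] for the net plus [eta] for the tuple; so
   [eta] is a Lebesgue number. *)
pose eta := eps / 4.
have eta0 : 0 < eta by rewrite divr_gt0.
have eta_eps : eta <= eps by rewrite /eta; lra.
have eps_delta : 2 * eps < delta by lra.
have [D HD] := finite_net eta0.
pose U (a : D) (x : X) : bool := `|iota x - iota (val a)| < eps / 2.
have U_close (a : D) x y : U a x -> U a y -> `|iota x - iota y| <= eps.
  move=> xa ya; have -> : iota x - iota y = (iota x - iota (val a)) + (iota (val a) - iota y).
    by rewrite addrA subrK.
  apply: le_trans (ler_normD _ _) _; rewrite [X in _ + X]distrC.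
  by move: xa ya; rewrite /U; lra.
have U_leb s : s <> [::] -> diam_im iota eta s -> carrier_set U s != finset.set0.
  case: s => // x s _ sd; have [c cD xc] := HD x.
  apply/finset.set0Pn; exists [` cD]%fset; rewrite inE; apply/allP => y ys.
  rewrite /U /=; have -> : iota y - iota c = (iota y - iota x) + (iota x - iota c).
    by rewrite addrA subrK.
  apply: le_lt_trans (ler_normD _ _) _.
  have : `|iota y - iota x| <= eta by apply: sd => //; rewrite inE eqxx.
  by move: xc; rewrite /eta; lra.
have eta20 : 0 < eta / 2 by rewrite divr_gt0.
have [h h0 f_time] := f_uniform_time eta20.
have [tiny tiny0 f_tiny] := f_uniform_space eta20.
have tiny20 : 0 < tiny / 2 by rewrite divr_gt0.
(* One [m] serves all times: tuples of diameter at most [tiny / 2] have images of diameter less than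
   [eta / 2] under every [f t]. *)
have [m [trE fine_m]] := filter_ex (filterI
  (supertrace_euler x0 iota_cont rK r_cont U_close U_leb eta0 eta_eps eps_delta Xchi)
  (sub_tuples_small x0 iota_cont r_cont U_close eta0 eta_eps eps_delta tiny20)).
pose W t : rat := \sum_i (-1) ^+ (size (@flag_of _ (good U) i)).+1 *
  ((theta t (flag_pt x0 U (flag_of i)))%:R * (model x0 iota r U m (f t) (flag_of i))@_(flag_of i)).
have close s t : `|val s - val t| < h -> close_maps x0 iota r U eta m (f s) (f t).
  move=> st u gu v vu x y xv yv.
  have xy : `|iota x - iota y| < tiny by have := fine_m u gu v vu x y xv yv; lra.
  split.
  - by have := f_tiny s x y xy; lra.
  - have -> : iota (f s x) - iota (f t y) = (iota (f s x) - iota (f s y)) + (iota (f s y) - iota (f t y)).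
      by rewrite addrA subrK.
    apply: le_trans (ler_normD _ _) _.
    by have := f_tiny s x y xy; have := f_time s t y st; lra.
  - by have := f_tiny t x y xy; lra.
(* If [f t] sends a point [y] of the subdivided flag [u] near the base point of [u], then this base
   point is almost fixed: [y] is close to it, and [f t] moves the two points together. *)
have near_fixed b u v t y S : good_flag (good U) u -> u <> [::] -> v \in msupp (sub_tuples x0 iota r U m u) ->
    y \in v -> `|iota (pt x0 U S) - iota (f t y)| <= b -> pt x0 U S = flag_pt x0 U u ->
    `|iota (flag_pt x0 U u) - iota (f t (flag_pt x0 U u))| <= b + d / 2.
  move=> gu u0 vu yv Sy SE; rewrite -SE.
  have := sub_tuples_near U_close r_close gu u0 vu yv; rewrite -SE => Hy.
  have -> : iota (pt x0 U S) - iota (f t (pt x0 U S)) =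
      (iota (pt x0 U S) - iota (f t y)) + (iota (f t y) - iota (f t (pt x0 U S))).
    by rewrite addrA subrK.
  apply: le_trans (ler_normD _ _) _; apply: lerD => //.
  rewrite distrC; apply/ltW/f_space; apply: le_lt_trans Hy _; lra.
have head_in (u : seq {set D}) : u <> [::] -> head finset.set0 u \in u.
  by case: u => // S u _; rewrite inE eqxx.
have step s t : `|val s - val t| < Num.min h d -> W s = W t.
  rewrite lt_min => /andP[st std]; have st_close := close s t st.
  have E := weighted_trace_step (x0 := x0) U_close U_leb eta_eps st_close (theta := fun u => theta s (flag_pt x0 U u)).
  rewrite /W; apply: etrans (E _) _; last first.
    (* It remains to replace the weight at time [s] by the one at time [t]: a nonzero diagonal entry
       forces the base point of the flag to be almost fixed by [f t], and there the weights
       agree. *)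
    apply: eq_bigr => i _; congr (_ * _).
    have [->|] := eqVneq (model x0 iota r U m (f t) (flag_of i))@_(flag_of i) 0; first by rewrite !mulr0.
    rewrite -mem_msupp => /msupp_lin[v /msupp_lin[v0 v0u]].
    rewrite msuppU oner_eq0 in_fset1 => /eqP -> uv.
    congr (_%:R * _); congr nat_of_bool; apply/esym/theta_loc.
    - by rewrite distrC; exact: ltW.
    - by rewrite subrr normr0; exact: ltW.
    have gi := flag_of_good i; have i0 : flag_of i <> [::] by apply/eqP; exact: flag_of_neq0.
    have sv0 := size_sub_tuples v0u.
    have v0_gt0 : (0 < size v0)%N.
      by rewrite sv0 lt0n size_eq0; exact: flag_of_neq0.
    have [x xv0] := mem_of_size v0_gt0.
    have dv : diam_im iota eta (map (f t) v0).
      move=> _ _ /mapP[y yv ->] /mapP[z zv ->].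
      by have [_ _] := st_close _ gi _ v0u _ _ yv zv.
    have [_ ng] := nerve_good x0 U_close U_leb eta_eps dv uv.
    have hi := head_in _ i0.
    have := near_fixed _ _ _ t x (head finset.set0 (flag_of i)) gi i0 v0u xv0 (ng _ _ hi (map_f _ xv0)) erefl.
    by move=> /le_trans; apply; lra.
  (* The hypothesis [theta_face]: both base points come from sets of the flag [w], so they are
     within [eps]; the one of [u] is almost fixed, as its set occurs in [w], a flag of the homotopy
     on [u]. *)
  move=> u w gu gw wh ub u0.
  have [_ [v [v' [vu v'v wv']]]] := hmodel_carried U_close U_leb eta_eps st_close gu wh.
  have [uw sw] := carried_bd1 ub.
  have w0 : w <> [::] by move=> w0; move: uw; rewrite w0 subseq0 => /eqP.
  have hu : head finset.set0 u \in w by apply: (mem_subseq uw); exact: head_in.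
  have hw := head_in _ w0.
  apply: theta_loc.
  - by rewrite subrr normr0; exact: ltW.
  - apply: (@le_trans _ _ eps); last lra.
    by apply: (flag_diam (x0 := x0) U_close gw); exact: map_f.
  have dv' := hmap_diam st_close gu vu v'v.
  have [_ ng] := nerve_good x0 U_close U_leb eta_eps dv' wv'.
  have v'_gt0 : (0 < size v')%N by rewrite (size_hmap v'v).
  have [y yv'] := mem_of_size v'_gt0; have [x xv yx] := hmap_ents v'v yv'.
  have py : `|iota (pt x0 U (head finset.set0 u)) - iota (f s x)| <= 2 * eps + eta.
    have H := ng _ _ hu yv'.
    case: yx => yx; rewrite yx in H; first by apply: (le_trans H); rewrite lerDl; exact: ltW.
    have -> : iota (pt x0 U (head finset.set0 u)) - iota (f s x) =
      (iota (pt x0 U (head finset.set0 u)) - iota (f t x)) + (iota (f t x) - iota (f s x)).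
      by rewrite addrA subrK.
    apply: le_trans (ler_normD _ _) _; apply: lerD; first exact: H.
    by rewrite distrC; have [_ fgx _] := st_close _ gu _ vu _ _ xv xv; exact: fgx.
  have := near_fixed _ _ _ s x _ gu u0 vu xv py erefl.
  by move=> /le_trans; apply; rewrite /eta; lra.
have [N hN] : exists N, N.+1%:R^-1 < Num.min h d.
  have hd : 0 < Num.min h d by rewrite lt_min h0 d0.
  exists (Num.truncn (Num.min h d)^-1); rewrite -[ltRHS]invrK ltf_pV2 ?posrE ?invr_gt0//.
  exact: truncnS_gt.
pose tj (j : nat) : I01 := clamp (j%:R / N.+1%:R).
have val_tj j : (j <= N.+1)%N -> val (tj j) = j%:R / N.+1%:R.
  move=> jN; rewrite val_clamp min_r 1?max_r ?divr_ge0//.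
  by rewrite ler_pdivrMr ?ltr0n// mul1r ler_nat.
have Wj j : (j <= N.+1)%N -> W zero = W (tj j).
  elim: j => [_|j IH jN].
    by congr W; apply: val_inj; rewrite val_tj// mul0r val_zero.
  rewrite IH; last exact: ltnW.
  apply: step; rewrite (val_tj j (ltnW jN)) (val_tj j.+1 jN).
  rewrite -mulrBl -natr1 opprD addrA subrr sub0r mulN1r normrN ger0_norm; last first.
    by rewrite invr_ge0.
  exact: hN.
have W1 : W one = 0.
  by rewrite /W big1// => i _; rewrite (negbTE (theta1 _)) mul0r mulr0.
have W0 : W zero = chi%:~R.
  have f0E : f zero = id by apply/funext => x; exact: f0.
  rewrite -trE supertrace_fmx /W f0E; apply: eq_bigr => i _.
  by rewrite theta0 mul1r.
have : W zero = 0.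
  rewrite (Wj _ (leqnn _)) -W1; congr W; apply: val_inj.
  rewrite (val_tj _ (leqnn _)) divff; first by rewrite val_one.
  by rewrite pnatr_eq0.
by rewrite W0 => /eqP; rewrite intr_eq0 => /eqP.
Qed.

End FixedPointClasses.

From mathcomp Require Import homotopy.
Import Defs.

(** * Free and based null-homotopies *)

Section FreeHomotopy.
Context {R : realType} {X : topologicalType}.
Local Notation I01 := (unitI R).
Implicit Types (l : I01 -> X).

Definition freely_homotopic l l' := exists G : I01 * I01 -> X,
  [/\ continuous G, forall s, G (s, zero) = l s, forall s, G (s, one) = l' s &
      forall u, G (zero, u) = G (one, u)].

Definition freely_null l := exists p, freely_homotopic l (fun=> p).

Lemma clamp0 : clamp 0 = zero :> I01.
Proof. by []. Qed.

Lemma clamp1 : clamp 1 = one :> I01.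
Proof. by []. Qed.

Lemma cont_clamp (T : topologicalType) (u : T -> R) :
  continuous u -> continuous (fun x => clamp (u x) : I01).
Proof. by move=> cu; apply: cont_comp cu _; exact: clamp_continuous. Qed.

Lemma cont_val (T : topologicalType) (u : T -> I01) :
  continuous u -> continuous (fun x => val (u x) : R).
Proof. by move=> cu; apply: cont_comp cu _; exact: val_continuous. Qed.

Lemma freely_homotopic_null l l' : freely_homotopic l l' -> freely_null l' -> freely_null l.
Proof.
move=> [G [cG G0 G1 Gx]] [p [H [cH H0 H1 Hx]]]; exists p.
exists (fun su => if val su.2 <= 1/2 :> R then G (su.1, clamp (2 * val su.2))
  else H (su.1, clamp (2 * val su.2 - 1))).
have c2 : continuous (fun su : I01 * I01 => val su.2 : R).
  by apply: cont_val; exact: cont_snd.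
split=> [|s|s|u].
- apply: (@paste_continuous _ _ _ (fun su : I01 * I01 => val su.2)) => //.
  + apply: cont_comp cG; apply: cont_pair; first exact: cont_fst.
    by apply: cont_clamp; apply: contM => //; exact: (@cont_cst _ R^o).
  + apply: cont_comp cH; apply: cont_pair; first exact: cont_fst.
    apply: cont_clamp; apply: (@contB _ R^o); last exact: (@cont_cst _ R^o).
    by apply: contM => //; exact: (@cont_cst _ R^o).
  + by move=> [s u] /= ->; rewrite dbl_half subrr clamp0 clamp1 G1 H0.
- by rewrite val_zero mulr0 half_ge0 clamp0 G0.
- by rewrite val_one one_gt_half dbl_one clamp1 H1.
- by rewrite /=; case: ifPn => _; [exact: Gx|exact: Hx].
Qed.

Lemma freely_homotopic_sym l l' : freely_homotopic l l' -> freely_homotopic l' l.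
Proof.
move=> [G [cG G0 G1 Gx]]; exists (fun su => G (su.1, clamp (1 - val su.2))); split.
- apply: cont_comp cG; apply: cont_pair; first exact: cont_fst.
  apply: cont_clamp; apply: (@contB _ R^o); first exact: (@cont_cst _ R^o).
  by apply: cont_val; exact: cont_snd.
- by move=> s; rewrite -(G1 s) val_zero subr0.
- by move=> s; rewrite -(G0 s) val_one subrr.
- by move=> u; exact: Gx.
Qed.

Lemma cont_min (T : topologicalType) (u v : T -> R) :
  continuous u -> continuous v -> continuous (fun x => Num.min (u x) (v x)).
Proof. by move=> cu cv x; exact: (@continuous_min _ _ u v x (cu x) (cv x)). Qed.

(** During [G] the base point moves along [dl]. The loop is first deformed into [al], which goes out
    along [dl], waits at its end and comes back; then [al] is drawn back along [dl]. *)
Lemma freely_null_homotopic (x : X) (l : {path I01 from x to x}) :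
  freely_null l -> homotopic l (const_loop x).
Proof.
move=> [p [G [cG G0 G1 Gx]]].
have l0 : l zero = x by exact: (path_zero (s := l)).
have l1 : l one = x by exact: (path_one (s := l)).
pose dl u := G (zero, u).
have cdl : continuous dl.
  by apply: cont_comp cG; apply: cont_pair; [exact: cont_cstT|exact: cont_id].
(* A trapezoid: up in the first third, constant in the second, where the null-homotopy has become
   constant, and down in the last. *)
pose h (s : R) := Num.min 1 (Num.min (3 * s) (3 - 3 * s)).
have ch : continuous h.
  apply: cont_min; first exact: (@cont_cst _ R^o).
  apply: cont_min; first by apply: contM; [exact: (@cont_cst _ R^o)|exact: cont_id].
  apply: (@contB _ R^o); first exact: (@cont_cst _ R^o).
  by apply: contM; [exact: (@cont_cst _ R^o)|exact: cont_id].
have h0 : h 0 = 0 by rewrite /h mulr0 subr0 (min_l (y := 3))// min_r.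
have h1 : h 1 = 0 by rewrite /h mulr1 subrr (min_r (y := 0))// min_r.
pose a (s : I01) := dl (clamp (h (val s))).
have ca : continuous a.
  apply: cont_comp cdl; apply: cont_clamp; apply: cont_comp ch.
  by apply: cont_val; exact: cont_id.
have a0 : a zero = x by rewrite /a val_zero h0 clamp0 /dl G0.
have a1 : a one = x by rewrite /a val_one h1 clamp0 /dl G0.
pose al : {path I01 from x to x} := mk_path ca a0 a1.
apply: (@homotopic_trans _ _ _ al).
- apply/asboolP.
  (* At stage [v] the path has total length [1 + 2 * v]: up [dl] to height [v], once along
     [G (-, v)], and down again. [w] and [w'] measure the distances to its two ends, and [k] is the
     height. *)
  pose w (sv : I01 * I01) : R := val sv.1 * (1 + 2 * val sv.2).
  pose w' (sv : I01 * I01) : R := (1 - val sv.1) * (1 + 2 * val sv.2).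
  pose k (sv : I01 * I01) : R := Num.min (val sv.2) (Num.min (w sv) (w' sv)).
  have c1 : continuous (fun sv : I01 * I01 => val sv.1 : R) by apply: cont_val; exact: cont_fst.
  have c2 : continuous (fun sv : I01 * I01 => val sv.2 : R) by apply: cont_val; exact: cont_snd.
  have c3 : continuous (fun sv : I01 * I01 => 1 + 2 * val sv.2 : R).
    apply: (@contD _ R^o); first exact: (@cont_cst _ R^o).
    by apply: contM => //; exact: (@cont_cst _ R^o).
  have cw : continuous w by exact: contM.
  have cw' : continuous w'.
    by apply: contM => //; apply: (@contB _ R^o) => //; exact: (@cont_cst _ R^o).
  exists (fun sv => G (clamp (w sv - val sv.2), clamp (k sv))); split.
  + apply: cont_comp cG; apply: cont_pair; apply: cont_clamp.
      exact: (@contB _ R^o).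
    by apply: cont_min => //; exact: cont_min.
  + move=> s; rewrite /k /w /w'; cbn [fst snd]; rewrite val_zero mulr0 addr0 !mulr1 subr0 clampK.
    rewrite min_l ?clamp0 ?G0//; have /andP[s0 s1] := val_unitI s.
    by rewrite le_min s0 subr_ge0.
  + move=> s; rewrite /k /w /w' -[al s]/(a s) /a /dl; cbn [fst snd]; rewrite val_one.
    have /andP[] := val_unitI s; move: (val s : R) => {}s s0 s1.
    have -> : s * (1 + 2 * 1) - 1 = 3 * s - 1 by lra.
    have -> : Num.min 1 (Num.min (s * (1 + 2 * 1)) ((1 - s) * (1 + 2 * 1))) = h s.
      by rewrite /h; congr (Num.min _ (Num.min _ _)); lra.
    have [s3|s3] := leP (3 * s) 1.
      by rewrite clamp_le0 ?clamp0//; lra.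
    have [s23|s23] := leP 2 (3 * s).
      by rewrite clamp_ge1 ?clamp1 -?Gx//; lra.
    have -> : h s = 1 by rewrite /h min_l// le_min; apply/andP; split; lra.
    by rewrite clamp1 !G1.
  + move=> v; rewrite /k /w /w'; cbn [fst snd]; rewrite val_zero val_one.
    have /andP[v0 v1] := val_unitI v; split.
      rewrite mul0r sub0r subr0 mul1r clamp_le0 ?oppr_le0// clamp0.
      rewrite (min_l (x := 0)); last lra.
      by rewrite min_r// clamp0 G0.
    rewrite subrr mul0r mul1r (min_r (y := 0)); last lra.
    rewrite min_r// clamp0 clamp_ge1; last lra.
    by rewrite clamp1 G0.
- apply/asboolP; exists (fun sv => dl (clamp ((1 - val sv.2) * h (val sv.1)))); split.
  + apply: cont_comp cdl; apply: cont_clamp; apply: contM.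
      apply: (@contB _ R^o); first exact: (@cont_cst _ R^o).
      by apply: cont_val; exact: cont_snd.
    by apply: cont_comp ch; apply: cont_val; exact: cont_fst.
  + by move=> s; cbn [fst snd]; rewrite val_zero subr0 mul1r.
  + by move=> s; cbn [fst snd]; rewrite val_one subrr mul0r clamp0 /dl G0.
  + by move=> v; cbn [fst snd]; rewrite val_zero val_one h0 h1 mulr0 clamp0 /dl G0.
Qed.

End FreeHomotopy.

(** * Orbits of loops of self-maps *)

Section Gottlieb.
Context {R : realType} {V : normedModType R} {X : topologicalType} (x0 : X).
Context (iota : X -> V) (r : V -> X) (delta : R).
Hypotheses (iota_cont : continuous iota) (rK : cancel iota r) (delta0 : 0 < delta).
Hypothesis r_cont : forall x y, `|iota x - y| < delta -> {for y, continuous r}.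
Hypothesis X_compact : compact [set: X].
Hypothesis X_connected : connected [set: X].
Local Notation I01 := (unitI R).
Context (f : I01 -> X -> X).
Hypothesis f_cont : continuous (fun p : I01 * X => f p.1 p.2).
Hypotheses (f0 : forall x, f zero x = x) (f1 : forall x, f one x = x).

Lemma near_retraction_continuous (T : topologicalType) (u : T -> V) : continuous u ->
  (forall t, exists x, `|iota x - u t| < delta) -> continuous (fun t => r (u t)).
Proof.
move=> cu H t; apply: continuous_comp; first exact: cu.
by have [x] := H t; exact: r_cont.
Qed.

(* The orbit of [x] up to time [t], closed up by the segment back to [x] when
   [f t x] is close to [x]. *)
Let arc (t : I01) x (s : I01) : V :=
  iota (f (clamp (val s * val t)) x) + val s *: (iota x - iota (f t x)).

Let theta (t : I01) x : bool := `[< freely_null (fun s => r (arc t x s)) >].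

Let arc0 (t : I01) x : arc t x zero = iota x.
Proof. by rewrite /arc val_zero mul0r scale0r addr0 f0. Qed.

Let arc1 (t : I01) x : arc t x one = iota x.
Proof. by rewrite /arc val_one mul1r scale1r clampK addrC subrK. Qed.

Let arc_one x (s : I01) : arc one x s = iota (f s x).
Proof. by rewrite /arc val_one mulr1 clampK f1 subrr scaler0 addr0. Qed.

Let arc_cont (t : I01) x : continuous (arc t x).
Proof.
apply: contD.
  apply: cont_comp iota_cont.
  apply: (@cont_comp _ _ _ (fun s : I01 => (clamp (val s * val t) : I01, x)) (fun p : I01 * X => f p.1 p.2)) => //.
  apply: cont_pair; last exact: cont_cstT.
  apply: cont_clamp; apply: contM; last exact: (@cont_cst _ R^o).
  by apply: cont_val; exact: cont_id.
apply: contZ; last exact: cont_cst.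
by apply: cont_val; exact: cont_id.
Qed.

Let theta0 x : theta zero x.
Proof.
apply/asboolP; exists x; exists (fun=> x); split=> //; first exact: cont_cstT.
by move=> s; rewrite /arc f0 subrr scaler0 addr0 val_zero mulr0 clamp0 f0 rK.
Qed.

(** The two closed arcs are joined by segments in [V]. As [f s x] is close to [x], the closing term
    is small, and each segment stays within [delta] of a point of the orbit of [x], so that [r] can
    be applied. *)
Let theta_locally_constant : exists2 d, 0 < d & forall s t x y,
  `|val s - val t| <= d -> `|iota x - iota y| <= d -> `|iota x - iota (f s x)| <= d ->
  theta s x = theta t y.
Proof.
have d80 : 0 < delta / 8 by rewrite divr_gt0.
have [h h0 Hh] := f_uniform_space iota_cont rK X_compact f_cont d80.
have [k k0 Hk] := f_uniform_time iota_cont X_compact f_cont d80.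
pose d := Num.min (delta / 8) (Num.min (h / 2) (k / 2)).
have d0 : 0 < d by rewrite !lt_min d80 !divr_gt0.
have dd : d <= delta / 8 by rewrite ge_min lexx.
have dh : d <= h / 2 by rewrite /d !ge_min lexx orbT.
have dk : d <= k / 2 by rewrite /d !ge_min lexx !orbT.
exists d => // s t x y st xy xfx.
have Hst (a b : I01) : `|val a - val b| <= d -> `|iota (f a x) - iota (f b y)| < delta / 4.
  move=> ab; have -> : iota (f a x) - iota (f b y) =
    (iota (f a x) - iota (f b x)) + (iota (f b x) - iota (f b y)) by rewrite addrA subrK.
  apply: le_lt_trans (ler_normD _ _) _.
  have H1 := Hk a b x (le_lt_trans ab (_ : d < k)).
  have H2 := Hh b x y (le_lt_trans xy (_ : d < h)).
  by have := H1 ltac:(lra); have := H2 ltac:(lra); lra.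
have fst_ (a b c : I01) : `|val b - val c| <= d ->
    `|(val (clamp (val a * val b) : I01) - val (clamp (val a * val c) : I01))| <= d.
  have ab_in (b' : I01) : val (clamp (val a * val b') : I01) = val a * val b'.
    have /andP[a0 a1] := val_unitI a; have /andP[b0 b1] := val_unitI b'.
    by rewrite val_clamp min_r ?max_r ?mulr_ge0// mulr_ile1.
  rewrite !ab_in -mulrBr normrM => H; apply: le_trans H.
  have /andP[a0 a1] := val_unitI a.
  by rewrite ger0_norm// ler_piMl.
have arc_near (a : I01) : `|arc t y a - arc s x a| < 3 / 4 * delta /\
    `|iota (f (clamp (val a * val s)) x) - arc s x a| < delta / 4.
  have /andP[a0 a1] := val_unitI a.
  have scale_le (v : V) : `|val a *: v| <= `|v|.
    by rewrite normrZ ger0_norm// ler_piMl.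
  rewrite /arc; split; last first.
    rewrite opprD addrA subrr sub0r normrN; have := le_trans (scale_le _) xfx; lra.
  rewrite opprD addrACA -scalerBr; apply: le_lt_trans (ler_normD _ _) _.
  have H1 := Hst (clamp (val a * val s)) (clamp (val a * val t)) (fst_ a s t st).
  have H2 : `|iota y - iota (f t y) - (iota x - iota (f s x))| <= d + delta / 4.
    have -> : iota y - iota (f t y) - (iota x - iota (f s x)) =
        (iota y - iota x) + (iota (f s x) - iota (f t y)).
      rewrite opprB (addrC (iota (f s x))) addrACA; congr (_ + _); exact: addrC.
    apply: le_trans (ler_normD _ _) _; apply: lerD; first by rewrite distrC.
    by apply: ltW; exact: Hst.
  have := scale_le (iota y - iota (f t y) - (iota x - iota (f s x))).
  rewrite distrC in H1; lra.
have hom : freely_homotopic (fun a => r (arc s x a)) (fun a => r (arc t y a)).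
  exists (fun au => r (arc s x au.1 + val au.2 *: (arc t y au.1 - arc s x au.1))); split.
  - have cs : continuous (fun au : I01 * I01 => arc s x au.1).
      by apply: cont_comp; [exact: cont_fst|exact: arc_cont].
    have ct : continuous (fun au : I01 * I01 => arc t y au.1).
      by apply: cont_comp; [exact: cont_fst|exact: arc_cont].
    apply: near_retraction_continuous.
      apply: contD => //; apply: contZ; last exact: contB.
      by apply: cont_val; exact: cont_snd.
    move=> [a u]; exists (f (clamp (val a * val s)) x); cbn [fst snd].
    have [H1 H2] := arc_near a; have /andP[u0 u1] := val_unitI u.
    rewrite opprD addrA; apply: le_lt_trans (ler_normB _ _) _.
    have : `|val u *: (arc t y a - arc s x a)| <= `|arc t y a - arc s x a|.
      by rewrite normrZ ger0_norm// ler_piMl.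
    lra.
  - by move=> a; cbn [fst snd]; rewrite val_zero scale0r addr0.
  - by move=> a; cbn [fst snd]; rewrite val_one scale1r addrC subrK.
  - by move=> u; cbn [fst snd]; rewrite !arc0 !arc1.
apply/asboolP/asboolP; apply: freely_homotopic_null => //.
exact: freely_homotopic_sym.
Qed.

(** At time one every point is fixed, so [theta one] is locally constant on the connected space [X]:
    it holds nowhere, and then [chi] is 0, or it holds everywhere. *)
Lemma orbit_freely_null chi x : is_euler_char R X chi -> chi != 0 ->
  freely_null (fun s => f s x).
Proof.
move=> hchi chi0; have [d d0 Hd] := theta_locally_constant.
have theta_near y z : `|iota y - iota z| <= d -> theta one y = theta one z.
  move=> yz; apply: Hd => //; first by rewrite subrr normr0 ltW.
  by rewrite f1 subrr normr0 ltW.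
have open_theta b : open [set y | theta one y = b].
  rewrite openE => y /= yb; have /cvgrPdist_lt/(_ _ d0) := @iota_cont y.
  by apply: filterS => z /ltW/theta_near yz; rewrite -yb yz.
have [[y ty]|Nt] := pselect (exists y, theta one y); last first.
  suff chi_eq0 : chi = 0 by rewrite chi_eq0 eqxx in chi0.
  have t1 z : ~~ theta one z by apply/negP => tz; apply: Nt; exists z.
  exact: (euler_char_eq0 x0 iota_cont rK delta0 r_cont X_compact f_cont f0 theta0 t1 theta_locally_constant hchi).
have : [set z | theta one z = true] = setT.
  apply: X_connected; first by exists y.
    by exists [set z | theta one z = true]; rewrite ?setTI.
  exists [set z | theta one z = true]; rewrite ?setTI//.
  have -> : [set z | theta one z = true] = ~` [set z | theta one z = false].
    by apply/seteqP; split=> z /=; case: (theta one z).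
  exact: open_closedC.
move=> /seteqP[_ /(_ x I)] /= /asboolP.
apply: freely_homotopic_null; exists (fun au => f au.1 x); split.
- apply: (@cont_comp _ _ _ (fun au : I01 * I01 => (au.1, x)) (fun p : I01 * X => f p.1 p.2)) => //.
  by apply: cont_pair; [exact: cont_fst|exact: cont_cstT].
- by [].
- by move=> a; rewrite arc_one rK.
- by move=> u; rewrite f0 f1.
Qed.

End Gottlieb.

(** * Continuity on closed subsets *)

Section ClosedContinuity.
Implicit Types S T U : topologicalType.

(* Says that [A] is closed and that [f] is continuous on [A]. *)
Definition closed_cont S T (A : set S) (f : S -> T) :=
  forall D, closed D -> closed (A `&` f @^-1` D).

Lemma closed_contP S T (A : set S) (f : S -> T) :
  closed_cont A f <-> closed A /\ {within A, continuous f}.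
Proof.
split=> [H|[cA cf] D cD].
  have cA : closed A by have := H setT closedT; rewrite preimage_setT setIT.
  split=> //; apply/continuous_closedP => D cD.
  by rewrite -(@closed_setSI _ A)//; exact: H.
rewrite (@closed_setSI _ A)//.
by move/continuous_closedP: cf; exact.
Qed.

Lemma closed_contU S T (A B : set S) (f : S -> T) :
  closed_cont A f -> closed_cont B f -> closed_cont (A `|` B) f.
Proof. by move=> cA cB D cD; rewrite setIUl; apply: closedU; [exact: cA|exact: cB]. Qed.

Lemma closed_cont_eq S T (A : set S) (f g : S -> T) :
  (forall x, A x -> f x = g x) -> closed_cont A f -> closed_cont A g.
Proof.
move=> fg cf D cD; have -> : A `&` g @^-1` D = A `&` f @^-1` D; last exact: cf.
by apply/seteqP; split=> x [Ax] /=; rewrite fg.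
Qed.

Lemma closed_cont_comp S T U (A : set S) (B : set T) (f : S -> T) (g : T -> U) :
  (forall x, A x -> B (f x)) -> closed_cont A f -> closed_cont B g ->
  closed_cont A (g \o f).
Proof.
move=> AB cf cg D cD.
have -> : A `&` (g \o f) @^-1` D = A `&` f @^-1` (B `&` g @^-1` D).
  by apply/seteqP; split=> x /= [Ax]; [move=> Dx; split=> //; split=> //; exact: AB|case].
by apply: cf; exact: cg.
Qed.

Lemma closed_contW S T (A B : set S) (f : S -> T) :
  closed B -> B `<=` A -> closed_cont A f -> closed_cont B f.
Proof.
move=> cB BA cf D cD; have -> : B `&` f @^-1` D = B `&` (A `&` f @^-1` D).
  by apply/seteqP; split=> x /= [Bx]; [move=> Dx; do 2!split=> //; exact: BA|case].
by apply: closedI => //; exact: cf.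
Qed.

Lemma closed_contT S T (A : set S) (f : S -> T) :
  closed A -> continuous f -> closed_cont A f.
Proof. by move=> cA cf; apply/closed_contP; split=> //; exact: continuous_subspaceT. Qed.

Lemma closed_cont_setT S T (f : S -> T) : closed_cont [set: S] f -> continuous f.
Proof. by move/closed_contP=> [_ ?]; apply/continuous_subspace_setT. Qed.

End ClosedContinuity.

(** * Embedding of a compact manifold and its neighbourhood retraction *)

Section CompactManifold.
Context {R : realType} (M : manifold R) (M_compact : compact [set: M]).
Local Notation n := (dim M).

Section ChartBall.
Variables (i : idx M) (p : M) (rho : R).
Hypotheses (ip : dom i p) (rho0 : 0 < rho).
Let cb (s : R) : set 'rV[R]_n := [set y | `|phi i p - y| <= s].
Hypothesis cb_chart : cb (2 * rho) `<=` phi i @` dom i.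

Definition chart_ball (s : R) : set M := [set x | dom i x /\ `|phi i p - phi i x| <= s].

Definition chart_oball (s : R) : set M := [set x | dom i x /\ `|phi i p - phi i x| < s].

Let cb_closed s : closed (cb s).
Proof.
rewrite -[cb s]/((fun y => `|phi i p - y|) @^-1` [set x | x <= s]).
apply: closed_preimage; last exact: closed_le.
apply: cont_comp; last exact: norm_continuous.
by apply: contB; [exact: cont_cst|exact: cont_id].
Qed.

Let cb_compact s : compact (cb s).
Proof.
apply: bounded_closed_compact => //.
exists (`|phi i p| + s); split; first exact: num_real.
move=> x xs y /= ys; apply: le_trans (ltW xs).
have -> : y = phi i p - (phi i p - y) by rewrite opprB addrC subrK.
by apply: le_trans (ler_normB _ _) _; rewrite lerD2l.
Qed.

Lemma phi_inv_cont : closed_cont (cb (2 * rho)) (phi_inv i).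
Proof.
apply/closed_contP; split=> //.
by apply: continuous_subspaceW cb_chart _; exact: phi_inv_continuous.
Qed.

Lemma phi_invP y : cb (2 * rho) y -> dom i (phi_inv i y) /\ phi i (phi_inv i y) = y.
Proof. by move=> /cb_chart [x ix <-]; rewrite phiK ?inE. Qed.

(** The ball is closed in the whole of [M] and not only in the chart, being a compact image in a
    Hausdorff space. *)
Lemma chart_ball_closed : closed (chart_ball (2 * rho)).
Proof.
have -> : chart_ball (2 * rho) = phi_inv i @` cb (2 * rho).
  apply/seteqP; split=> [x [ix xs]|_ [y ys <-]].
    by exists (phi i x) => //; rewrite phiK ?inE.
  by have [iy yE] := phi_invP ys; split=> //; rewrite yE.
apply: compact_closed; first exact: manifold_hausdorff.
by apply: continuous_compact => //; move/closed_contP: phi_inv_cont => [].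
Qed.

Lemma phi_cont : closed_cont (chart_ball (2 * rho)) (phi i).
Proof.
apply/closed_contP; split; first exact: chart_ball_closed.
by apply: continuous_subspaceW (@phi_continuous _ M i) => x [].
Qed.

Lemma chart_oball_open s : open (chart_oball s).
Proof.
have := @phi_continuous _ M i.
rewrite continuous_open_subspace; last exact: dom_open.
move=> cphi; rewrite openE => x [ix xs].
have cx : {for x, continuous (phi i)} by apply: cphi; rewrite inE.
have H1 : \forall y \near x, dom i y by apply: open_nbhs_nbhs; split=> //; exact: dom_open.
have H2 : \forall y \near x, `|phi i x - phi i y| < s - `|phi i p - phi i x|.
  by move/cvgrPdist_lt : cx; apply; rewrite subr_gt0.
rewrite /interior; apply: filterS2 H1 H2 => y iy ys; split=> //.
have -> : phi i p - phi i y = (phi i p - phi i x) + (phi i x - phi i y) by rewrite addrA subrK.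
by apply: le_lt_trans (ler_normD _ _) _; rewrite -ltrBrDl.
Qed.

Lemma chart_supported (u : M -> R) : closed_cont (chart_ball (2 * rho)) u ->
  (forall x, ~ chart_oball (2 * rho) x -> u x = 0) -> continuous u.
Proof.
move=> cu u0; apply: closed_cont_setT.
have -> : [set: M] = chart_ball (2 * rho) `|` ~` chart_oball (2 * rho).
  apply/seteqP; split=> // x _; have [[ix xs]|] := pselect (chart_oball (2 * rho) x).
    by left; split=> //; exact: ltW.
  by right.
apply: closed_contU => //.
apply: (@closed_cont_eq _ _ _ (fun=> 0)); first by move=> x /u0.
apply: closed_contT; last exact: cst_continuous.
by apply: open_closedC; exact: chart_oball_open.
Qed.

Definition bump (x : M) : R :=
  if `[< chart_ball (2 * rho) x >] then 2 * rho - `|phi i p - phi i x| else 0.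

(** Component 0 is the bump itself and the others are the bump times the coordinates; dividing by
    the former recovers [phi i] where it is positive. *)
Definition bump_coord (k : 'I_n.+1) (x : M) : R :=
  bump x * if unlift ord0 k is Some k' then phi i x 0 k' else 1.

Lemma bump_out x : ~ chart_oball (2 * rho) x -> bump x = 0.
Proof.
rewrite /bump; case: asboolP => // -[ix xs] H.
apply/eqP; rewrite eq_le !subr_le0 subr_ge0 xs andbT leNgt.
by apply/negP => lt; apply: H; split.
Qed.

Lemma bump_cont : closed_cont (chart_ball (2 * rho)) bump.
Proof.
apply: (@closed_cont_eq _ _ _ ((fun y => 2 * rho - `|phi i p - y|) \o phi i)).
  by move=> x xs; rewrite /bump asboolT.
apply: closed_cont_comp phi_cont (closed_contT closedT _) => //.
apply: (@contB _ R^o); first exact: (@cont_cst _ R^o).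
apply: cont_comp; last exact: norm_continuous.
by apply: contB; [exact: cont_cst|exact: cont_id].
Qed.

Lemma bump_coord_continuous k : continuous (bump_coord k).
Proof.
apply: chart_supported => [|x /bump_out]; last by rewrite /bump_coord => ->; rewrite mul0r.
apply/closed_contP; split; first exact: chart_ball_closed.
rewrite /bump_coord => x; apply: cvgM.
  by have /closed_contP[_ ] := bump_cont; exact.
case: (unlift ord0 k) => [k'|]; last exact: cvg_cst.
apply: (@cvg_comp _ _ _ (phi i) (fun y : 'rV[R]_n => y 0 k') _ (nbhs (phi i x))); last exact: coord_continuous.
by have /closed_contP[_ ] := phi_cont; exact.
Qed.

Lemma bump_coord_inj x y : chart_oball rho x ->
  (forall k, bump_coord k x = bump_coord k y) -> x = y.
Proof.
move=> [ix xr] xy.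
have bx : 0 < bump x.
  rewrite /bump asboolT /=; first by move: rho0 xr => ? ?; lra.
  by split=> //; move: rho0 xr => ? ?; lra.
have bxy : bump x = bump y.
  by have := xy ord0; rewrite /bump_coord unlift_none !mulr1.
have iy : dom i y.
  by move: bx; rewrite bxy /bump; case: asboolP => [[]//|]; rewrite ltxx.
have pxy : phi i x = phi i y.
  apply/rowP => k; have := xy (lift ord0 k).
  by rewrite /bump_coord liftK -bxy => /(mulfI (lt0r_neq0 bx)).
by rewrite -[x](@phiK _ M i) ?inE// pxy phiK ?inE.
Qed.

Section Extend.
Context {V : normedModType R} (iota : M -> V) (iota_cont : continuous iota).

(** The invariant of an induction on charts: [Y] contains the whole image of [M], but it is a
    neighbourhood of the image of [A] only, and [A] grows one chart ball at a time. *)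
Definition retractable (A : set M) := exists Y (r : V -> M),
  [/\ closed_cont Y r, forall x, Y (iota x) /\ r (iota x) = x & iota @` A `<=` Y^°].

Lemma tietze_row (C : set V) (f : V -> 'rV[R]_n) (b : R) : 0 < b ->
  closed_cont C f -> (forall x, C x -> `|f x| <= b) ->
  exists2 g : V -> 'rV[R]_n, continuous g & forall x, C x -> f x = g x.
Proof.
move=> b0 /closed_contP[cC cf] fb.
have Hk (k : 'I_n) : exists g : V -> R^o, continuous g /\ forall x, C x -> f x 0 k = g x.
  have [||x Cx|g [fg cg _]] := @continuous_bounded_extension V R _ C cC (fun x => f x 0 k) b b0.
  - exact: pseudometric_normal.
  - by move=> x; apply: (@cvg_comp _ _ _ f (fun y : 'rV[R]_n => y 0 k) _ (nbhs (f x))); [exact: cf|exact: coord_continuous].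
  - by apply: le_trans (fb x Cx); exact: coord_le_mx_norm.
  by exists g; split=> // x Cx; apply: fg; rewrite inE.
have [g Hg] := choice Hk.
exists (fun x => \row_k g k x) => [|x Cx].
  apply: continuous_mx => a k; under eq_fun do rewrite mxE.
  exact: (Hg k).1.
by apply/rowP => k; rewrite mxE (Hg k).2.
Qed.

(* In a chart, a continuous retraction extends by Tietze; the extension is only
   used near the points that the retraction maps into the chart. *)
Lemma retractableU A : retractable A -> retractable (A `|` chart_oball rho).
Proof.
move=> [Y [r [cr rY AY]]].
pose C := Y `&` r @^-1` chart_ball (2 * rho).
have cC : closed C by apply: cr; exact: chart_ball_closed.
have [|||g cg gE] := @tietze_row C (phi i \o r) (`|phi i p| + 2 * rho).
- by rewrite ltr_wpDl// mulr_gt0.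
- apply: closed_cont_comp (closed_contW cC _ cr) phi_cont; first by move=> v [].
  by move=> v [].
- move=> v [_ [ir vr]] /=.
  have -> : phi i (r v) = phi i p - (phi i p - phi i (r v)) by rewrite opprB addrC subrK.
  by apply: le_trans (ler_normB _ _) _; rewrite lerD2l.
pose K := iota @` chart_ball rho.
have cK : closed K.
  apply: compact_closed; first exact: norm_hausdorff.
  apply: continuous_compact; first exact: continuous_subspaceT.
  apply: subclosed_compact M_compact _ => //.
  have -> : chart_ball rho = chart_ball (2 * rho) `&` phi i @^-1` cb rho.
    apply/seteqP; split=> [x [ix xr]|x [[ix _]] xr]; last by split.
    by split=> //; split=> //; apply: (le_trans xr); move: rho0 => ?; lra.
  exact: phi_cont.
(* [Z] is the part of [Y] that [r] sends out of the open chart ball. A function [u] separating it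
   from [K] bounds the region where [phi_inv i \o g] is used: there, points of [Y] are sent into the
   chart, so that the two formulas agree. *)
pose Z := Y `&` r @^-1` (~` chart_oball (2 * rho)).
have cZ : closed Z by apply: cr; apply: open_closedC; exact: chart_oball_open.
have KZ : K `&` Z = set0.
  apply/seteqP; split=> // _ [[x [ix xr] <-] [_ /=]]; rewrite (rY x).2; apply.
  by split=> //; apply: (le_lt_trans xr); move: rho0 => ?; lra.
have sep : uniform_separator K Z.
  by apply: normal_uniform_separator => //; exact: pseudometric_normal.
pose u : V -> R := Urysohn K Z.
have cu : continuous u by exact: Urysohn_continuous.
have uK v : K v -> u v = 0 by move=> Kv; apply: (Urysohn_sub0 sep); exists v.
have uZ v : Z v -> u v = 1 by move=> Zv; apply: (Urysohn_sub1 sep); exists v.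
pose D := [set v | u v <= 1 / 2] `&` g @^-1` cb (2 * rho).
have cD : closed D.
  apply: closedI; last exact: closed_preimage.
  by apply: (@closed_preimage _ _ u [set x | x <= 1 / 2]) => //; exact: closed_le.
have YD v : Y v -> D v -> C v.
  move=> Yv [uv _]; split=> //=.
  have [[ir vr]|nv] := pselect (chart_oball (2 * rho) (r v)); first by split=> //; exact: ltW.
  by move: uv; rewrite /= uZ//; lra.
pose r' v := if `[< Y v >] then r v else phi_inv i (g v).
have r'Y v : Y v -> r' v = r v by move=> Yv; rewrite /r' asboolT.
exists (Y `|` D), r'; split.
- apply: closed_contU; first by apply: closed_cont_eq cr => v /r'Y.
  apply: (@closed_cont_eq _ _ _ (phi_inv i \o g)); last first.
    apply: closed_cont_comp (closed_contT cD cg) phi_inv_cont.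
    by move=> v [].
  move=> v Dv; rewrite /r'; case: asboolP => // Yv.
  by have [_ [ir vr]] := YD v Yv Dv; rewrite /= -gE ?phiK ?inE//; exact: YD.
- by move=> x; have [Yx rx] := rY x; rewrite r'Y//; split=> //; left.
- move=> _ [x [Ax|[ix xr]] <-].
    by apply: (@interiorS _ Y); [exact: subsetUl|apply: AY; exists x].
  apply: (@interiorS _ D); first exact: subsetUr.
  have xK : K (iota x) by exists x => //; split=> //; exact: ltW.
  have xC : C (iota x).
    split; first exact: (rY x).1.
    by rewrite /= (rY x).2; split=> //; apply: ltW; apply: (lt_trans xr); move: rho0 => ?; lra.
  rewrite /interior; apply: filterI.
    have : u (iota x) < 1 / 2 by rewrite uK//; lra.
    move=> H; have := cu (iota x); move/cvgr_lt => /(_ _ H).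
    by apply: filterS => v /= /ltW.
  have : `|phi i p - g (iota x)| < 2 * rho.
    rewrite -gE//= (rY x).2; apply: (lt_trans xr); move: rho0 => ?; lra.
  have cn : continuous (fun v => `|phi i p - g v|).
    apply: cont_comp; last exact: norm_continuous.
    by apply: contB => //; exact: cont_cst.
  move=> H; have := cn (iota x); move/cvgr_lt => /(_ _ H).
  by apply: filterS => v /= /ltW.
Qed.

End Extend.
End ChartBall.

Lemma chart_at p : exists c : idx M * R, [/\ dom c.1 p, 0 < c.2 &
  [set y | `|phi c.1 p - y| <= 2 * c.2] `<=` phi c.1 @` dom c.1].
Proof.
have [i _ ip] : (\bigcup_i @dom _ M i) p by rewrite dom_cover.
have : nbhs (phi i p) (phi i @` dom i).
  by apply: open_nbhs_nbhs; split; [exact: phi_dom_open|exists p].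
move/nbhs_normP => [e /= e0 He]; exists (i, e / 4) => /=; split=> //.
  by rewrite divr_gt0.
by move=> y /= ye; apply: He => /=; lra.
Qed.

(* A compact manifold is a Euclidean neighbourhood retract. *)
Lemma compact_manifold_enr (x0 : M) :
  exists m (iota : M -> 'M[R]_(m, n.+1)) (r : 'M[R]_(m, n.+1) -> M) delta,
  [/\ continuous iota, cancel iota r, 0 < delta &
      forall x y, `|iota x - y| < delta -> {for y, continuous r}].
Proof.
have [c Hc] := choice chart_at.
have [D HD] : exists D : {fset M}, forall x, exists2 p, p \in D & chart_oball (c p).1 p (c p).2 x.
  have : cover_compact [set: M].
    pose X' : ptopologicalType := HB.pack (carrier M : Type) (isPointed.Build M x0) (carrier M).
    have cX : @compact X' [set: M] by exact: M_compact.
    by rewrite compact_cover in cX.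
  move=> /(_ M setT (fun p => chart_oball (c p).1 p (c p).2)).
  case=> [p _|x _|D _ HD]; first exact: chart_oball_open.
    by exists x => //; have [ix r0 _] := Hc x; split; rewrite ?subrr ?normr0.
  by exists D => x; have [p pD xp] := HD x I; exists p.
pose m := size D.
pose pt (j : 'I_m) : M := nth x0 D j.
pose iota x : 'M[R]_(m, n.+1) :=
  \matrix_(j, k) bump_coord (c (pt j)).1 (pt j) (c (pt j)).2 k x.
have ci : continuous iota.
  apply: continuous_mx => j k; under eq_fun do rewrite mxE.
  by have [? ? ?] := Hc (pt j); exact: bump_coord_continuous.
have cover x : exists j, chart_oball (c (pt j)).1 (pt j) (c (pt j)).2 x.
  have [p pD xp] := HD x; have jm : (index p D < m)%N by rewrite index_mem.
  by exists (Ordinal jm); rewrite /pt /= nth_index.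
have iota_inj : injective iota.
  move=> x y xy; have [j xj] := cover x; have [ij rj cj] := Hc (pt j).
  apply: (bump_coord_inj rj xj) => k.
  by have := congr1 (fun A : 'M[R]_(m, n.+1) => A j k) xy; rewrite !mxE.
(* As [M] is compact, [iota] is a closed map and its inverse is continuous on the image. *)
have base : retractable iota set0.
  pose r v := if pselect (exists x, iota x = v) is left H then projT1 (cid H) else x0.
  have rK x : r (iota x) = x.
    rewrite /r; case: pselect => [H|[]]; last by exists x.
    by apply: iota_inj; exact: projT2 (cid H).
  exists (range iota), r; split.
  - move=> A cA; have -> : range iota `&` r @^-1` A = iota @` A.
      apply/seteqP; split=> [_ [[x _ <-]] /=|_ [x Ax <-]]; first by rewrite rK; exists x.
      by split; [exists x|rewrite /= rK].
    apply: compact_closed; first exact: norm_hausdorff.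
    apply: continuous_compact; first exact: continuous_subspaceT.
    exact: subclosed_compact cA M_compact _.
  - by move=> x; split=> //; exists x.
  - by rewrite image_set0.
have steps (s : seq 'I_m) : retractable iota
    [set x | exists2 j, j \in s & chart_oball (c (pt j)).1 (pt j) (c (pt j)).2 x].
  elim: s => [|j s IH].
    suff -> : [set x | exists2 j, j \in [::] & chart_oball (c (pt j)).1 (pt j) (c (pt j)).2 x] = set0 by [].
    by apply/seteqP; split=> // x [].
  have [ij rj cj] := Hc (pt j).
  have := retractableU rj cj ci IH; set A := (X in retractable iota X).
  set B := (X in _ -> retractable iota X); suff -> : A = B by [].
  apply/seteqP; split=> x.
    by move=> [[k ks xk]|xj]; [exists k => //; rewrite inE ks orbT|exists j => //; rewrite inE eqxx].
  move=> [k]; rewrite inE => /orP[/eqP ->|ks xk]; first by right.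
  by left; exists k.
have [Y [r [cr rY HY]]] := steps (enum 'I_m).
have {}HY x : Y^° (iota x).
  by apply: HY; exists x => //; have [j xj] := cover x; exists j; rewrite ?mem_enum.
(* Compactness turns the neighbourhoods of the single points of the image into a uniform [delta]. *)
have /compact_near_coveringP/(_ R (0^'+) (fun e x => forall y, `|iota x - y| < e -> Y^° y)) := M_compact.
have H : forall x, [set: M] x -> \forall x' \near x & e \near 0^'+, forall y, `|iota x' - y| < e -> Y^° y.
  move=> x _; have /nbhs_normP[e /= e0 He] : nbhs (iota x) Y^°.
    by apply: open_nbhs_nbhs; split; [exact: open_interior|exact: HY].
  have e20 : 0 < e / 2 by rewrite divr_gt0.
  exists ([set x' | `|iota x - iota x'| < e / 2], [set e' | e' < e / 2]) => /=.
    split; last exact: nbhs_right_lt.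
    by have /cvgrPdist_lt/(_ _ e20) := ci x.
  move=> [x' e'] /= [xx' e'e] y yx'; apply: He => /=.
  have -> : iota x - y = (iota x - iota x') + (iota x' - y) by rewrite addrA subrK.
  by apply: le_lt_trans (ler_normD _ _) _; lra.
move=> /(_ _ H) {}H.
have [d [d0 Hd]] := filter_ex (filterI (nbhs_right_gt 0) H).
exists m, iota, r, d; split=> //; first by move=> x; rewrite (rY x).2.
move=> x y /(Hd x I) Yy.
have /closed_contP[_ cY] := cr.
have : {within Y^°, continuous r} by apply: continuous_subspaceW cY; exact: interior_subset.
rewrite continuous_open_subspace; last exact: open_interior.
by apply; rewrite inE.
Qed.

End CompactManifold.

From mathcomp Require Import ring.

(** * A smooth step function *)

Section SmoothStep.
Context {R : realType}.
Implicit Types f g : R -> R.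

Fixpoint times_derivable k g : Prop :=
  if k is k'.+1 then exists2 g', forall x, is_derive x (1 : R) g (g' x) & times_derivable k' g'
  else True.

Lemma times_derivableS k g : times_derivable k.+1 g -> times_derivable k g.
Proof. by elim: k g => //= k IH g [g' gg' /IH g'k]; exists g'. Qed.

Lemma times_derivableD k f g : times_derivable k f -> times_derivable k g ->
  times_derivable k (fun x => f x + g x).
Proof.
elim: k f g => //= k IH f g [f' ff' f'k] [g' gg' g'k].
exists (fun x => f' x + g' x); last exact: IH.
by move=> x; exact: is_deriveD.
Qed.

Lemma times_derivableM k f g : times_derivable k f -> times_derivable k g ->
  times_derivable k (fun x => f x * g x).
Proof.
elim: k f g => //= k IH f g [f' ff' f'k] [g' gg' g'k].
exists (fun x => f x * g' x + g x * f' x).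
  by move=> x; exact: is_deriveM.
by apply: times_derivableD; apply: IH => //; apply: times_derivableS; [exists f'|exists g'].
Qed.

Lemma times_derivable_cst k (c : R) : times_derivable k (fun=> c).
Proof. by elim: k c => //= k IH c; exists (fun=> 0) => // x; exact: is_derive_cst. Qed.

Lemma is_deriveV1 g (d x : R) : g x != 0 -> is_derive x (1 : R) g d ->
  is_derive x (1 : R) (fun x => (g x)^-1) (- (g x) ^- 2 * d).
Proof.
move=> gx dg; apply: DeriveDef; first exact: derivableV.
by rewrite deriveV// derive_val.
Qed.

Lemma times_derivableV k g : (forall x, g x != 0) -> times_derivable k g ->
  times_derivable k (fun x => (g x)^-1).
Proof.
move=> g0; elim: k => //= k IH [g' gg' g'k].
exists (fun x => -1 * g' x * ((g x)^-1 * (g x)^-1)).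
  move=> x; apply: is_derive_eq (is_deriveV1 (g0 x) (gg' x)) _.
  by rewrite -invfM -expr2 mulN1r mulrC mulrN mulNr.
have gk : times_derivable k (fun x => (g x)^-1) by apply: IH; apply: times_derivableS; exists g'.
apply: times_derivableM; last exact: times_derivableM.
by apply: times_derivableM => //; exact: times_derivable_cst.
Qed.

Lemma is_derive_affine (a b x : R) : is_derive x (1 : R) (fun x => a * x + b) a.
Proof.
have H : is_derive x (1 : R) (a \*: id + cst b) (a *: 1 + 0) by apply: is_deriveD; exact: is_deriveZ.
apply: is_derive_eq H _; rewrite addr0; exact: mulr1.
Qed.

Lemma times_derivable_affine k g (a b : R) : times_derivable k g ->
  times_derivable k (fun x => g (a * x + b)).
Proof.
elim: k g => //= k IH g [g' gg' g'k].
exists (fun x => a * g' (a * x + b)); last first.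
  by apply: times_derivableM; [exact: times_derivable_cst|exact: IH].
move=> x; rewrite mulrC.
exact: (@is_derive1_comp _ g (fun x => a * x + b) x _ _ (gg' (a * x + b)) (is_derive_affine a b x)).
Qed.

(* All the derivatives of [exp (- 1 / x)] extended by 0 are combinations of
   these. *)
Definition flat m (x : R) : R := if 0 < x then x^-1 ^+ m * expR (- x^-1) else 0.

(** For [y = 1 / x], one term of the exponential series gives [exp y >= y ^ (m + 2) / (m + 2)!]. The
    factor [x] that remains makes [flat] differentiable at 0. *)
Lemma flat_bound m (x : R) : 0 < x -> `|flat m.+1 x| <= (m.+2)`!%:R * x.
Proof.
move=> x0; rewrite /flat x0 ger0_norm; last by rewrite mulr_ge0 ?expR_ge0// exprn_ge0// invr_ge0 ltW.
have y0 : 0 < x^-1 by rewrite invr_gt0.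
have H := expR_ge1Dxn m.+1 (ltW y0).
rewrite expRN ler_pdivrMr ?expR_gt0//.
have H' : x^-1 ^+ m.+2 / m.+2`!%:R <= expR x^-1 by apply: le_trans H; rewrite lerDr.
have f0 : 0 < m.+2`!%:R :> R by rewrite ltr0n fact_gt0.
rewrite ler_pdivrMr// in H'.
have -> : x^-1 ^+ m.+1 = x * x^-1 ^+ m.+2 by rewrite [in RHS]exprS mulVKf// gt_eqF.
by rewrite [_%:R * x]mulrC -mulrA ler_pM2l// mulrC.
Qed.

Lemma is_derive_near f g (d x : R) : {near x, f =1 g} -> is_derive x (1 : R) f d ->
  is_derive x (1 : R) g d.
Proof.
move=> fg [df <-]; apply: DeriveDef; first exact: near_eq_derivable fg df.
by apply/esym; apply: near_eq_derive.
Qed.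

Lemma is_derive_flat m (x : R) :
  is_derive x (1 : R) (flat m) (flat m.+2 x - m%:R * flat m.+1 x).
Proof.
have [x0|x0|<-] := ltgtP 0 x.
- have xn0 : x != 0 by rewrite gt_eqF.
  have dV : is_derive x (1 : R) (fun x => x^-1) (- x ^- 2 * 1).
    exact: (@is_deriveV1 id _ _ xn0).
  have dE : is_derive x (1 : R) (expR \o (fun x => - x^-1)) (expR (- x^-1) * - (- x ^- 2 * 1)).
    exact: is_derive1_comp.
  apply: (@is_derive_near ((fun x => x^-1) ^+ m * (expR \o (fun x => - x^-1)))).
    have : \forall y \near x, 0 < y by exact: (@cvgr_gt _ _ _ _ id x cvg_id _ x0).
    by apply: filterS => y y0; rewrite /flat y0 exprfctE.
  apply: is_derive_eq (is_deriveM (is_deriveX m dV) dE) _.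
  rewrite /flat x0 exprfctE /= mulr1 opprK; set E := expR _.
  rewrite -![_ *: _]/(_ * _) -exprVn.
  by case: m => [|m]; rewrite ?exprS ?expr0 /=; ring.
- apply: (@is_derive_near (cst 0)).
    have : \forall y \near x, y < 0 by exact: (@cvgr_lt _ _ _ _ id x cvg_id _ x0).
    by apply: filterS => y y0; rewrite /flat ltNge ltW.
  by apply: is_derive_eq; rewrite /flat !ltNge !ltW//= mulr0 subr0.
- have flat0 k : flat k 0 = 0 by rewrite /flat ltxx.
  rewrite !flat0 mulr0 subr0.
  have H : (fun h => h^-1 *: ((flat m \o shift 0) (h *: 1) - flat m 0)) @ (0 : R)^' --> (0 : R).
    apply/cvgrPdist_lt => e e0.
    have f0 : 0 < m.+2`!%:R :> R by rewrite ltr0n fact_gt0.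
    have : \forall h \near (0 : R)^', `|h| < e / m.+2`!%:R by apply: dnbhs0_lt; rewrite divr_gt0.
    apply: filterS => h he; rewrite sub0r normrN flat0 subr0 /= addr0 [h *: 1]mulr1.
    have [h0|h0] := ltP 0 h; last first.
      have -> : flat m h = 0 by rewrite /flat ifF//; apply/negbTE; rewrite -leNgt.
      by rewrite [_ *: 0]mulr0 normr0.
    (* The difference quotient at 0 is again of the family, so [flat_bound] applies. *)
    have -> : h^-1 *: flat m h = flat m.+1 h.
      by rewrite /flat h0 exprS -mulrA.
    apply: le_lt_trans (flat_bound m h0) _.
    by rewrite mulrC -ltr_pdivlMr//; rewrite gtr0_norm in he.
  by apply: DeriveDef; [apply/cvg_ex; exists 0|exact: cvg_lim H].
Qed.

Lemma times_derivable_flat k m : times_derivable k (flat m).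
Proof.
elim: k m => //= k IH m; exists (fun x => flat m.+2 x + (- m%:R) * flat m.+1 x).
  by move=> x; rewrite mulNr; exact: is_derive_flat.
apply: times_derivableD => //; apply: times_derivableM => //.
exact: times_derivable_cst.
Qed.

(** The quotient [u / (u + v)], where [u] vanishes up to 1/4 and [v] from 3/4 on, so that the
    denominator has no zero. *)
Lemma smooth_step : exists b : R -> R, [/\ forall k, times_derivable k b,
  forall x, 0 <= b x <= 1, forall x, x <= 1 / 4 -> b x = 0 &
  forall x, 3 / 4 <= x -> b x = 1].
Proof.
pose u (x : R) := flat 0 (1 * x + - (1 / 4)); pose v (x : R) := flat 0 (- 1 * x + 3 / 4).
have u0 x : 0 <= u x by rewrite /u /flat; case: ifP => // _; rewrite mulr_ge0 ?expR_ge0.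
have v0 x : 0 <= v x by rewrite /v /flat; case: ifP => // _; rewrite mulr_ge0 ?expR_ge0.
have uv x : 0 < u x + v x.
  rewrite lt_neqAle addr_ge0// andbT eq_sym paddr_eq0//; apply/negP => /andP[].
  rewrite /u /v /flat; case: ifPn => [_|H1 _]; first by rewrite expr0 mul1r gt_eqF// expR_gt0.
  case: ifPn => [_|H2 _]; first by rewrite expr0 mul1r gt_eqF// expR_gt0.
  by move: H1 H2; rewrite -!leNgt; lra.
exists (fun x => u x * (u x + v x)^-1); split=> [k|x|x x4|x x34].
- apply: times_derivableM.
    by apply: (times_derivable_affine (g := flat 0)); exact: times_derivable_flat.
  apply: times_derivableV; first by move=> x; rewrite gt_eqF.
  apply: times_derivableD.
    by apply: (times_derivable_affine (g := flat 0)); exact: times_derivable_flat.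
  by apply: (times_derivable_affine (g := flat 0)); exact: times_derivable_flat.
- rewrite divr_ge0 ?addr_ge0//= ler_pdivrMr// mul1r lerDl//.
- suff -> : u x = 0 by rewrite mul0r.
  by rewrite /u /flat ifF//; apply/negbTE; rewrite -leNgt; lra.
- have vx : v x = 0 by rewrite /v /flat ifF//; apply/negbTE; rewrite -leNgt; lra.
  by have := uv x; rewrite vx addr0 => /lt0r_neq0 ux; rewrite divff.
Qed.

End SmoothStep.

(** * Smoothness under a change of time *)

Section TimeReparametrization.
Context {R : realType} (n k : nat).
Local Notation E := (R^o * 'rV[R]_n)%type.
Local Notation W := 'rV[R]_k.
Local Notation dt := ((1, 0) : E).

Lemma is_derive_time (V : normedModType R) (f : E -> V) (s : R) y d :
  is_derive ((s, y) : E) dt f d -> is_derive s (1 : R) (fun s => f (s, y)) d.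
Proof.
move=> [df <-].
have q : (fun h : R => h^-1 *: (((fun s : R => f (s, y)) \o shift s) (h *: (1 : R)) - f (s, y))) =
         (fun h : R => h^-1 *: ((f \o shift ((s, y) : E)) (h *: dt) - f (s, y))).
  apply/funext => h /=; congr (_ *: (f (_, _) - _)).
  by rewrite /= scaler0 add0r.
by apply: DeriveDef; rewrite /derivable /derive q.
Qed.

(* The mean value theorem in the time variable, uniformly in the space
   variable. *)
Lemma time_increment (f : E -> R) (d : E -> R) (x : E) :
  (\forall z \near x, is_derive z dt (f : E -> R^o) (d z)) -> {for x, continuous d} ->
  forall e, 0 < e -> exists2 r, 0 < r & forall s y, `|x.1 - s| < r -> `|x.2 - y| < r ->
    `|f (s, y) - f (x.1, y) - (s - x.1) * d x| <= e * `|s - x.1|.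
Proof.
move=> df cd e e0; have /cvgrPdist_lt/(_ e e0) := cd => Hd.
have [r /= r0 Hr] := (nbhs_normP _ _).1 (filterI df Hd).
exists r => // s y sr yr.
have box u : `|x.1 - u| < r -> is_derive ((u, y) : E) dt (f : E -> R^o) (d (u, y)) /\ `|d x - d (u, y)| < e.
  by move=> ur; apply: Hr; rewrite /ball_ /= -[Num.norm _]/(Num.max _ _) gt_max ur.
have [c [H1 H2]] : exists c, `|x.1 - c| < r /\ f (s, y) - f (x.1, y) = d (c, y) * (s - x.1).
  have mvt a b : a <= b -> (forall c, a <= c <= b -> `|x.1 - c| < r) -> exists c, a <= c <= b /\
      f (b, y) - f (a, y) = d (c, y) * (b - a).
    move=> ab Hab.
    have der c : a <= c <= b -> is_derive (c : R) (1 : R) (fun u => f (u, y) : R) (d (c, y)).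
      by move=> /Hab /box[+ _]; exact: (@is_derive_time R^o f).
    have [|c|c cab fE] := @MVT_segment R (fun u => f (u, y)) (fun u => d (u, y)) a b ab.
    - by move=> c /subset_itv_oo_cc; rewrite in_itv /=; exact: der.
    - move: c; apply: derivable_within_continuous => c; rewrite in_itv /= => /der H.
      exact: ex_derive.
    - by exists c; split=> //; move: cab; rewrite in_itv.
  have [xs|sx] := leP x.1 s.
    have [|c [/andP[c1 c2] fE]] := mvt x.1 s xs.
      by move=> c /andP[c1 c2]; move: sr; rewrite !ler0_norm ?subr_le0//; lra.
    by exists c; split=> //; move: sr; rewrite !ler0_norm ?subr_le0//; lra.
  have [|c [/andP[c1 c2] fE]] := mvt s x.1 (ltW sx).
    by move=> c /andP[c1 c2]; move: sr; rewrite !ger0_norm ?subr_ge0//; lra.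
  exists c; split; first by move: sr; rewrite !ger0_norm ?subr_ge0//; lra.
  by rewrite -opprB fE -mulrN opprB.
rewrite H2 mulrC -mulrBr normrM mulrC; apply: ler_wpM2r => //.
by rewrite distrC; apply: ltW; exact: (box c H1).2.
Qed.

Lemma is_derive_cvg (V V' : normedModType R) (f : V -> V') x v d : is_derive x v f d ->
  h^-1 *: (f (h *: v + x) - f x) @[h --> (0 : R)^'] --> d.
Proof. by move=> [df <-]; exact: df. Qed.

Lemma is_derive_coord (V : normedModType R) (f : V -> W) x v i j : derivable f x v ->
  is_derive x v (fun z => f z i j : R^o) ('D_v f x i j).
Proof.
move=> /derivableP/is_derive_cvg H.
have {}H : h^-1 *: (f (h *: v + x) i j - f x i j : R^o) @[h --> (0 : R)^'] --> 'D_v f x i j.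
  have -> : (fun h : R => h^-1 *: (f (h *: v + x) i j - f x i j : R^o)) =
      (fun h => (h^-1 *: (f (h *: v + x) - f x)) i j) by apply/funext => h; rewrite !mxE.
  exact: cvg_comp H (@coord_continuous _ _ _ i j _).
by apply: DeriveDef; [apply/cvg_ex; eexists; exact: H|exact: cvg_lim H].
Qed.

(** Only directional derivatives of [f] are given, so the increment is split: [Q1] changes the time
    at a moving point of space, where [time_increment] is uniform, and [Q2] changes the space
    variable at a fixed time. *)
Lemma is_derive_reparam (f : E -> W) (g : R -> R) (dg t a : R) (y v : 'rV[R]_n) :
  is_derive t (1 : R) g dg ->
  (\forall z \near ((g t, y) : E), derivable f z dt) ->
  {for ((g t, y) : E), continuous ('D_dt f)} ->
  derivable f ((g t, y) : E) ((0, v) : E) ->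
  is_derive ((t, y) : E) ((a, v) : E) (fun z : E => f (g z.1, z.2))
    ((a * dg) *: 'D_dt f (g t, y) + 'D_((0, v) : E) f (g t, y)).
Proof.
move=> gd df cd dv; set x : E := (g t, y).
pose q (h : R) := g (a * h + t).
have q0 : q 0 = g t by rewrite /q mulr0 add0r.
have Dq : is_derive (0 : R) (1 : R) q (dg * a).
  have gd' : is_derive (a * 0 + t) (1 : R) g dg by rewrite mulr0 add0r.
  exact: (@is_derive1_comp _ g (fun h => a * h + t) 0 _ _ gd' (is_derive_affine a t 0)).
have dq : h^-1 * (q h - g t) @[h --> (0 : R)^'] --> a * dg.
  have := is_derive_cvg Dq; rewrite mulrC q0.
  by under eq_fun do rewrite [_ *: (1 : R)]mulr1 addr0.
have cq : q h @[h --> (0 : R)^'] --> g t.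
  rewrite -q0; apply: (cvg_trans (cvg_app q (@nbhs_dnbhs _ (0 : R)))).
  have dq1 : derivable q 0 1 by exact: ex_derive.
  exact: (differentiable_continuous ((derivable1_diffP _ _).1 dq1)).
have Q1 : h^-1 *: (f (q h, h *: v + y) - f (g t, h *: v + y)) @[h --> (0 : R)^'] --> (a * dg) *: 'D_dt f x.
  apply: cvg_mx => i j; apply/cvgrPdist_lt => e e0.
  (* [B] bounds the difference quotients of [q] near 0, thanks to the 1 in the minimum below, and
     [D] the time derivative; each of the two error terms then takes [e / 2]. *)
  pose B := `|a * dg| + 1.
  have B0 : 0 < B by rewrite ltr_wpDl.
  pose d1 (z : E) := 'D_dt f z i j.
  have [|||r r0 Hr] := @time_increment (fun z => f z i j) d1 x _ _ (e / (2 * B)).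
  - by apply: filterS df => z; exact: is_derive_coord.
  - by apply: (@cvg_comp _ _ _ ('D_dt f) (fun A : W => A i j) _ (nbhs ('D_dt f x))); [exact: cd|exact: coord_continuous].
  - by rewrite divr_gt0// mulr_gt0.
  pose D := `|d1 x| + 1; have D0 : 0 < D by rewrite ltr_wpDl.
  have eD : 0 < Num.min 1 (e / (2 * D)) by rewrite lt_min ltr01 divr_gt0// mulr_gt0.
  have /cvgrPdist_lt/(_ _ eD) N1 := dq.
  have /cvgrPdist_lt/(_ _ r0) N2 := cq.
  have cv : h *: v + y @[h --> (0 : R)^'] --> y.
    rewrite -[X in _ --> X]add0r -(scale0r v).
    apply: (cvg_trans (cvg_app _ (@nbhs_dnbhs _ (0 : R)))).
    by apply: cvgD; [apply: cvgZ; [exact: cvg_id|exact: cvg_cst]|exact: cvg_cst].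
  have /cvgrPdist_lt/(_ _ r0) N3 := cv.
  near=> h.
  have h1 : `|a * dg - h^-1 * (q h - g t)| < Num.min 1 (e / (2 * D)) by near: h.
  have h3 : `|g t - q h| < r by near: h.
  have h4 : `|y - (h *: v + y)| < r by near: h.
  move: h1; rewrite lt_min => /andP[h1 h2].
  have := Hr (q h) (h *: v + y) h3 h4.
  rewrite !mxE -/(d1 x); cbn [fst x].
  set F := f (q h, _) i j - _; set rem := F - _ => Hrem.
  pose u := h^-1 * (q h - g t); rewrite -/u in h1 h2.
  have FE : F = (q h - g t) * d1 x + rem by rewrite /rem addrC subrK.
  have -> : a * dg * d1 x - h^-1 * F = (a * dg - u) * d1 x - h^-1 * rem.
    by rewrite FE /u; ring.
  have R1 : `|(a * dg - u) * d1 x| < e / 2.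
    rewrite normrM; apply: (@le_lt_trans _ _ (`|a * dg - u| * D)).
      by apply: ler_wpM2l => //; rewrite lerDl.
    have -> : e / 2 = e / (2 * D) * D by rewrite invfM mulrA mulfVK// gt_eqF.
    by rewrite ltr_pM2r.
  have uB : `|u| < B.
    have := ler_normB (a * dg) (a * dg - u); rewrite opprB addrC subrK => H.
    by apply: (le_lt_trans H); rewrite ltrD2l.
  have R2 : `|h^-1 * rem| <= e / 2.
    rewrite normrM; apply: (@le_trans _ _ (e / (2 * B) * `|u|)).
      by rewrite /u normrM mulrCA; apply: ler_wpM2l.
    have -> : e / 2 = e / (2 * B) * B by rewrite invfM mulrA mulfVK// gt_eqF.
    by apply: ler_wpM2l; [rewrite divr_ge0// ?mulr_ge0// ltW|exact: ltW].
  apply: le_lt_trans (ler_normB _ _) _; lra.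
have Q2 : h^-1 *: (f (g t, h *: v + y) - f (g t, y)) @[h --> (0 : R)^'] --> 'D_((0, v) : E) f x.
  have := is_derive_cvg (derivableP dv).
  have -> // : (fun h : R => h^-1 *: (f (h *: ((0, v) : E) + x) - f x)) =
    (fun h : R => h^-1 *: (f (g t, h *: v + y) - f (g t, y))).
  apply/funext => h; congr (_ *: (f (_, _) - _)).
  by rewrite /= scaler0 add0r.
have H : (fun h => h^-1 *: (((fun z : E => f (g z.1, z.2)) \o shift ((t, y) : E)) (h *: ((a, v) : E)) - f (g t, y)))
   @ (0 : R)^' --> (a * dg) *: 'D_dt f x + 'D_((0, v) : E) f x.
  have -> : (fun h => h^-1 *: (((fun z : E => f (g z.1, z.2)) \o shift ((t, y) : E)) (h *: ((a, v) : E)) - f (g t, y))) =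
    (fun h => h^-1 *: (f (q h, h *: v + y) - f (g t, h *: v + y)) + h^-1 *: (f (g t, h *: v + y) - f (g t, y))).
    apply/funext => h /=; rewrite -scalerDr addrA subrK /q; congr (_ *: (f (g _, _) - _)).
    by rewrite /= mulrC.
  exact: cvgD Q1 Q2.
by apply: DeriveDef; [apply/cvg_ex; eexists; exact: H|exact: cvg_lim H].
Unshelve. all: by end_near. Qed.

Lemma is_derive_fst (g : R -> R) (dg t a : R) (y v : 'rV[R]_n) : is_derive t (1 : R) g dg ->
  is_derive ((t, y) : E) ((a, v) : E) (fun z : E => g z.1 : R^o) (a * dg).
Proof.
move=> gd.
have Dq : is_derive (0 : R) (1 : R) (fun h => g (a * h + t)) (dg * a).
  have gd' : is_derive (a * 0 + t) (1 : R) g dg by rewrite mulr0 add0r.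
  exact: (@is_derive1_comp _ g (fun h => a * h + t) 0 _ _ gd' (is_derive_affine a t 0)).
have H := is_derive_cvg Dq.
have {}H : (fun h => h^-1 *: (((fun z : E => g z.1 : R^o) \o shift ((t, y) : E)) (h *: ((a, v) : E)) - g t))
   @ (0 : R)^' --> a * dg.
  have F h : h^-1 *: (((fun z : E => g z.1 : R^o) \o shift ((t, y) : E)) (h *: ((a, v) : E)) - g t) =
      h^-1 *: (g (a * (h *: 1 + 0) + t) - g (a * 0 + t) : R^o).
    by rewrite /= [h *: (1 : R)]mulr1 addr0 mulr0 add0r (mulrC a h).
  by rewrite mulrC (eq_cvg _ _ F).
by apply: DeriveDef; [apply/cvg_ex; eexists; exact: H|exact: cvg_lim H].
Qed.

Lemma is_derive_scale (V V' : normedModType R) (c : V -> R) (f : V -> V') x v dc df :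
  is_derive x v (c : V -> R^o) dc -> is_derive x v f df ->
  is_derive x v (fun z => c z *: f z) (dc *: f x + c x *: df).
Proof.
move=> /is_derive_cvg Hc /is_derive_cvg Hf.
have fx : f (h *: v + x) @[h --> (0 : R)^'] --> f x.
  have id0 : (h : R) @[h --> (0 : R)^'] --> (0 : R) by exact: nbhs_dnbhs.
  have : h *: (h^-1 *: (f (h *: v + x) - f x)) + f x @[h --> (0 : R)^'] --> f x.
    by rewrite -[X in _ --> X]add0r -(scale0r df); apply: cvgD; [exact: cvgZ|exact: cvg_cst].
  move=> H; apply: cvg_trans H; apply: near_eq_cvg; near=> h.
  by rewrite scalerA divff ?scale1r ?subrK//; near: h; exact: nbhs_dnbhs_neq.
have H : (fun h => h^-1 *: (((fun z => c z *: f z) \o shift x) (h *: v) - c x *: f x))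
   @ (0 : R)^' --> dc *: f x + c x *: df.
  have := cvgD (cvgZ Hc fx) (cvgZ (cvg_cst (c x)) Hf).
  have E h : h^-1 *: (((fun z => c z *: f z) \o shift x) (h *: v) - c x *: f x) =
    (h^-1 *: (c (h *: v + x) - c x : R^o)) *: f (h *: v + x) + c x *: (h^-1 *: (f (h *: v + x) - f x)).
    rewrite [RHS](_ : _ = h^-1 *: ((c (h *: v + x) - c x) *: f (h *: v + x)) +
      h^-1 *: (c x *: (f (h *: v + x) - f x))); last by rewrite !scalerA [c x * _]mulrC.
    by rewrite -scalerDr; congr (_ *: _); rewrite scalerBl scalerBr addrA subrK.
  rewrite (eq_cvg _ _ E) => HH; apply: HH.
by apply: DeriveDef; [apply/cvg_ex; eexists; exact: H|exact: cvg_lim H].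
Unshelve. all: by end_near. Qed.

Definition smooth_scalar (g : R -> R) := forall m, times_derivable m g.

Lemma smooth_scalar_derive1 g : smooth_scalar g ->
  (forall x, is_derive x (1 : R) g (derive1 g x)) /\ smooth_scalar (derive1 g).
Proof.
move=> sg; split=> [x|m].
  have [g' gg' _] := sg 1%N; apply: DeriveDef; first by case: (gg' x).
  by rewrite derive1E.
have [g' gg' g'm] := sg m.+1.
suff -> : derive1 g = g' by [].
by apply/funext => x; rewrite derive1E derive_val.
Qed.

Lemma smooth_scalarM f g : smooth_scalar f -> smooth_scalar g -> smooth_scalar (fun x => f x * g x).
Proof. by move=> sf sg m; exact: times_derivableM. Qed.

Lemma smooth_scalar_cst (c : R) : smooth_scalar (fun=> c).
Proof. by move=> m; exact: times_derivable_cst. Qed.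

Lemma smooth_scalar_continuous g : smooth_scalar g -> continuous g.
Proof.
move=> /smooth_scalar_derive1[dg _] x.
by apply: (@differentiable_continuous _ _ _ x g); apply/derivable1_diffP; case: (dg x).
Qed.

Section SmoothReparam.
Variables (U : set E) (f : E -> W) (g : R -> R).
Hypotheses (oU : open U) (sf : smooth_on U f) (sg : smooth_scalar g).

Let warp (z : E) : E := (g z.1, z.2).

Let U' : set E := warp @^-1` U.

Let warp_cont : continuous warp.
Proof.
apply: cont_pair; last exact: cont_snd.
by apply: cont_comp; [exact: cont_fst|exact: smooth_scalar_continuous].
Qed.

Let oU' : open U'.
Proof. by apply: open_comp => // z _; exact: warp_cont. Qed.

(* The iterated derivatives of the reparametrized map are sums of such terms. *)
Let terms (L : seq ((R -> R) * seq E)) (z : E) : W :=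
  \sum_(p <- L) p.1 z.1 *: iter_derive p.2 f (warp z).

Let smooth_terms (L : seq ((R -> R) * seq E)) := forall p, List.In p L -> smooth_scalar p.1.

(** Leibniz and chain rules: the derivative falls on the coefficient, on the reparametrized time or
    on the space variable. *)
Let dterm (a : R) v (p : (R -> R) * seq E) : seq ((R -> R) * seq E) :=
  [:: (fun x => a * derive1 p.1 x, p.2); (fun x => p.1 x * (a * derive1 g x), dt :: p.2);
      (p.1, ((0, v) : E) :: p.2)].

Let term_derive p z a v : smooth_scalar p.1 -> U' z ->
  is_derive z ((a, v) : E) (fun z => p.1 z.1 *: iter_derive p.2 f (warp z)) (terms (dterm a v p) z).
Proof.
case: p z => c s [t y] /= sc Uz.
have [dc _] := smooth_scalar_derive1 sc; have [dg _] := smooth_scalar_derive1 sg.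
have [cs ds] := sf s Uz.
have H1 := @is_derive_fst c _ t a y v (dc t).
have H2 : is_derive ((t, y) : E) ((a, v) : E) (fun z => iter_derive s f (warp z))
    ((a * derive1 g t) *: 'D_dt (iter_derive s f) (g t, y) + 'D_((0, v) : E) (iter_derive s f) (g t, y)).
  apply: is_derive_reparam => //.
  - have : \forall z \near ((g t, y) : E), U z by apply: open_nbhs_nbhs.
    by apply: filterS => z /(sf s)[_]; exact.
  - by have [] := sf (dt :: s) Uz.
apply: is_derive_eq (is_derive_scale H1 H2) _.
by rewrite /terms !big_cons big_nil /= addr0 scalerDr scalerA.
Qed.

Let terms_derive L z a v : smooth_terms L -> U' z ->
  is_derive z ((a, v) : E) (terms L) (terms (flatten (map (dterm a v) L)) z).
Proof.
move=> sL Uz; elim: L sL => [|p L IH] sL.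
  rewrite /terms /= big_nil; have -> : (fun z => \sum_(p <- [::]) p.1 z.1 *: iter_derive p.2 f (warp z)) = cst 0.
    by apply/funext => z'; rewrite big_nil.
  exact: is_derive_cst.
have -> : terms (p :: L) = (fun z => p.1 z.1 *: iter_derive p.2 f (warp z)) + terms L.
  by apply/funext => z'; rewrite /terms big_cons.
have -> : terms (flatten (map (dterm a v) (p :: L))) z =
    terms (dterm a v p) z + terms (flatten (map (dterm a v) L)) z by rewrite /terms -big_cat.
apply: is_deriveD.
  by apply: term_derive => //; apply: sL; left.
by apply: IH => q Lq; apply: sL; right.
Qed.

Let smooth_dterms L a v : smooth_terms L -> smooth_terms (flatten (map (dterm a v) L)).
Proof.
move=> sL; elim: L sL => [|p L IH] sL q //=.
have sp : smooth_scalar p.1 by apply: sL; left.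
have [_ dp] := smooth_scalar_derive1 sp; have [_ dg] := smooth_scalar_derive1 sg.
move=> [<-|[<-|[<-|Lq]]] //=.
- by apply: smooth_scalarM => //; exact: smooth_scalar_cst.
- by apply: smooth_scalarM => //; apply: smooth_scalarM => //; exact: smooth_scalar_cst.
- by apply: IH Lq => r Lr; apply: sL; right.
Qed.

Let terms_cont L z : smooth_terms L -> U' z -> {for z, continuous (terms L)}.
Proof.
move=> sL Uz; elim: L sL => [|p L IH] sL.
  have -> : terms [::] = cst 0 by apply/funext => z'; rewrite /terms big_nil.
  exact: cst_continuous.
have -> : terms (p :: L) = (fun z => p.1 z.1 *: iter_derive p.2 f (warp z)) + terms L.
  by apply/funext => z'; rewrite /terms big_cons.
apply: cvgD; last by apply: IH => q Lq; apply: sL; right.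
apply: cvgZ.
  apply: (@continuous_comp _ _ _ (fun z : E => z.1)); first exact: cvg_fst.
  by apply: smooth_scalar_continuous; apply: sL; left.
apply: (@continuous_comp _ _ _ warp); first exact: warp_cont.
by have [] := sf p.2 Uz.
Qed.

Lemma smooth_on_reparam : smooth_on U' (fun z => f (warp z)).
Proof.
suff H s : exists2 L, smooth_terms L & forall z, U' z -> iter_derive s (fun z => f (warp z)) z = terms L z.
  move=> s z Uz; have [L sL EL] := H s.
  have N : {near z, terms L =1 iter_derive s (fun z => f (warp z))}.
    have : \forall z' \near z, U' z' by apply: open_nbhs_nbhs.
    by apply: filterS => z' /EL.
  split.
    apply: cvg_trans; first exact: near_eq_cvg N.
    by rewrite -[nbhs (iter_derive _ _ _)]/(nbhs _) EL//; exact: terms_cont.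
  move=> [a v]; apply: near_eq_derivable N _.
  by case: (terms_derive a v sL Uz).
elim: s => [|[a v] s [L sL EL]].
  exists [:: (fun=> 1, [::])].
    by move=> p [<-|//]; exact: smooth_scalar_cst.
  by move=> z _; rewrite /terms big_seq1 scale1r.
exists (flatten (map (dterm a v) L)); first exact: smooth_dterms.
move=> z Uz /=; rewrite (@near_eq_derive _ _ _ _ (terms L)).
  by have [_ ->] := terms_derive a v sL Uz.
have : \forall z' \near z, U' z' by apply: open_nbhs_nbhs.
by apply: filterS => z' /EL.
Qed.

End SmoothReparam.

End TimeReparametrization.

From mathcomp Require Import measurable_realfun.
Import Defs.

(** * Primitives on the unit interval *)

Section Integrals.
Context {R : realType}.

Lemma primitive_exists (c : R -> R) : continuous c ->
  exists C : R -> R, forall x : R, 0 <= x <= 1 -> is_derive x (1 : R) C (c x).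
Proof.
(* Integrating from -1, inside [-1, 2], makes 0 and 1 interior points, with two-sided
   derivatives. *)
move=> cc; exists (fun x => \int[lebesgue_measure]_(t in [set` Interval (BLeft (-1)) (BRight x)]) c t).
move=> x /andP[x0 x1].
have ic : lebesgue_measure.-integrable [set` Interval (BLeft (-1)) (BRight 2)] (EFin \o c).
  apply: continuous_compact_integrable; first exact: segment_compact.
  exact: continuous_subspaceT.
have [||d1 d2] := @continuous_FTC1 R c (BLeft (-1)) x 2 _ ic _ (cc x).
- by lra.
- by rewrite /Order.lt /=; lra.
by apply: DeriveDef => //; rewrite -derive1E.
Qed.

(** The integrand may differ from [g] at the end points: the velocity of a loop there involves its
    values outside [0, 1]. *)
Lemma ftc_itv01 (f g P : R -> R) : (forall x : R, 0 <= x <= 1 -> is_derive x (1 : R) P (g x)) ->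
  continuous g -> (forall t, 0 < t < 1 -> f t = g t) ->
  \int[lebesgue_measure]_(t in `[0, 1]) f t = P 1 - P 0.
Proof.
move=> dP cg fg.
have cP x : 0 <= x <= 1 -> {for x, continuous P}.
  move=> /dP[dPx _].
  exact: (differentiable_continuous ((derivable1_diffP _ _).1 dPx)).
have E : (\int[lebesgue_measure]_(t in `[0%R, 1%R]) (f t)%:E = \int[lebesgue_measure]_(t in `[0%R, 1%R]) (g t)%:E)%E.
  have cgo : {within (`]0%R, 1%R[%classic : set R), continuous g} by exact: continuous_subspaceT.
  have cfo : {within (`]0%R, 1%R[%classic : set R), continuous f}.
    by apply: subspace_eq_continuous cgo => x; rewrite inE /= in_itv /= => H; rewrite /from_subspace fg.
  rewrite integral_itv_bndoo; last first.
    by apply/measurable_EFinP; apply: subspace_continuous_measurable_fun.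
  rewrite [RHS]integral_itv_bndoo; last first.
    by apply/measurable_EFinP; apply: subspace_continuous_measurable_fun.
  by apply: eq_integral => x; rewrite inE /= in_itv /= => H; rewrite fg.
rewrite /Rintegral E (@continuous_FTC2 _ g P)//.
- exact: continuous_subspaceT.
- split.
  + by move=> x; rewrite in_itv /= => /andP[x0 x1]; have [] := dP x; rewrite ?ltW.
  + by apply: cvg_at_right_filter; apply: cP; lra.
  + by apply: cvg_at_left_filter; apply: cP; lra.
- by move=> x; rewrite in_itv /= => /andP[x0 x1]; rewrite derive1E; have [] := dP x; rewrite ?ltW.
Qed.

End Integrals.

Lemma continuous_pair_at (S T U : topologicalType) (f : S -> T) (g : S -> U) x :
  {for x, continuous f} -> {for x, continuous g} ->
  {for x, continuous (fun x => (f x, g x))}.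
Proof. by move=> cf cg; exact: (cvg_pair cf cg). Qed.

(** * Smoothness as a local property *)

Section NearSmooth.
Context {R : realType} {V W : normedModType R}.

Lemma near_eq_iter_derive (f g : V -> W) (x : V) s : {near x, f =1 g} ->
  {near x, iter_derive s f =1 iter_derive s g}.
Proof.
move=> fg; elim: s => [|v s IH] //=.
have := near_join IH; apply: filterS => y; exact: near_eq_derive.
Qed.

Lemma near_eq_smooth (f g : V -> W) (x : V) s : {near x, f =1 g} ->
  {for x, continuous (iter_derive s f)} /\ (forall v, derivable (iter_derive s f) x v) ->
  {for x, continuous (iter_derive s g)} /\ (forall v, derivable (iter_derive s g) x v).
Proof.
move=> fg [cf df]; have N := near_eq_iter_derive s fg; split.
  apply: cvg_trans; first exact: near_eq_cvg N.
  by rewrite -[nbhs (iter_derive s g x)]/(nbhs _) -(nbhs_singleton N).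
by move=> v; apply: near_eq_derivable N _; exact: df.
Qed.

Lemma iter_derive_snd (s : seq (R^o * V)) (f : V -> W) z :
  iter_derive s (fun z : R^o * V => f z.2) z = iter_derive (map snd s) f z.2.
Proof.
elim: s z => //= v s IH [t y].
by rewrite (_ : iter_derive s _ = fun z => iter_derive (map snd s) f z.2)//; exact/funext.
Qed.

Lemma smooth_on_snd (U : set V) (f : V -> W) : smooth_on U f ->
  smooth_on [set z : R^o * V | U z.2] (fun z => f z.2).
Proof.
move=> sf s [t y] /= Uy; have [c d] := sf (map snd s) y Uy.
have -> : iter_derive s (fun z : R^o * V => f z.2) = fun z => iter_derive (map snd s) f z.2.
  by apply/funext => z; exact: iter_derive_snd.
split; last by move=> [a v]; exact: d.
by apply: (@continuous_comp _ _ _ snd); [exact: cvg_snd|exact: c].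
Qed.

End NearSmooth.

(** * Velocities along smooth isotopies *)

Section Isotopies.
Context {R : realType} (M : manifold R).
Local Notation n := (dim M).
Local Notation E := (R^o * 'rV[R]_n)%type.
Local Notation dt := ((1, 0) : E).

Lemma phi_at i (p : M) : dom i p -> {for p, continuous (phi i)}.
Proof.
have := @phi_continuous _ M i; rewrite continuous_open_subspace; last exact: dom_open.
by move=> + ip; apply; rewrite inE.
Qed.

Lemma phi_inv_at i y : (phi i @` @dom _ M i) y -> {for y, continuous (phi_inv i)}.
Proof.
have := @phi_inv_continuous _ M i; rewrite continuous_open_subspace; last exact: phi_dom_open.
by move=> + iy; apply; rewrite inE.
Qed.

Variable F : R * M -> M.
Hypothesis F_smooth : smooth_isotopy F.

Definition isotopy_dom i j : set E :=
  [set ty | (phi i @` dom i) ty.2 /\ dom j (F (ty.1, phi_inv i ty.2))].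

Definition isotopy_rep i j (ty : E) : 'rV[R]_n := phi j (F (ty.1, phi_inv i ty.2)).

Lemma isotopy_dom_open i j : open (isotopy_dom i j).
Proof.
rewrite openE => -[t y] [/= iy jF]; rewrite /interior.
have c : {for ((t, y) : E), continuous (fun ty : E => F (ty.1, phi_inv i ty.2))}.
  apply: (@continuous_comp _ _ _ (fun ty : E => (ty.1 : R, phi_inv i ty.2)) F); last exact: F_smooth.1.
  apply: continuous_pair_at; first exact: cvg_fst.
  by apply: (@continuous_comp _ _ _ snd); [exact: cvg_snd|exact: phi_inv_at].
apply: filterI.
  have : open (phi i @` @dom _ M i) by exact: phi_dom_open.
  move=> o; apply: (@cvg_snd _ _ (nbhs (t : R^o)) (nbhs y)).
  by apply: open_nbhs_nbhs.
by apply: c; apply: open_nbhs_nbhs; split=> //; exact: dom_open.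
Qed.

(* The velocity at time [s] of the particle which is at [z] at time 0. *)
Definition speed i (s : R) (z : M) : 'rV[R]_n := derive1 (fun s => phi i (F (s, z))) s.

Lemma isotopy_domP i j s z : dom j z -> dom i (F (s, z)) -> isotopy_dom j i (s, phi j z).
Proof. by move=> jz iF; split=> /=; [exists z|rewrite phiK ?inE]. Qed.

Lemma speedE i j s z : dom j z -> dom i (F (s, z)) ->
  speed i s z = 'D_dt (isotopy_rep j i) (s, phi j z).
Proof.
move=> jz iF; have [_ d] := F_smooth.2 j i [::] _ (isotopy_domP jz iF).
have := is_derive_time (derivableP (d dt)).
rewrite /isotopy_rep /= phiK ?inE// => -[_ <-].
by rewrite /speed derive1E.
Qed.

Lemma is_derive_orbit i (b : R -> R) db t z : is_derive t (1 : R) b db -> dom i (F (b t, z)) ->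
  is_derive t (1 : R) (fun s => phi i (F (b s, z))) (db *: speed i (b t) z).
Proof.
move=> dbt iF; have [j _ jz] : (\bigcup_j @dom _ M j) z by rewrite dom_cover.
have Uz := isotopy_domP jz iF; rewrite (speedE jz iF).
have sf := F_smooth.2 j i.
have := @is_derive_reparam R n n (isotopy_rep j i) b db t 1 (phi j z) 0 dbt.
case=> [||| d1 d2].
- have : \forall x \near ((b t, phi j z) : E), isotopy_dom j i x.
    by apply: open_nbhs_nbhs; split=> //; exact: isotopy_dom_open.
  by apply: filterS => x /(sf [::] x)[_]; exact.
- by have [] := sf [:: dt] _ Uz.
- by have [_ d] := sf [::] _ Uz; exact: d.
have := is_derive_time (DeriveDef d1 d2).
rewrite mul1r derive0 addr0 /isotopy_rep /=.
by under eq_fun do rewrite phiK ?inE//.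
Qed.

Hypothesis M_compact : compact [set: M].

(* The graph of [Q] is closed and [M] is compact. *)
Lemma inverse_orbit_continuous (T : topologicalType) (s : T -> R) (Q : T -> M) q : continuous s ->
  (forall x z, F (s x, z) = q <-> z = Q x) -> continuous Q.
Proof.
move=> cs FQ x0 U; rewrite nbhsE => -[U' [oU' QU'] sU'].
have cK : compact (~` U').
  by apply: subclosed_compact M_compact _ => //; exact: open_closedC.
have /compact_near_coveringP/(_ T (nbhs x0) (fun x z => F (s x, z) <> q)) := cK.
have H : forall z, (~` U') z -> \forall z' \near z & x \near x0, F (s x, z') <> q.
  move=> z zU; have Fq : F (s x0, z) != q.
    by apply/eqP => /FQ zQ; apply: zU; rewrite zQ.
  have cF : {for ((z, x0) : M * T), continuous (fun zx : M * T => F (s zx.2, zx.1))}.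
    apply: (@continuous_comp _ _ _ (fun zx : M * T => (s zx.2, zx.1)) F); last exact: F_smooth.1.
    apply: continuous_pair_at; last exact: cvg_fst.
    by apply: (@continuous_comp _ _ _ snd s); [exact: cvg_snd|exact: cs].
  have nq : nbhs (F (s x0, z)) (~` [set q]).
    apply: open_nbhs_nbhs; split; last exact/eqP.
    apply: closed_openC; apply: compact_closed; first exact: manifold_hausdorff.
    exact: compact_set1.
  exact: cF nq.
move=> /(_ _ H); apply: filterS => x Hx; apply: sU'.
by have [//|nU] := pselect (U' (Q x)); have := Hx _ nU; case; apply/FQ.
Qed.

Lemma speed_continuous (T : topologicalType) (s : T -> R) (Q : T -> M) i q : continuous s ->
  dom i q -> (forall x z, F (s x, z) = q <-> z = Q x) ->
  continuous (fun x => speed i (s x) (Q x)).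
Proof.
move=> cs iq FQ x0; have cQ := inverse_orbit_continuous cs FQ.
have FE x : F (s x, Q x) = q by apply/FQ.
have [j _ jz] : (\bigcup_j @dom _ M j) (Q x0) by rewrite dom_cover.
have iF x : dom i (F (s x, Q x)) by rewrite FE.
have N : {near x0, (fun x => 'D_dt (isotopy_rep j i) (s x, phi j (Q x))) =1 (fun x => speed i (s x) (Q x))}.
  have : \forall x \near x0, dom j (Q x).
    by apply: cQ; apply: open_nbhs_nbhs; split=> //; exact: dom_open.
  by apply: filterS => x jx; rewrite (speedE jx).
apply: cvg_trans; first exact: near_eq_cvg N.
rewrite /= (speedE jz (iF x0)).
apply: (@continuous_comp _ _ _ (fun x => (s x, phi j (Q x)) : E) ('D_dt (isotopy_rep j i)) x0).
  apply: continuous_pair_at; first exact: cs.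
  by apply: (@continuous_comp _ _ _ Q); [exact: cQ|exact: phi_at].
by have [] := F_smooth.2 j i [:: dt] _ (isotopy_domP jz (iF x0)).
Qed.

End Isotopies.

(** * The doubled loop and its flux form *)

Section Doubling.
Context {R : realType} (M : manifold R) (w : symplectic_form M).
Local Notation n := (dim M).
Local Notation E := (R^o * 'rV[R]_n)%type.
Hypothesis M_compact : compact [set: M].

Lemma symp_inv_uniq (f : symp w) p q : f p = q <-> p = symp_inv f q.
Proof. by split=> [<-|->]; [rewrite symp_funK|rewrite symp_invK]. Qed.

Variable psi : symp_loop w.
Variable F : R * M -> M.
Hypotheses (F_smooth : smooth_isotopy F)
  (F_psi : forall t p, 0 <= t <= 1 -> F (t, p) = psi t p).
Variable beta : R -> R.
Hypotheses (beta_smooth : smooth_scalar beta) (beta01 : forall x, 0 <= beta x <= 1)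
  (beta0 : forall x, x <= 1 / 4 -> beta x = 0) (beta1 : forall x, 3 / 4 <= x -> beta x = 1).

(** [b1] moves within [1/8, 3/8] and [b2] within [5/8, 7/8]; between 3/8 and 5/8 both branches of
    [psi2] are the identity, an overlap that makes the gluing smooth. *)
Let b1 t := beta (2 * t + 0).
Let b2 t := beta (2 * t + -1).

Let b1_late t : 3 / 8 <= t -> b1 t = 1. Proof. by move=> ?; apply: beta1; lra. Qed.

Let b2_early t : t <= 5 / 8 -> b2 t = 0. Proof. by move=> ?; apply: beta0; lra. Qed.

Let b1_smooth : smooth_scalar b1. Proof. by move=> m; exact: times_derivable_affine. Qed.

Let b2_smooth : smooth_scalar b2. Proof. by move=> m; exact: times_derivable_affine. Qed.

Let psi2 t : symp w := if t <= 1 / 2 then psi (b1 t) else psi (b2 t).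

Let F2 (tp : R * M) : M := if tp.1 <= 1 / 2 then F (b1 tp.1, tp.2) else F (b2 tp.1, tp.2).

Let F2_psi2 t p : F2 (t, p) = psi2 t p.
Proof. by rewrite /F2 /psi2 /=; case: ifP => _; rewrite F_psi// beta01. Qed.

Let psi2_left t : t < 5 / 8 -> psi2 t = psi (b1 t).
Proof.
by move=> t58; rewrite /psi2; case: leP => // ?; rewrite b1_late ?b2_early ?loop0 ?loop1//; lra.
Qed.

Let psi2_right t : 3 / 8 < t -> psi2 t = psi (b2 t).
Proof.
by move=> t58; rewrite /psi2; case: leP => // ?; rewrite b1_late ?b2_early ?loop0 ?loop1//; lra.
Qed.

Let F2_left t p : t < 5 / 8 -> F2 (t, p) = F (b1 t, p).
Proof. by move=> t58; rewrite F2_psi2 psi2_left// F_psi// beta01. Qed.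

Let F2_right t p : 3 / 8 < t -> F2 (t, p) = F (b2 t, p).
Proof. by move=> t58; rewrite F2_psi2 psi2_right// F_psi// beta01. Qed.

(** Before time 5/8 the first branch describes [F2] and after 3/8 the second, so near any time a
    single reparametrization of [F] is involved. *)
Let F2_smooth : smooth_isotopy F2.
Proof.
have [cF _] := F_smooth.
have cb (b : R -> R) : smooth_scalar b -> continuous (fun tp : R * M => F (b tp.1, tp.2)).
  move=> /smooth_scalar_continuous cb; apply: cont_comp cF.
  apply: cont_pair; last exact: cont_snd.
  by apply: cont_comp cb; exact: cont_fst.
split.
  apply: (@paste_continuous _ _ _ (fun tp : R * M => tp.1)); [exact: cont_fst|exact: cb|exact: cb|].
  by move=> [t p] /= ->; rewrite b1_late ?b2_early ?F_psi ?loop0 ?loop1//; lra.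
move=> i j s [t y] [/= iy jF].
have H (b : R -> R) : smooth_scalar b -> F2 (t, phi_inv i y) = F (b t, phi_inv i y) ->
    {near ((t, y) : E), (fun ty : E => isotopy_rep F i j (b ty.1, ty.2)) =1 isotopy_rep F2 i j} ->
    {for ((t, y) : E), continuous (iter_derive s (isotopy_rep F2 i j))} /\
    (forall v, derivable (iter_derive s (isotopy_rep F2 i j)) (t, y) v).
  move=> sb FE N; apply: near_eq_smooth N _.
  apply: (smooth_on_reparam (isotopy_dom_open F_smooth (i := i) (j := j)) (F_smooth.2 i j) sb).
  by split=> //=; rewrite -FE.
have [t58|t58] := ltP t (1 / 2).
  apply: (H b1) => //; first by rewrite F2_left//; lra.
  have : \forall z \near ((t, y) : E), z.1 < 5 / 8.
    by apply: (@cvgr_lt R E (nbhs ((t, y) : E)) _ (fun z : E => z.1 : R) t); [exact: cvg_fst|lra].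
  by apply: filterS => -[u z] /= u58; rewrite /isotopy_rep /= F2_left.
apply: (H b2) => //; first by rewrite F2_right//; lra.
have : \forall z \near ((t, y) : E), 3 / 8 < z.1.
  by apply: (@cvgr_gt R E (nbhs ((t, y) : E)) _ (fun z : E => z.1 : R) t); [exact: cvg_fst|lra].
by apply: filterS => -[u z] /= u58; rewrite /isotopy_rep /= F2_right.
Qed.

Let psi2_loop : exists psi' : symp_loop w, forall t, psi' t = psi2 t.
Proof.
have P2 : smooth_path psi2 by exists F2; [exact: F2_smooth|move=> t p _; exact: F2_psi2].
have S2 t : 0 <= t <= 1 -> @Symp0 _ _ w (psi2 t).
  by move=> _; rewrite /psi2; case: ifP => _; apply: loop_Symp0; exact: beta01.
have p0 : psi2 0 = symp_id w by rewrite psi2_left; [rewrite /b1 beta0 ?loop0//; lra|lra].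
have p1 : psi2 1 = symp_id w by rewrite psi2_right; [rewrite /b2 beta1 ?loop1//; lra|lra].
by exists (SympLoop P2 S2 p0 p1).
Qed.

Section FluxAt.
Variables (i : idx M) (q : M) (a : 'I_n).
Hypothesis iq : dom i q.

(** Outside [0, 1] the loop is arbitrary; clamping the time makes the integrand continuous on the
    whole line. *)
Let cl (t : R) : R := val (clamp t : unitI R).

Let cl01 t : 0 <= cl t <= 1. Proof. exact: val_unitI. Qed.

Let clK t : 0 <= t <= 1 -> cl t = t.
Proof. by move=> /andP[t0 t1]; rewrite /cl val_clamp min_r// max_r. Qed.

Let Q t := symp_inv (psi (cl t)) q.

Let FQ x z : F (cl x, z) = q <-> z = Q x.
Proof. by rewrite F_psi//; exact: symp_inv_uniq. Qed.

(** The coefficient of the contraction of the symplectic form at [q], where the particle that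
    started at [Q t] passes at time [t]. *)
Let c (t : R) : R := (speed F i (cl t) (Q t) *m w i q) 0 a.

Let cl_cont : continuous cl.
Proof. by apply: cont_val; apply: cont_clamp; exact: cont_id. Qed.

Let c_cont : continuous c.
Proof.
have cs := speed_continuous F_smooth M_compact cl_cont iq FQ.
have := cont_comp (cont_comp cs (@mulmxr_continuous R 1 n n (w i q))) (@coord_continuous R 1 n 0 a).
exact.
Qed.

Let velocity_psi t : 0 < t < 1 -> (velocity psi t i q *m w i q) 0 a = c t.
Proof.
move=> /andP[t0 t1]; have t01 : 0 <= t <= 1 by rewrite !ltW.
rewrite /c /Q (clK t01).
suff -> : velocity psi t i q = speed F i t (symp_inv (psi t) q) by [].
rewrite /velocity /speed !derive1E; apply: near_eq_derive.
have N0 : \forall u \near t, 0 < u by exact: (@cvgr_gt _ _ _ _ id t cvg_id).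
have N1 : \forall u \near t, u < 1 by exact: (@cvgr_lt _ _ _ _ id t cvg_id).
by apply: filterS2 N0 N1 => u u0 u1; rewrite F_psi// !ltW.
Qed.

Let g2 t := derive1 b1 t * c (b1 t) + derive1 b2 t * c (b2 t).

Let velocity_branch (b : R -> R) t : smooth_scalar b -> 0 <= b t <= 1 -> psi2 t = psi (b t) ->
  (\forall s \near t, forall p, psi2 s p = F (b s, p)) ->
  (velocity psi2 t i q *m w i q) 0 a = derive1 b t * c (b t).
Proof.
move=> sb b01 pE N; have [db _] := smooth_scalar_derive1 sb.
have Fq : F (b t, symp_inv (psi2 t) q) = q by rewrite pE F_psi// symp_invK.
have iF : dom i (F (b t, symp_inv (psi2 t) q)) by rewrite Fq.
have H := is_derive_orbit F_smooth (db t) iF.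
have -> : velocity psi2 t i q = derive1 b t *: speed F i (b t) (symp_inv (psi2 t) q).
  case: H => _ <-; rewrite /velocity derive1E; apply: near_eq_derive.
  by apply: filterS N => s ->.
by rewrite -scalemxAl mxE /c /Q (clK b01) pE.
Qed.

Let locally_constant_derive1 (b : R -> R) t k : (\forall s \near t, b s = k) -> derive1 b t = 0.
Proof. by move=> N; rewrite derive1E (near_eq_derive _ N) derive_cst. Qed.

Let velocity_psi2 t : (velocity psi2 t i q *m w i q) 0 a = g2 t.
Proof.
rewrite /g2; have [t58|t58] := ltP t (1 / 2).
  have N : \forall s \near t, s < 5 / 8 by apply: (@cvgr_lt _ _ _ _ id t cvg_id); lra.
  rewrite (@locally_constant_derive1 b2 t 0); last by apply: filterS N => s /ltW/b2_early.
  rewrite mul0r addr0; apply: velocity_branch; [exact: b1_smooth|exact: beta01| |].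
    by apply: psi2_left; lra.
  by apply: filterS N => s s58 p; rewrite -F2_psi2 F2_left.
have N : \forall s \near t, 3 / 8 < s by apply: (@cvgr_gt _ _ _ _ id t cvg_id); lra.
rewrite (@locally_constant_derive1 b1 t 1); last by apply: filterS N => s /ltW/b1_late.
rewrite mul0r add0r; apply: velocity_branch; [exact: b2_smooth|exact: beta01| |].
  by apply: psi2_right; lra.
by apply: filterS N => s s58 p; rewrite -F2_psi2 F2_right.
Qed.

Lemma flux_form_double :
  flux_form psi2 i q 0 a = flux_form psi i q 0 a + flux_form psi i q 0 a.
Proof.
have b10 : b1 0 = 0 by apply: beta0; lra.
have b11 : b1 1 = 1 by apply: beta1; lra.
have b20 : b2 0 = 0 by apply: beta0; lra.
have b21 : b2 1 = 1 by apply: beta1; lra.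
have [C dC] := primitive_exists c_cont.
have E1 : flux_form psi i q 0 a = C 1 - C 0.
  rewrite /flux_form mxE; apply: (@ftc_itv01 R _ c C dC c_cont) => t; exact: velocity_psi.
have [d1 s1] := smooth_scalar_derive1 b1_smooth; have [d2 s2] := smooth_scalar_derive1 b2_smooth.
(* [beta01] keeps the arguments of [C] in [0, 1], where [C] is a primitive of [c]. *)
have dP x : 0 <= x <= 1 -> is_derive (x : R) (1 : R) (fun t => C (b1 t) + C (b2 t)) (g2 x).
  move=> _; have H1 := @is_derive1_comp _ C b1 x _ _ (dC _ (beta01 _)) (d1 x).
  have H2 := @is_derive1_comp _ C b2 x _ _ (dC _ (beta01 _)) (d2 x).
  have := is_deriveD H1 H2; rewrite /g2 ![c _ * _]mulrC; exact.
have g2_cont : continuous g2.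
  apply: (@contD _ R^o); apply: contM.
  - exact: smooth_scalar_continuous.
  - by apply: cont_comp c_cont; exact: smooth_scalar_continuous.
  - exact: smooth_scalar_continuous.
  - by apply: cont_comp c_cont; exact: smooth_scalar_continuous.
have E2 : flux_form psi2 i q 0 a = C (b1 1) + C (b2 1) - (C (b1 0) + C (b2 0)).
  rewrite /flux_form mxE; apply: (@ftc_itv01 R _ g2 _ dP g2_cont) => t _; exact: velocity_psi2.
apply: (etrans E2); rewrite b10 b11 b20 b21.
apply: etrans _ (esym (congr2 +%R E1 E1)); move: (C 1) (C 0) => u v; ring.
Qed.

End FluxAt.

Lemma double_loop_with : exists psi' : symp_loop w, forall i q, dom i q ->
  flux_form psi' i q = flux_form psi i q + flux_form psi i q.
Proof.
have [psi' E] := psi2_loop; exists psi' => i q iq.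
have -> : (psi' : R -> symp w) = psi2 by exact/funext.
by apply/rowP => a; rewrite flux_form_double// !mxE.
Qed.

End Doubling.

From mathcomp Require Import generic_quotient ring_quotient.
Import Defs.

Local Open Scope quotient_scope.

(** * Closed forms modulo exact forms *)

Section SmoothScaling.
Context {R : realType} {V W : normedModType R} (U : set V) (c : R) (f : V -> W).
Hypotheses (oU : open U) (sf : smooth_on U f).

Lemma iter_deriveZ s x : U x -> iter_derive s (c \*: f) x = c *: iter_derive s f x.
Proof.
elim: s x => //= v s IH x Ux.
rewrite (@near_eq_derive _ _ _ _ (c \*: iter_derive s f)); last first.
  have : \forall y \near x, U y by apply: open_nbhs_nbhs.
  by apply: filterS => y; exact: IH.
by rewrite deriveZ//; exact: (sf s Ux).2.
Qed.

Lemma smooth_onZ : smooth_on U (c \*: f).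
Proof.
move=> s x Ux; have [cs ds] := sf s Ux.
have N : {near x, c \*: iter_derive s f =1 iter_derive s (c \*: f)}.
  have : \forall y \near x, U y by apply: open_nbhs_nbhs.
  by apply: filterS => y Uy; rewrite iter_deriveZ.
split.
  apply: cvg_trans; first exact: near_eq_cvg N.
  by rewrite -(nbhs_singleton N); apply: cvgZ; [exact: cvg_cst|exact: cs].
by move=> v; apply: near_eq_derivable N _; apply: derivableZ; exact: ds.
Qed.

End SmoothScaling.

Section ClosedForms.
Context {R : realType} (M : manifold R).
Implicit Types al be : preform1 M.

Lemma phi_inv_dom i y : (phi i @` @dom _ M i) y -> dom i (phi_inv i y).
Proof. by move=> [x ix <-]; rewrite phiK ?inE. Qed.

(* Only the values of a form on the domains of the charts matter. *)
Lemma eq_closed_form1 al be : (forall i q, dom i q -> al i q = be i q) ->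
  is_closed_form1 be -> is_closed_form1 al.
Proof.
move=> E [beC beS beD].
have N i y : (phi i @` @dom _ M i) y -> {near y, be i \o phi_inv i =1 al i \o phi_inv i}.
  move=> iy; have : \forall z \near y, (phi i @` @dom _ M i) z.
    by apply: open_nbhs_nbhs; split=> //; exact: phi_dom_open.
  by apply: filterS => z /phi_inv_dom iz /=; rewrite E.
split=> [i j p ip jp|i s y iy|i p a b ip].
- by rewrite !E//; exact: beC.
- by apply: near_eq_smooth (N i y iy) _; exact: beS.
- have P k : partial i k (al i) p = partial i k (be i) p.
    rewrite /partial; apply/esym; apply: near_eq_derive.
    by apply: N; exists p.
  by rewrite !P; exact: beD.
Qed.

Lemma scale_closed_form1 (c : R) be : is_closed_form1 be ->
  is_closed_form1 (fun i p => c *: be i p).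
Proof.
move=> [beC beS beD].
have oi i := @phi_dom_open _ M i.
split=> [i j p ip jp|i|i p a b ip].
- by rewrite (beC i j)// scalemxAl.
- exact: (smooth_onZ c (oi i) (beS i)).
- have P k : partial i k (fun p => c *: be i p) p = c *: partial i k (be i) p.
    rewrite /partial; have ipp : (phi i @` dom i) (phi i p) by exists p.
    exact: (deriveZ c ((beS i [::] _ ipp).2 _)).
  by rewrite !P !mxE; congr (_ * _); exact: beD.
Qed.

Lemma pi_H1D (al be : closed_form1 M) :
  \pi_(H1 M) (al + be) = \pi_(H1 M) al + \pi_(H1 M) be :> H1 M.
Proof. exact: (Quotient.pi_add (exact_form1_pred (M := M))). Qed.

Lemma pi_H10 : \pi_(H1 M) (0 : closed_form1 M) = 0 :> H1 M.
Proof. by apply: (@addrI (H1 M) (\pi_(H1 M) (0 : closed_form1 M))); rewrite -pi_H1D !addr0. Qed.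

Lemma pi_H1Mn (al : closed_form1 M) m : \pi_(H1 M) (al *+ m) = \pi_(H1 M) al *+ m :> H1 M.
Proof. by elim: m => [|m IH]; rewrite ?mulr0n ?pi_H10// !mulrS pi_H1D IH. Qed.

Lemma pi_H1_eq (al be : closed_form1 M) :
  \pi_(H1 M) al = \pi_(H1 M) be :> H1 M <-> al - be \in exact_form1_pred (M := M).
Proof.
by split=> [H|]; [rewrite Quotient.idealrBE; apply/eqP|rewrite Quotient.idealrBE => /eqP].
Qed.

Lemma form1D (al be : closed_form1 M) i p : form1 (al + be) i p = form1 al i p + form1 be i p.
Proof. by []. Qed.

Lemma form1Mn (al : closed_form1 M) m i p : form1 (al *+ m) i p = form1 al i p *+ m.
Proof. by elim: m => [|m IH]; rewrite ?mulr0n// !mulrS form1D IH. Qed.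

(** If [m] times a form is the differential of [f], then the form is the differential of [f / m]. *)
Lemma H1_torsion_free (x : H1 M) m : (0 < m)%N -> x *+ m = 0 -> x = 0.
Proof.
move=> m0; rewrite -[x]reprK; move: (repr x) => al.
rewrite -pi_H1Mn -pi_H10 => /pi_H1_eq; rewrite subr0 => /asboolP[f fS fE].
apply/pi_H1_eq; rewrite subr0; apply/asboolP.
have m0' : m%:R != 0 :> R by rewrite pnatr_eq0 -lt0n.
exists (m%:R^-1 \*: f) => [i|i p a ip].
  exact: (smooth_onZ m%:R^-1 (@phi_dom_open _ M i) (fS i)).
have ipp : (phi i @` dom i) (phi i p) by exists p.
rewrite /partial [RHS](deriveZ m%:R^-1 ((fS i [::] _ ipp).2 _)) -[X in _ *: X]/(partial i a f p) -fE//.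
rewrite form1Mn mulmxnE -[RHS]/(m%:R^-1 * _) -[X in _ = _ * X]mulr_natl.
by rewrite mulKf.
Qed.

Variable w : symplectic_form M.

Lemma flux_closed (psi : R -> symp w)
    (cl : flux_form psi \in closed_form1_pred (M := M)) :
  flux psi = \pi_(H1 M) (ClosedForm1 cl).
Proof. by rewrite /flux /insubd insubT. Qed.

Lemma flux_not_closed (psi : R -> symp w) :
  flux_form psi \notin closed_form1_pred (M := M) -> flux psi = 0.
Proof. by move=> ncl; rewrite /flux /insubd insubN// -pi_H10. Qed.

(** [flux] takes the default value 0 on forms that are not closed. On the chart domains one form is
    twice the other, so they are closed together, and the equation holds in both cases. *)
Lemma flux_double (psi psi' : R -> symp w) :
  (forall i q, dom i q -> flux_form psi' i q = flux_form psi i q + flux_form psi i q) ->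
  flux psi' = flux psi + flux psi.
Proof.
move=> E.
have [cl|ncl] := boolP (flux_form psi \in closed_form1_pred (M := M)).
  have cl' : flux_form psi' \in closed_form1_pred (M := M).
    apply/asboolP; apply: (@eq_closed_form1 _ (fun i p => 2 *: flux_form psi i p)).
      by move=> i q iq; rewrite E// scaler_nat mulr2n.
    by apply: scale_closed_form1; exact/asboolP.
  rewrite (flux_closed cl') (flux_closed cl) -pi_H1D; apply/pi_H1_eq; apply/asboolP.
  exists 0 => [i|i p a ip]; first exact: smooth_on0.
  have -> : partial i a (0 : M -> R^o) p = 0 by exact: derive_cst.
  have F (al be : closed_form1 M) : form1 (al - (be + be)) i p = form1 al i p - (form1 be i p + form1 be i p) by [].
  apply: (etrans (congr1 (fun v : 'rV_(dim M) => v 0 a) (F (ClosedForm1 cl') (ClosedForm1 cl)))).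
  have G : flux_form psi' i p - (flux_form psi i p + flux_form psi i p) = 0 by rewrite E// subrr.
  by apply: (etrans (congr1 (fun v : 'rV_(dim M) => v 0 a) G)); rewrite mxE.
have ncl' : flux_form psi' \notin closed_form1_pred (M := M).
  apply: contra ncl => /asboolP cl'; apply/asboolP.
  apply: (@eq_closed_form1 _ (fun i p => 2^-1 *: flux_form psi' i p)); last exact: scale_closed_form1.
  move=> i q iq; have n2 : (2 : R) != 0 by rewrite pnatr_eq0.
  by rewrite E// -[X in _ *: X]mulr2n -[X in _ *: X]scaler_nat scalerA (mulVf n2) scale1r.
by rewrite (flux_not_closed ncl) (flux_not_closed ncl') addr0.
Qed.

End ClosedForms.

(** * Doubling, centrality and triviality of evaluations *)

Section Loops.
Context {R : realType} (M : manifold R) (w : symplectic_form M).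
Hypothesis M_compact : compact [set: M].

Lemma double_loop (psi : symp_loop w) :
  exists psi' : symp_loop w, flux psi' = flux psi + flux psi.
Proof.
have [F sF FE] := loop_smooth psi.
have [b [sb b01 b0 b1]] := @smooth_step R.
have [psi' E] := double_loop_with M_compact sF (fun t p t01 => FE t p t01) sb b01 b0 b1.
by exists psi'; exact: flux_double.
Qed.

(** [Gamma] is a range over loops, so a loop must exist for it to contain 0. *)
Lemma symp_loop_exists : exists psi : symp_loop w, True.
Proof.
have P : smooth_path (fun _ : R => symp_id w).
  exists (fun tp => tp.2) => //; split; first exact: cont_snd.
  move=> i j s [t y] [/= [x ix xy] jy].
  apply: (smooth_on_snd (@transition_smooth _ M i j)) => /=.
  by exists x => //; split=> //; move: jy; rewrite -xy phiK ?inE.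
have S (t : R) : 0 <= t <= 1 -> @Symp0 _ _ w (symp_id w).
  by move=> _; apply: connected_component_refl.
by exists (SympLoop P S erefl erefl).
Qed.

Variable x0 : M.

(** In the square of pairs of a time for [psi] and a time for [g], the two concatenations follow the
    two pairs of sides from (0, 0) to (1, 1); linear interpolation inside the square gives the
    homotopy. *)
Lemma ev_central (psi : symp_loop w) : group_center (pi1 R x0) (ev x0 psi).
Proof.
move=> b; rewrite -[b]reprK; move: (repr b) => {b} g.
have E1 := pi_pi1_mul (orbit_loop x0 psi) g; have E2 := pi_pi1_mul g (orbit_loop x0 psi).
apply: etrans (esym E1) (etrans _ E2); apply/eqmodP; apply/asboolP.
have [F [cF _] FE] := loop_smooth psi.
have g0 : g zero = x0 by exact: (path_zero (s := g)).
have g1 : g one = x0 by exact: (path_one (s := g)).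
(* [P] runs from 0 to 1 in the first half of the time and [Q] in the second. *)
pose P (s : unitI R) : R := val (clamp (2 * val s) : unitI R).
pose Q (s : unitI R) : R := val (clamp (2 * val s - 1) : unitI R).
pose K (sv : unitI R * unitI R) : M :=
  F (val (clamp ((1 - val sv.2) * P sv.1 + val sv.2 * Q sv.1) : unitI R),
     g (clamp ((1 - val sv.2) * Q sv.1 + val sv.2 * P sv.1))).
have KE s v : K (s, v) = psi (val (clamp ((1 - val v) * P s + val v * Q s) : unitI R))
    (g (clamp ((1 - val v) * Q s + val v * P s))).
  by rewrite /K FE// val_unitI.
have cP : continuous P.
  apply: cont_val; apply: cont_clamp; apply: contM; first exact: (@cont_cst _ R^o).
  by apply: cont_val; exact: cont_id.
have cQ : continuous Q.
  apply: cont_val; apply: cont_clamp; apply: (@contB _ R^o); last exact: (@cont_cst _ R^o).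
  apply: contM; first exact: (@cont_cst _ R^o).
  by apply: cont_val; exact: cont_id.
have mix (u v : unitI R -> R) : continuous u -> continuous v ->
    continuous (fun sv : unitI R * unitI R => (1 - val sv.2) * u sv.1 + val sv.2 * v sv.1).
  move=> cu cv; have c2 : continuous (fun sv : unitI R * unitI R => val sv.2 : R).
    by apply: cont_val; exact: cont_snd.
  apply: (@contD _ R^o); apply: contM => //.
  - by apply: (@contB _ R^o) => //; exact: (@cont_cst _ R^o).
  - by apply: cont_comp cu; exact: cont_fst.
  - by apply: cont_comp cv; exact: cont_fst.
have cg : continuous g by exact: cts_fun.
exists K; split.
- apply: cont_comp cF; apply: cont_pair.
    by apply: cont_val; apply: cont_clamp; exact: mix.
  by apply: cont_comp cg; apply: cont_clamp; exact: mix.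
- move=> s; rewrite KE val_zero subr0 !mul1r !mul0r !addr0 /P /Q !clampK.
  rewrite -[concat _ _ s]/(concat_fun _ _ s) /concat_fun.
  have [s2|s2] := leP (val s) (1 / 2 : R).
    by rewrite (@clamp_le0 _ (2 * val s - 1)) ?clamp0 ?g0//; lra.
  by rewrite (@clamp_ge1 _ (2 * val s)) ?clamp1 ?val_one ?loop1//; lra.
- move=> s; rewrite KE val_one subrr !mul1r !mul0r !add0r /P /Q !clampK.
  rewrite -[concat _ _ s]/(concat_fun _ _ s) /concat_fun.
  have [s2|s2] := leP (val s) (1 / 2 : R).
    by rewrite (@clamp_le0 _ (2 * val s - 1)) ?clamp0 ?val_zero ?loop0//; lra.
  by rewrite (@clamp_ge1 _ (2 * val s)) ?clamp1 ?g1//; lra.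
- have P0 : P zero = 0 by rewrite /P val_zero mulr0 clamp0 val_zero.
  have Q0 : Q zero = 0.
    by rewrite /Q val_zero mulr0 sub0r clamp_le0 ?clamp0 ?val_zero//; lra.
  have P1 : P one = 1.
    by rewrite /P val_one mulr1 clamp_ge1 ?clamp1 ?val_one//; lra.
  have Q1 : Q one = 1 by rewrite /Q val_one dbl_one clamp1 val_one.
  move=> v; rewrite !KE P0 Q0 P1 Q1 !mulr0 !mulr1 !addr0 subrK.
  by rewrite clamp0 clamp1 val_zero val_one loop0 loop1 g0 g1.
Qed.

Lemma ev_null (M_connected : connected [set: M]) (psi : symp_loop w) :
  euler_char R M != 0 -> ev x0 psi = \pi_(pi1 R x0) (const_loop x0).
Proof.
move=> chi0.
(* The default value of [euler_char] is 0, so a nonzero value does satisfy the definition. *)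
have hchi : is_euler_char R M (euler_char R M).
  have [ex|nex] := pselect (exists chi, is_euler_char R M chi); first exact: xgetPex.
  by move: chi0; rewrite /euler_char xgetPN ?eqxx// => chi hchi; apply: nex; exists chi.
have [m [iota [r [delta [ci rK d0 cr]]]]] := compact_manifold_enr M_compact x0.
have [F [cF _] FE] := loop_smooth psi.
pose f (t : unitI R) p := F (val t, p).
have cf : continuous (fun p : unitI R * M => f p.1 p.2).
  apply: cont_comp cF; apply: cont_pair; last exact: cont_snd.
  by apply: cont_val; exact: cont_fst.
have f0 p : f zero p = p by rewrite /f val_zero FE ?lexx ?ler01// loop0.
have f1 p : f one p = p by rewrite /f val_one FE ?lexx ?ler01// loop1.
have H := orbit_freely_null x0 ci rK d0 cr M_compact M_connected cf f0 f1 x0 hchi chi0.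
apply/eqmodP; apply: freely_null_homotopic.
have -> // : (orbit_loop x0 psi : unitI R -> M) = fun s => f s x0.
by apply/funext => s; rewrite /f FE ?val_unitI.
Qed.

End Loops.

(** * Vanishing of the fluxes *)

Section Zmodules.
Variables (V : zmodType) (T : Type) (f : T -> V) (D : T -> T).
Hypothesis fD : forall t, f (D t) = f t + f t.

Lemma iter_double t k : f (iter k D t) = f t *+ 2 ^ k.
Proof. by elim: k => [|k IH]; rewrite ?expn0 ?mulr1n//= fD IH expnS mul2n -addnn mulrnDr. Qed.

Lemma double_fixed_eq0 t : f t = f (D t) -> f t = 0.
Proof. by move=> E; apply: (@addrI _ (f t)); rewrite -fD -E addr0. Qed.

Hypothesis torsion_free : forall (x : V) m, (0 < m)%N -> x *+ m = 0 -> x = 0.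

Lemma iter_double_eq0 t i j : (i < j)%N -> f (iter i D t) = f (iter j D t) -> f t = 0.
Proof.
move=> ij; rewrite !iter_double => H.
have lt : (2 ^ i < 2 ^ j)%N by rewrite ltn_exp2l.
have m0 : (0 < 2 ^ j - 2 ^ i)%N by rewrite subn_gt0.
by apply: (torsion_free m0); rewrite (mulrnBr _ (ltnW lt)) H subrr.
Qed.

End Zmodules.

Lemma pigeonhole (T : choiceType) (A : set T) (u : nat -> T) : finite_set A ->
  (forall k, A (u k)) -> exists i j, (i < j)%N /\ u i = u j.
Proof.
move=> fin Au; apply: contrapT => N; apply: infinite_nat.
have -> : [set: nat] = u @^-1` A by apply/seteqP; split=> // k _; exact: Au.
apply: finite_preimage fin => i j _ _ E.
have [ij|ij|//] := ltngtP i j; exfalso; apply: N; first by exists i, j.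
by exists j, i.
Qed.

Section FluxEvaluation.
Context {R : realType} {M : manifold R} {w : symplectic_form M} {x0 : M}.
Variable e : Gamma w -> pi1 R x0.
Hypotheses (e_hom : is_e_homomorphism e) (e_inj : injective e).

Lemma flux_in_Gamma (psi : symp_loop w) : (flux psi : H1 M) \in Gamma w.
Proof. by apply/mem_set; exists psi. Qed.

Lemma eq_flux_of_ev (psi psi' : symp_loop w) : ev x0 psi = ev x0 psi' -> flux psi = flux psi'.
Proof.
move=> E.
have E1 : e (SigSub (flux_in_Gamma psi)) = ev x0 psi by apply: e_hom.
have E2 : e (SigSub (flux_in_Gamma psi')) = ev x0 psi' by apply: e_hom.
exact: (congr1 val (e_inj (etrans E1 (etrans E (esym E2))))).
Qed.

Lemma Gamma_eq0 : (forall psi : symp_loop w, flux psi = 0) -> Gamma w = [set 0].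
Proof.
move=> flux0; apply/seteqP; split=> [_ [psi _ <-]|_ ->]; first exact: flux0.
by have [psi _] := symp_loop_exists w; exists psi.
Qed.

End FluxEvaluation.

Theorem proposition1p1 (R : realType) (M : manifold R) (w : symplectic_form M)
    (M_compact : compact [set: M]) (M_connected : connected [set: M])
    (x0 : M) (e : Gamma w -> pi1 R x0)
    (e_hom : is_e_homomorphism e) (e_inj : injective e)
    (chi_or_center :
      euler_char R M != 0 \/ finite_set (group_center (pi1 R x0))) :
  Gamma w = [set 0].
Proof.
have [D HD] := choice (double_loop M_compact (w := w)).
apply: Gamma_eq0 => psi; case: chi_or_center => [chi|fin].
  (* A loop and its double both have trivial evaluation, so the flux equals its own double. *)
  apply: (double_fixed_eq0 HD); apply: (eq_flux_of_ev e_hom e_inj).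
  exact: etrans (@ev_null R M w M_compact x0 M_connected psi chi)
    (esym (@ev_null R M w M_compact x0 M_connected (D psi) chi)).
have [i [j [ij E]]] := pigeonhole fin (fun k => @ev_central R M w x0 (iter k D psi)).
exact: (iter_double_eq0 HD (@H1_torsion_free R M) ij (eq_flux_of_ev e_hom e_inj E)).
Qed.
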